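(* Assume the setting in the context. Let $(u^0,w^0)\in V\times\mathcal M$ satisfy $u^0-w^0(r)\in K_r$ for $\mu$-a.e. $r$, and assume additionally that $\Delta u^0\in H$ and $f\in BV_r(0,T;H)$. Let $(u,w)$ be the exact solution of problem (P), and, for an arbitrary partition $0=t_0<\dots<t_N=T$ with $\tau=\max_n(t_n-t_{n-1})$, let $(u_\tau^n,w_\tau^n)_{n=0}^N$ be the implicit Euler solution (IE) initialized by $(u_\tau^0,w_\tau^0)=(u^0,w^0)$, with sampled data $f^0=f(0)$, $f^n=f(t_n)$ (using the left trace at $T$). Let $u_\tau,w_\tau$ be the continuous piecewise affine in time interpolants of the nodal values, and $\overline u_\tau(t)=u_\tau^n$ for $t\in(t_{n-1},t_n]$. Then $$\max\Big\{\max_{t\in[0,T]}\left(\|u(t)-u_\tau(t)\|^2+\|w(t)-w_\tau(t)\|_{\mathcal M}^2\right)^{1/2},\ \left(\|u-u_\tau\|_{L^2(0,T;V)}^2+\|u-\overline u_\tau\|_{L^2(0,T;V)}^2\right)^{1/2}\Big\}\le\frac{\tau}{\sqrt\kappa}\left[\frac1{\sqrt2}\|f(0)+\Delta u^0\|+2\operatorname{Var}(f;[0,T])\right].$$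
   Context: $\Omega\subset\mathbb R^d$ is a bounded Lipschitz domain, $T>0$, $H=L^2(\Omega)$ (real) with inner product $(\cdot,\cdot)_H$ and norm $\|\cdot\|$ (also used for vector fields), $V=H_0^1(\Omega)$ with $\|v\|_V=\|\nabla v\|$. Constitutive data: $(\mathcal R,\mathcal A,\mu)$ is a complete finite measure space with $\mu\ge 0$; $a\ge0$ and $\kappa:=1+a$; $c:\mathcal R\to(0,\infty)$ is measurable with $S_c:=\int_{\mathcal R}c\,d\mu<\infty$; for each $r\in\mathcal R$, $K_r\subset H$ is closed and convex with $0\in K_r$; and $\{(r,z)\in\mathcal R\times H: z\in K_r\}\in\mathcal A\otimes\mathcal B(H)$, where $\mathcal B(H)$ is the Borel $\sigma$-algebra. For closed convex $C\subset H$ and $x\in C$, $N_C(x)=\{\xi\in H:(\xi,y-x)_H\le0\ \forall y\in C\}$; $P_{K_r}$ is the metric projection of $H$ onto $K_r$. $\mathcal M:=L^2(\mathcal R,c\,d\mu;H)$ (Bochner space) with inner product $\langle z_1,z_2\rangle_{\mathcal M}=\int_{\mathcal R}c(r)(z_1(r),z_2(r))_H\,d\mu(r)$. $G:\mathcal M\to H$, $Gz:=\int_{\mathcal R}c(r)z(r)\,d\mu(r)$. Problem (P): find $u\in H^1(0,T;H)\cap L^2(0,T;V)$ and $w\in H^1(0,T;\mathcal M)$ such that $u(0)=u^0$, $w(0)=w^0$ and for a.e. $t\in(0,T)$: $\kappa(\partial_tu,\varphi)_H+(G\partial_tw,\varphi)_H+(\nabla u,\nabla\varphi)_H=(f,\varphi)_H$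 for all $\varphi\in V$; and, for $\mu$-a.e. $r$, $u-w(r)\in K_r$ and $\partial_tw(r)\in N_{K_r}(u-w(r))$. It has a unique solution. Scheme (IE): with $\tau_n=t_n-t_{n-1}$ and $\delta_nz^n=(z^n-z^{n-1})/\tau_n$, given $(u_\tau^0,w_\tau^0)\in V\times\mathcal M$ with $u_\tau^0-w_\tau^0(r)\in K_r$ for $\mu$-a.e. $r$, and $f^n\in H$, find $u_\tau^n\in V$, $w_\tau^n\in\mathcal M$, $n=1,\dots,N$, with $\kappa(\delta_nu_\tau^n,\varphi)_H+(G\delta_nw_\tau^n,\varphi)_H+(\nabla u_\tau^n,\nabla\varphi)_H=(f^n,\varphi)_H$ for all $\varphi\in V$ and $w_\tau^n(r)=u_\tau^n-P_{K_r}(u_\tau^n-w_\tau^{n-1}(r))$ for $\mu$-a.e. $r$. It has a unique solution. $BV_r(0,T;H)$ denotes the right-continuous representatives $f:[0,T]\to H$ of $H$-valued functions of bounded variation, with the value at $T$ fixed by the left trace; $\operatorname{Var}(f;[0,T])$ is the total variation in $H$. *)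

(* Defs.v *)
(* Conventions.
   - H = L^2(Omega) is the library's type of square-integrable measurable
     functions, which is not quotiented by a.e. equality: the L^2 norm is a
     seminorm on it, equality in H is stated as equality a.e., and closed sets
     and Borel sets of H are those of the seminorm topology (they are
     automatically saturated for a.e. equality).
   - Functions on Omega are functions on R^d, d = n + 1, integrated against the
     Lebesgue measure restricted to Omega.
   - An element of V = H^1_0(Omega) is a pair (v, grad v); in a product such as
     (u, phi)_H one uses the first component, in (grad u, grad phi)_H the second.
   - Bochner measurability, integrals and spaces are developed for functions
     with values in a set S (a linear subspace) of a left module X, with a
     function N : X -> R that is a seminorm on S. *)
From HB Require Import structures.
From mathcomp Require Import all_boot all_order all_algebra.
From mathcomp Require Import all_classical all_reals all_analysis.
From mathcomp Require Import lra.

Set Implicit Arguments.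
Unset Strict Implicit.
Unset Printing Implicit Defensive.

Import Order.TTheory GRing.Theory Num.Theory numFieldNormedType.Exports.

Local Open Scope classical_set_scope.
Local Open Scope ring_scope.

Section euclidean_space.
Context (R : realType).

(* R^n with the Borel sigma-algebra *)
Definition borelRn (n : nat) := g_sigma_algebraType (@open 'rV[R]_n).

Lemma open_borelRn n (A : set 'rV[R]_n) :
  open A -> measurable (A : set (borelRn n)).
Proof. exact: sub_sigma_algebra. Qed.

Lemma measurable_borelRn n d (T : measurableType d) (f : T -> borelRn n) :
  (forall A : set 'rV[R]_n, open A -> measurable (f @^-1` A)) ->
  measurable_fun [set: T] f.
Proof.
move=> mf; apply: (@measurability _ _ _ (borelRn n) _ _ (@open 'rV[R]_n)) => //.
by move=> _ [A oA <-]; rewrite setTI; exact: mf.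
Qed.

Definition consRn n (p : measurableTypeR R * borelRn n) : borelRn n.+1 :=
  \row_i oapp (fun j => p.2 ord0 j) p.1 (unlift ord0 i).
Definition headRn n (x : borelRn n.+1) : measurableTypeR R := x ord0 ord0.
Definition tailRn n (x : borelRn n.+1) : borelRn n :=
  \row_j x ord0 (lift ord0 j).

Lemma ball_consRn n (x : 'rV[R]_n.+1) (e : R) : 0 < e ->
  @consRn n @^-1` (ball x e) = ball (headRn x : R) e `*` ball (tailRn x : 'rV[R]_n) e.
Proof.
move=> e0; apply/seteqP; split => [[a v]/= [_ H]|[a v]/= [H1 [_ H2]]].
- split.
    have := H ord0 ord0; by rewrite mxE unlift_none.
  split=> // i j; have := H ord0 (lift ord0 j).
  by rewrite !mxE liftK /= !ord1.
- split=> // i j; rewrite !ord1; rewrite mxE; case: unliftP => [k ->|->] //=.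
  by have := H2 ord0 k; rewrite !mxE.
Qed.

Lemma dense_rat_rV n (x : 'rV[R]_n) (e : R) : 0 < e ->
  exists q : 'rV[rat]_n, ball (map_mx ratr q : 'rV[R]_n) e x.
Proof.
move=> e0.
have H (j : 'I_n) : exists q : rat, ball (ratr q : R) e (x ord0 j).
  have /rat_in_itvoo[q] : x ord0 j - e < x ord0 j + e by lra.
  rewrite in_itv/= => /andP[h1 h2]; exists q.
  by rewrite /ball/= ltr_norml; apply/andP; split; lra.
have [q qP] := choice H.
exists (\row_j q j); split=> // i j; rewrite ord1 !mxE; exact: qP.
Qed.

Lemma open_rat_cover n (A : set 'rV[R]_n) : open A ->
  A = \bigcup_(p : 'rV[rat]_n * nat)
        (if `[< ball (map_mx ratr p.1 : 'rV[R]_n) p.2.+1%:R^-1 `<=` A >]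
         then ball (map_mx ratr p.1 : 'rV[R]_n) p.2.+1%:R^-1 else set0).
Proof.
move=> oA; apply/seteqP; split; last first.
  by move=> x [p _]; case: asboolP => // pA px; exact: pA.
move=> x Ax; have /nbhs_ballP[e/= e0 eA] : nbhs x A by exact: open_nbhs_nbhs.
have [k ke] : exists k : nat, k.+1%:R^-1 < e / 2 :> R.
  have [N _ /(_ N (leqnn N)) /= NE] :=
    cvgr_lt (0 : R) (@cvg_harmonic R) (e / 2) ltac:(lra).
  by exists N.
have k0 : 0 < k.+1%:R^-1 :> R by rewrite invr_gt0.
have [q qx] := dense_rat_rV x k0.
exists (q, k) => //=; case: asboolP => // -[] y qy; apply: eA.
rewrite (splitr e); apply: (ball_triangle (y := map_mx ratr q : 'rV[R]_n)).
  by apply: ball_sym; apply: le_ball qx; exact: ltW.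
by apply: le_ball qy; exact: ltW.
Qed.

Lemma measurable_consRn n :
  measurable_fun [set: measurableTypeR R * borelRn n] (@consRn n).
Proof.
apply: measurable_borelRn => A oA; rewrite (open_rat_cover oA) preimage_bigcup.
apply: countable_bigcupT_measurable => // p; case: asboolP => _; last first.
  by rewrite preimage_set0.
rewrite ball_consRn; last by rewrite invr_gt0.
apply: measurableX.
  apply: (@measurable_realfun.open_measurable R); exact: ball_open.
by apply: open_borelRn; exact: ball_open.
Qed.

Lemma measurable_headRn n : measurable_fun [set: borelRn n.+1] (@headRn n).
Proof.
apply: (measurability _ (measurable_realfun.RGenOpens.measurableE R)) => _ [A [a [b ->]] <-].
rewrite setTI; apply: open_borelRn; apply: (open_comp (f := fun x : 'rV[R]_n.+1 => x ord0 ord0)).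
  by move=> x _; exact: coord_continuous.
exact: interval_open.
Qed.

Lemma measurable_tailRn n : measurable_fun [set: borelRn n.+1] (@tailRn n).
Proof.
apply: measurable_borelRn => A oA; apply: open_borelRn.
apply: (open_comp (f := @tailRn n : 'rV[R]_n.+1 -> 'rV[R]_n)) => // x _.
move=> B /nbhs_ballP[e/= e0 eB]; apply/nbhs_ballP; exists e => //= y [_ xy].
by apply: eB; split=> // i j; rewrite !mxE; exact: xy.
Qed.

Lemma consRnK n (p : measurableTypeR R * borelRn n) :
  (headRn (consRn p), tailRn (consRn p)) = p.
Proof.
case: p => a v; congr pair; first by rewrite /headRn mxE unlift_none.
by apply/rowP => j; rewrite !mxE liftK/=.
Qed.

Section pushforward_consRn.
Context n (mu : {sigma_finite_measure set (borelRn n) -> \bar R}).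

Let P : {measure set (measurableTypeR R * borelRn n)%type -> \bar R} :=
  (@lebesgue_measure R \x mu)%E.
Let m := pushforward P (@consRn n).

Let m0 : m set0 = 0%E. Proof. by rewrite /m /pushforward preimage_set0 measure0. Qed.
Let m_ge0 A : (0 <= m A)%E.
Proof. by rewrite /m /pushforward measure_ge0. Qed.
Let m_sigma_additive : semi_sigma_additive m.
Proof.
move=> F mF tF mUF; rewrite /m /pushforward preimage_bigcup.
apply: measure_semi_sigma_additive.
- by move=> k; rewrite -[X in measurable X]setTI; exact: measurable_consRn.
- apply/trivIsetP => /= i j _ _ ij; rewrite -preimage_setI.
  by move/trivIsetP : tF => /(_ _ _ _ _ ij) ->//; rewrite preimage_set0.
- by rewrite -preimage_bigcup -[X in measurable X]setTI; exact: measurable_consRn.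
Qed.

HB.instance Definition _ := isMeasure.Build _ _ _ m m0 m_ge0 m_sigma_additive.

Let m_sigma_finite : sigma_finite setT m.
Proof.
have /sigma_finiteP[F [TF ndF Foo]] := sigma_finiteT (@lebesgue_measure R).
have /sigma_finiteP[G [TG ndG Goo]] := sigma_finiteT mu.
exists (fun k => (@headRn n @^-1` F k) `&` (@tailRn n @^-1` G k)).
  apply/seteqP; split => // x _.
  have [k _ Fk] : (\bigcup_k F k) (headRn x) by rewrite -TF.
  have [l _ Gl] : (\bigcup_k G k) (tailRn x) by rewrite -TG.
  exists (maxn k l) => //; split.
    by have /subsetPset := ndF _ _ (leq_maxl k l); exact.
  by have /subsetPset := ndG _ _ (leq_maxr k l); exact.
move=> k; have [mF Fkoo] := Foo k; have [mG Gkoo] := Goo k.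
split.
  apply: measurableI.
    by rewrite -[X in measurable X]setTI; exact: measurable_headRn.
  by rewrite -[X in measurable X]setTI; exact: measurable_tailRn.
rewrite /m /pushforward (_ : _ @^-1` _ = F k `*` G k).
  by rewrite /P/= product_measure1E// lte_mul_pinfty// ge0_fin_numE.
by apply/seteqP; split => -[y z] /=; have [-> ->] := consRnK (y, z).
Qed.

HB.instance Definition _ := @Measure_isSigmaFinite.Build _ _ _ m m_sigma_finite.

Definition lebesgue_consRn : {sigma_finite_measure set (borelRn n.+1) -> \bar R} := m.

End pushforward_consRn.

Definition dirac0Rn : {sigma_finite_measure set (borelRn 0) -> \bar R} :=
  dirac ((0 : 'rV[R]_0) : borelRn 0).

(* Lebesgue measure on R^n, as an iterated product; see lebesgue_Rn_box *)
Fixpoint lebesgue_Rn n : {sigma_finite_measure set (borelRn n) -> \bar R} :=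
  match n with
  | 0 => dirac0Rn
  | n'.+1 => lebesgue_consRn (lebesgue_Rn n')
  end.

Lemma lebesgue_Rn_box n (a b : 'rV[R]_n) : (forall i, a ord0 i <= b ord0 i) ->
  lebesgue_Rn n [set x : borelRn n | forall i, (x : 'rV[R]_n) ord0 i \in `]a ord0 i, b ord0 i]]
  = (\prod_(i < n) (b ord0 i - a ord0 i))%:E.
Proof.
elim: n a b => [a b _|n ih a b ab].
  rewrite big_ord0 /= /dirac/= indicE mem_set//=.
  by case.
have [tl tlE] : exists tl : 'rV[R]_n.+1 -> 'rV[R]_n,
  forall v i, tl v ord0 i = v ord0 (lift ord0 i).
  by exists (@tailRn n) => v i; rewrite mxE.
pose B := [set x : borelRn n | forall i,
  (x : 'rV[R]_n) ord0 i \in `](tl a) ord0 i, (tl b) ord0 i]].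
rewrite [LHS](_ : _ = (lebesgue_measure \x lebesgue_Rn n)%E
    (`]a ord0 ord0, b ord0 ord0] `*` B)); last first.
  rewrite /= /pushforward; congr (_ _); apply/seteqP; split => -[y z] /= h.
    split=> [|i]; first by have := h ord0; rewrite mxE unlift_none.
    by have := h (lift ord0 i); rewrite mxE liftK/= !tlE.
  move=> i; rewrite mxE; case: unliftP => [j ->|->] /=; last exact: h.1.
  by have := h.2 j; rewrite !tlE.
rewrite product_measure1E; [|exact: measurable_itv|].
  rewrite ih; last by move=> i; rewrite !tlE.
    rewrite big_ord_recl. rewrite [X in (X * _)%E](_ : _ = (b ord0 ord0 - a ord0 ord0)%:E); last first.
    apply: etrans; first exact: lebesgue_measure_itv.
    rewrite /= lte_fin; case: ltP => // ba.
    by congr EFin; apply/eqP; rewrite eq_sym subr_eq0 eq_le ba ab.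
  by rewrite EFinM; congr (_ * (_)%:E)%E; apply: eq_bigr => i _; rewrite !tlE.
rewrite (_ : B = \bigcap_(i in [set: 'I_n]) ((fun x : borelRn n => (x : 'rV[R]_n) ord0 i) @^-1`
   `](tl a) ord0 i, (tl b) ord0 i])).
  apply: fin_bigcap_measurable => // i _.
  rewrite -[X in measurable X]setTI.
  suff : measurable_fun [set: borelRn n] (fun x : borelRn n => (x : 'rV[R]_n) ord0 i : measurableTypeR R).
    by apply => //; exact: measurable_itv.
  apply: (measurability _ (measurable_realfun.RGenOpens.measurableE R)) => _ [A [r [s ->]] <-].
  rewrite setTI; apply: open_borelRn.
  apply: (open_comp (f := fun x : 'rV[R]_n => x ord0 i)).
    by move=> x _; exact: coord_continuous.
  exact: interval_open.
by apply/seteqP; split => x /= h i => [_|]; exact: h.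
Qed.

End euclidean_space.

Section bochner.
Context (R : realType) d (T : measurableType d) (mu : {measure set T -> \bar R}).
Context (X : lmodType R) (S : set X) (N : X -> R).

Definition simple_function (s : T -> X) :=
  [/\ finite_set (range s), (forall x, measurable (s @^-1` [set x]))
    & forall t, S (s t)].

(* pointwise limit of simple functions *)
Definition strongly_measurable (D : set T) (f : T -> X) :=
  (forall t, D t -> S (f t)) /\
  exists2 s : nat -> T -> X, (forall k, simple_function (s k)) &
    forall t, D t -> N (s k t - f t) @[k --> \oo] --> (0 : R).

(* only used for sets D of finite measure *)
Definition simple_integral (D : set T) (s : T -> X) : X :=
  \sum_(x \in range s) fine (mu (D `&` s @^-1` [set x])) *: x.

(* v is the Bochner integral of f over D; v is unique up to vectors of
   seminorm 0 *)
Definition bochner_integral (D : set T) (f : T -> X) (v : X) :=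
  [/\ S v, strongly_measurable D f &
    exists s : nat -> T -> X, [/\ (forall k, simple_function (s k)),
      (\int[mu]_(t in D) (N (f t - s k t))%:E)%E @[k --> \oo] --> 0%E &
      N (simple_integral D (s k) - v) @[k --> \oo] --> (0 : R)]].

Definition L2_sqnorm (D : set T) (f : T -> X) : \bar R :=
  (\int[mu]_(t in D) (N (f t) ^+ 2)%:E)%E.

Definition in_L2 (D : set T) (f : T -> X) :=
  strongly_measurable D f /\ (L2_sqnorm D f < +oo)%E.

End bochner.

Section time_dependent.
Context (R : realType) (X : lmodType R) (S : set X) (N : X -> R) (T : R).

(* C^1 functions with compact support in the open interval (0, T) *)
Definition C1c_time (phi : R -> R) :=
  [/\ forall t, derivable phi t 1, continuous (derive1 phi) &
      exists a b, [/\ 0 < a, b < T & forall t, t \notin `[a, b] -> phi t = 0]].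

(* ut is the weak derivative of u on (0, T):
   \int_0^T phi' u = - \int_0^T phi ut; for u and ut in L^2 both Bochner
   integrals exist *)
Definition weak_time_derivative (u ut : R -> X) :=
  forall phi, C1c_time phi -> exists v,
    bochner_integral lebesgue_measure S N `]0, T[ (fun t => derive1 phi t *: u t) v /\
    bochner_integral lebesgue_measure S N `]0, T[ (fun t => phi t *: ut t) (- v).

Definition continuous_on_time (u : R -> X) :=
  forall t, t \in `[0, T] ->
    S (u t) /\ N (u s - u t) @[s --> within `[0, T] (nbhs t)] --> (0 : R).

(* u is the continuous representative of an element of H^1(0,T;S) whose
   derivative is ut *)
Definition in_H1 (u ut : R -> X) :=
  [/\ continuous_on_time u, in_L2 lebesgue_measure S N `]0, T[ u,
      in_L2 lebesgue_measure S N `]0, T[ ut & weak_time_derivative u ut].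

(* sum of the increments of f along a partition a < s_1 < ... < s_k = b *)
Definition variation_along (a b : R) (f : R -> X) (s : seq R) : R :=
  \sum_(0 <= k < size s) N (f (nth b (a :: s) k.+1) - f (nth b (a :: s) k)).

Definition variations_along (a b : R) (f : R -> X) : set R :=
  [set variation_along a b f s | s in itv_partition a b].

Definition total_variation_on (a b : R) (f : R -> X) : R :=
  sup (variations_along a b f).

(* BV_r(0,T;X): right-continuous on [0,T), left-continuous at T *)
Definition in_BVr (f : R -> X) :=
  [/\ forall t, t \in `[0, T] -> S (f t),
      has_ubound (variations_along 0 T f),
      forall t, t \in `[0, T[ -> N (f s - f t) @[s --> t^'+] --> (0 : R) &
      N (f s - f T) @[s --> T^'-] --> (0 : R)].

End time_dependent.

Section partitions.
Context (R : realType).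
Implicit Types (t : nat -> R) (s : R).

Definition time_partition (T : R) (n : nat) t :=
  [/\ t 0%N = 0, t n = T & forall k, (k < n)%N -> t k < t k.+1].

Definition step t (k : nat) : R := t k.+1 - t k.

Definition mesh (n : nat) t : R := \big[Num.max/0]_(k < n) step t k.

(* the k with t_k < s <= t_(k+1); it is 0 for s = 0 *)
Definition interval_index (n : nat) t s : nat :=
  find (fun k => s <= t k.+1) (iota 0 n).

Context (X : lmodType R).

Definition affine_interpolant (n : nat) t (z : nat -> X) s : X :=
  let k := interval_index n t s in
  z k + ((s - t k) / step t k) *: (z k.+1 - z k).

Definition constant_interpolant (n : nat) t (z : nat -> X) s : X :=
  z (interval_index n t s).+1.

End partitions.

Section lipschitz_domains.
Context (R : realType) (n : nat).

(* near each boundary point, up to a rigid motion, A is the epigraph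
   x_0 > g(x_1, ..., x_n) of a Lipschitz function g *)
Definition lipschitz_boundary (A : set 'rV[R]_n.+1) :=
  forall x, (closure A `\` A°) x ->
  exists (Q : 'M[R]_n.+1) (g : 'rV[R]_n -> R) (L r : R),
    [/\ Q *m Q^T = 1%:M, 0 < r,
        forall y z, `|g y - g z| <= L * `|y - z| &
        forall y, ball x r y ->
          let y' := (y - x) *m Q in
          A y <-> g (col' ord0 y') < y' ord0 ord0].

Record lipschitz_domain := LipschitzDomain {
  dom :> set 'rV[R]_n.+1 ;
  dom_open : open dom ;
  dom_connected : connected dom ;
  dom_nonempty : dom !=set0 ;
  dom_bounded : bounded_set dom ;
  dom_lipschitz : lipschitz_boundary dom }.

End lipschitz_domains.

Section sobolev.
Context (R : realType) (n : nat) (Omega : lipschitz_domain R n).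

Definition mu_dom : {measure set (borelRn R n.+1) -> \bar R} :=
  mrestr (lebesgue_Rn R n.+1) (open_borelRn (@dom_open R n Omega)).

Definition L2H : lmodType R := LfunType mu_dom (lee1n 2).
Definition L2Hd : lmodType R := {ffun 'I_n.+1 -> L2H}.

Definition ip (f g : 'rV[R]_n.+1 -> R) : R := \int[mu_dom]_x (f x * g x).
Definition L2norm (f : 'rV[R]_n.+1 -> R) : R := Num.sqrt (ip f f).

Definition normH (x : L2H) : R := L2norm x.
Definition eqH (x y : L2H) := (x : borelRn R n.+1 -> R) = y %[ae mu_dom].
Definition ipd (p q : L2Hd) : R := \sum_(i < n.+1) ip (p i) (q i).
Definition normd (p : L2Hd) : R := Num.sqrt (ipd p p).

Definition partial (i : 'I_n.+1) (phi : 'rV[R]_n.+1 -> R) : 'rV[R]_n.+1 -> R :=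
  fun x => 'D_(delta_mx ord0 i) phi x.

Fixpoint Cfun (k : nat) (phi : 'rV[R]_n.+1 -> R) : Prop :=
  continuous phi /\
  match k with
  | 0 => True
  | k'.+1 => forall i, (forall x, derivable phi x (delta_mx ord0 i)) /\
                       Cfun k' (partial i phi)
  end.

(* C_c^oo(Omega) *)
Definition test_function (phi : 'rV[R]_n.+1 -> R) :=
  let supp := closure [set x | phi x != 0] in
  [/\ forall k, Cfun k phi, compact supp & supp `<=` Omega].

Definition weak_gradient (v : L2H) (p : L2Hd) :=
  forall phi, test_function phi ->
  forall i, ip v (partial i phi) = - ip (p i) phi.

(* closure of C_c^oo(Omega) in H^1(Omega) *)
Definition H10 : set (L2H * L2Hd) := [set v |
  weak_gradient v.1 v.2 /\
  exists phi : nat -> 'rV[R]_n.+1 -> R,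
    [/\ forall k, test_function (phi k),
        L2norm (phi k \- v.1) @[k --> \oo] --> (0 : R) &
        forall i, L2norm (partial i (phi k) \- v.2 i) @[k --> \oo] --> (0 : R)]].

Definition normV (v : L2H * L2Hd) : R := normd v.2.

(* the distributional Laplacian of v belongs to H and equals h *)
Definition is_laplacian (v : L2H * L2Hd) (h : L2H) :=
  forall phi, test_function phi ->
  ip h phi = - \sum_(i < n.+1) ip (v.2 i) (partial i phi).

Definition openH (A : set L2H) :=
  forall x, A x -> exists2 e : R, 0 < e & forall y, normH (y - x) < e -> A y.
Definition closedH (A : set L2H) := openH (~` A).
Definition convexH (A : set L2H) := forall x y (a : R), A x -> A y ->
  0 <= a <= 1 -> A (a *: x + (1 - a) *: y).
Definition borelH : set (set L2H) := <<s openH >>.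

(* xi \in N_C(x) *)
Definition normal_cone (C : set L2H) (x xi : L2H) :=
  C x /\ forall y, C y -> ip xi (y - x : L2H) <= 0.

(* p = P_C(x) *)
Definition is_projection (C : set L2H) (x p : L2H) :=
  C p /\ forall y, C y -> normH (x - p) <= normH (x - y).

End sobolev.

Section model.
Context (R : realType) (n : nat) (Omega : lipschitz_domain R n).
Notation H := (L2H Omega).
Notation Hd := (L2Hd Omega).
Context (dR : measure_display) (Rr : measurableType dR).
Context (mu : {finite_measure set Rr -> \bar R}) (c : Rr -> R) (K : Rr -> set H).

(* {(r, z) : z \in K_r} belongs to A \otimes B(H) *)
Definition jointly_measurable :=
  <<s [set A `*` B | A in @measurable dR Rr & B in borelH (Omega := Omega)] >>
    [set p : Rr * H | K p.1 p.2].

(* L^2(R, c dmu; H) *)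
Definition spaceM : set (Rr -> H) := [set z |
  strongly_measurable setT (@normH _ _ Omega) setT z /\
  (\int[mu]_r (c r * normH (z r) ^+ 2)%:E < +oo)%E].
Definition ipM (z1 z2 : Rr -> H) : R :=
  \int[mu]_r (c r * ip Omega (z1 r) (z2 r)).
Definition normM (z : Rr -> H) : R := Num.sqrt (ipM z z).
Definition eqM (z1 z2 : Rr -> H) := {ae mu, forall r, eqH (z1 r) (z2 r)}.

(* g = G z = \int c z dmu *)
Definition is_G (z : Rr -> H) (g : H) :=
  bochner_integral mu setT (@normH _ _ Omega) setT (fun r => c r *: z r) g.

Definition admissible (u : H) (w : Rr -> H) := {ae mu, forall r, K r (u - w r)}.

Context (kappa T : R) (f : R -> H) (u0 : H * Hd) (w0 : Rr -> H).

(* (u, w) solves (P); ut and wt are the time derivatives of u and w, and v is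
   u as an element of L^2(0,T;V) *)
Definition exact_solution (u ut : R -> H) (v : R -> H * Hd)
    (w wt : R -> Rr -> H) :=
  [/\ in_H1 setT (@normH _ _ Omega) T u ut,
      in_L2 lebesgue_measure (H10 (Omega := Omega)) (@normV _ _ Omega) `]0, T[ v /\
      {ae lebesgue_measure, forall t : R, t \in `]0, T[ -> eqH (u t) (v t).1},
      in_H1 spaceM normM T w wt,
      eqH (u 0) u0.1 /\ eqM (w 0) w0 &
      {ae lebesgue_measure, forall t : R, t \in `]0, T[ ->
        (exists2 g, is_G (wt t) g & forall phi, H10 phi ->
           kappa * ip Omega (ut t) phi.1 + ip Omega g phi.1
             + ipd (v t).2 phi.2 = ip Omega (f t) phi.1) /\
        {ae mu, forall r, K r (u t - w t r) /\
                          normal_cone (K r) (u t - w t r) (wt t r)}}].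

Definition backward_difference (X : lmodType R) (t : nat -> R) (z : nat -> X)
  (k : nat) : X := (step t k)^-1 *: (z k.+1 - z k).

(* the index k ranges over 0, ..., N - 1 and stands for k + 1 = 1, ..., N *)
Definition euler_solution (N : nat) (t : nat -> R) (fn : nat -> H)
    (u : nat -> H * Hd) (w : nat -> Rr -> H) :=
  [/\ u 0%N = u0 /\ w 0%N = w0,
      forall k, (k <= N)%N -> H10 (u k) /\ spaceM (w k) &
      forall k, (k < N)%N ->
        (exists2 g, is_G (backward_difference t w k) g &
           forall phi, H10 phi ->
             kappa * ip Omega (backward_difference t u k).1 phi.1
               + ip Omega g phi.1 + ipd (u k.+1).2 phi.2
             = ip Omega (fn k.+1) phi.1) /\
        {ae mu, forall r, exists2 p, is_projection (K r) ((u k.+1).1 - w k r) p &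
                                     eqH (w k.+1 r) ((u k.+1).1 - p)}].

End model.

(* Main.v *)
Require Import Defs.
From mathcomp Require Import all_boot all_order all_algebra finmap.
From mathcomp Require Import all_classical all_reals all_analysis.
From mathcomp Require Import measurable_realfun ring lra.

Set Implicit Arguments.
Unset Strict Implicit.
Unset Printing Implicit Defensive.

Import Order.TTheory GRing.Theory Num.Theory numFieldNormedType.Exports HBSimple.

Local Open Scope classical_set_scope.
Local Open Scope ring_scope.

(* The pair p = (u, w) satisfies <p', (phi, phi)> + (grad u, grad phi) = (f, phi)
   for the energy product kappa (u, u')_H + <w, w'>_M, and w' lies in the normal
   cone at the slack x = u - w. On the step [t_k, t_(k+1)], with d_k the energy
   norm of the k-th discrete velocity (d_0 is that of f(0) + Laplacian u^0, with
   w at rest) and b_k the variation of f over the step divided by sqrt kappa: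
   - comparing two consecutive discrete equations tested with their increment,
     monotonicity of the cones bounds the consistency terms <dw, dx> and
     |grad du|^2 by be_k = tau_k d_(k+1) (b_k + d_k - d_(k+1));
   - testing exact minus discrete with the error e gives
     d/dt |e|^2 + |u - u_tau|_V^2 + |u - ubar_tau|_V^2
       <= 2 b_k |e| + 2 (1 - la) be_k,  where la = (t - t_k) / tau_k;
   - a quadratic Gronwall argument yields
     |e| <= sqrt (sum tau_k be_k) + sum b_k tau_k, and likewise for the gradients,
     while sum d_(k+1) (b_k + d_k - d_(k+1)) <= (d_0 + sum b_k)^2 / 2 telescopes. *)

(** * Positive semidefinite forms *)

(** Every consistency term is a discrete quantity, so the exact solution enters only through its
    defining relations and BV data suffice. First order has two sources: be_k carries one factor
    tau_k, and its weight 2 (1 - la) integrates to another tau_k over the step, while the remaining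
    sum of d_(k+1) (b_k + d_k - d_(k+1)) is bounded independently of the partition. Since the
    forcing error is 2 b_k |e|, linear in |e|, the growth in time is linear and no exponential
    appears. The first obstacle is the chain rule for |e|^2: time derivatives are weak and vector
    valued, with H and M known only through seminorms. Everything is therefore paired with a fixed
    vector, where a scalar fundamental theorem of calculus applies, and the quadratic identity is
    reassembled on short intervals. The second is that a test function phi acts on both components
    at once, as (phi, phi), whereas u and w have different increments; the discrepancy is exactly an
    increment of the slack, which is what the normal cones control. *)

Lemma subrACA (V : zmodType) (x1 x2 x3 x4 : V) :
  x1 - x2 - (x3 - x4) = (x1 - x3) - (x2 - x4).
Proof. by rewrite !opprB [LHS]addrACA [RHS]addrACA (addrC (- x2)). Qed.

(** H is not quotiented by a.e. equality, so the form is only semidefinite; M is a subset of a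
    function space, so the laws are required only on [S]. [N] is a separate argument because strong
    measurability and Bochner integrals are phrased with a seminorm. *)
Record semi_inner (R : realType) (X : lmodType R) (S : set X)
    (b : X -> X -> R) (N : X -> R) : Prop := SemiInner {
  si_0 : S 0 ;
  si_S : forall a x y, S x -> S y -> S (a *: x + y) ;
  si_sym : forall x y, S x -> S y -> b x y = b y x ;
  si_lin : forall a x y z, S x -> S y -> S z ->
    b (a *: x + y) z = a * b x z + b y z ;
  si_ge0 : forall x, S x -> 0 <= b x x ;
  si_norm : forall x, S x -> N x = Num.sqrt (b x x) }.

Section semi_inner_theory.
Context (R : realType) (X : lmodType R) (S : set X) (b : X -> X -> R) (N : X -> R).
Hypothesis sib : semi_inner S b N.

Let S0 := si_0 sib.

Lemma siSD x y : S x -> S y -> S (x + y).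
Proof. by move=> Sx Sy; rewrite -[x]scale1r; exact: (si_S sib). Qed.

Lemma siSZ a x : S x -> S (a *: x).
Proof. by move=> Sx; rewrite -[_ *: _]addr0; exact: (si_S sib). Qed.

Lemma siSN x : S x -> S (- x).
Proof. by rewrite -scaleN1r; exact: siSZ. Qed.

Lemma siSB x y : S x -> S y -> S (x - y).
Proof. by move=> Sx Sy; apply: siSD => //; exact: siSN. Qed.

Lemma siDl x y z : S x -> S y -> S z -> b (x + y) z = b x z + b y z.
Proof. by move=> *; rewrite -[x in LHS]scale1r (si_lin sib)// mul1r. Qed.

Lemma si0l z : S z -> b 0 z = 0.
Proof.
by move=> Sz; have := siDl S0 S0 Sz; rewrite addr0 => h; lra.
Qed.

Lemma siZl a x z : S x -> S z -> b (a *: x) z = a * b x z.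
Proof. by move=> Sx Sz; rewrite -[_ *: _]addr0 (si_lin sib)// si0l// addr0. Qed.

Lemma siNl x z : S x -> S z -> b (- x) z = - b x z.
Proof. by move=> Sx Sz; rewrite -scaleN1r siZl// mulN1r. Qed.

Lemma siBl x y z : S x -> S y -> S z -> b (x - y) z = b x z - b y z.
Proof. by move=> *; rewrite siDl ?siNl//; exact: siSN. Qed.

Lemma siDr x y z : S x -> S y -> S z -> b z (x + y) = b z x + b z y.
Proof.
by move=> Sx Sy Sz; rewrite !(si_sym sib Sz)//; [exact: siDl|exact: siSD].
Qed.

Lemma siZr a x z : S x -> S z -> b z (a *: x) = a * b z x.
Proof.
by move=> Sx Sz; rewrite !(si_sym sib Sz)//; [exact: siZl|exact: siSZ].
Qed.

Lemma siBr x y z : S x -> S y -> S z -> b z (x - y) = b z x - b z y.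
Proof.
by move=> Sx Sy Sz; rewrite !(si_sym sib Sz)//; [exact: siBl|exact: siSB].
Qed.

Lemma siN_ge0 x : S x -> 0 <= N x.
Proof. by move=> Sx; rewrite (si_norm sib)// sqrtr_ge0. Qed.

Lemma siN_sqr x : S x -> N x ^+ 2 = b x x.
Proof. by move=> Sx; rewrite (si_norm sib)// sqr_sqrtr// (si_ge0 sib). Qed.

Lemma si_sqB x y : S x -> S y -> b (x - y) (x - y) = b x x - 2 * b x y + b y y.
Proof.
move=> Sx Sy; have Sxy := siSB Sx Sy.
by rewrite siBl// !siBr// (si_sym sib Sy Sx); ring.
Qed.

Lemma si_sqD x y : S x -> S y -> b (x + y) (x + y) = b x x + 2 * b x y + b y y.
Proof.
move=> Sx Sy; have Sxy := siSD Sx Sy.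
by rewrite siDl// !siDr// (si_sym sib Sy Sx); ring.
Qed.

(** The square of s x - r y is nonnegative, and s = N y, r = N x gives the claim. If one of the
    seminorms vanishes, this expression is affine in the corresponding coefficient, so a positive
    [b x y] would make it negative for a suitable value. *)
Lemma si_cauchy x y : S x -> S y -> b x y <= N x * N y.
Proof.
move=> Sx Sy; have Nx := siN_ge0 Sx; have Ny := siN_ge0 Sy.
have pos s r : 0 <= s ^+ 2 * N x ^+ 2 - 2 * (s * r) * b x y + r ^+ 2 * N y ^+ 2.
  have := si_ge0 sib (siSB (siSZ s Sx) (siSZ r Sy)).
  rewrite si_sqB ?(siZl, siZr) -?siN_sqr//; try exact: siSZ.
  by move=> h; apply: le_trans h _; rewrite le_eqVlt; apply/orP; left; apply/eqP; ring.
have [Ny0|Ny0] := eqVneq (N y) 0.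
  rewrite Ny0 mulr0; rewrite leNgt; apply/negP => h.
  have := pos 1 ((N x ^+ 2 + 1) / b x y).
  rewrite Ny0 expr0n/= mulr0 addr0 expr1n !mul1r -mulrA divfK ?gt_eqF//.
  by nra.
have {Ny Ny0}Ny : 0 < N y by rewrite lt_neqAle eq_sym Ny0.
have [Nx0|Nx0] := eqVneq (N x) 0.
  rewrite Nx0 mul0r; rewrite leNgt; apply/negP => h.
  have := pos ((N y ^+ 2 + 1) / b x y) 1.
  rewrite Nx0 expr0n/= mulr0 add0r expr1n mulr1 mul1r -mulrA divfK ?gt_eqF//.
  by nra.
have {Nx Nx0}Nx : 0 < N x by rewrite lt_neqAle eq_sym Nx0.
have := pos (N y) (N x).
have -> : N y ^+ 2 * N x ^+ 2 - 2 * (N y * N x) * b x y + N x ^+ 2 * N y ^+ 2 =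
  2 * (N y * N x) * (N x * N y - b x y) by ring.
by rewrite pmulr_rge0 ?subr_ge0// !mulr_gt0.
Qed.

Lemma si_cauchy_abs x y : S x -> S y -> `|b x y| <= N x * N y.
Proof.
move=> Sx Sy; rewrite ler_norml si_cauchy// andbT lerNl.
rewrite -siNl//; apply: le_trans (si_cauchy (siSN Sx) Sy) _.
suff -> : N (- x) = N x by [].
rewrite !(si_norm sib)//; last exact: siSN.
rewrite siNl//; last exact: siSN.
by rewrite -scaleN1r siZr// mulN1r opprK.
Qed.

Lemma siNZ a x : S x -> N (a *: x) = `|a| * N x.
Proof.
move=> Sx; have Sax := siSZ a Sx.
rewrite !(si_norm sib)// siZl// siZr// mulrA -expr2 sqrtrM ?sqr_ge0//.
by rewrite sqrtr_sqr.
Qed.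

Lemma siN_opp x : S x -> N (- x) = N x.
Proof. by move=> Sx; rewrite -scaleN1r siNZ// normrN1 mul1r. Qed.

Lemma siN0 : N 0 = 0.
Proof. by rewrite -(scale0r 0) siNZ// normr0 mul0r. Qed.

Lemma siN_subC x y : S x -> S y -> N (x - y) = N (y - x).
Proof. by move=> Sx Sy; rewrite -siN_opp ?opprB//; exact: siSB. Qed.

Lemma siN_triangle x y : S x -> S y -> N (x + y) <= N x + N y.
Proof.
move=> Sx Sy; have Sxy := siSD Sx Sy.
rewrite -(@ler_pXn2r _ 2)// ?nnegrE ?addr_ge0 ?siN_ge0// siN_sqr//.
rewrite si_sqD// sqrrD !siN_sqr//.
have := si_cauchy Sx Sy; lra.
Qed.

Lemma siN_triangleB x y z : S x -> S y -> S z -> N (x - z) <= N (x - y) + N (y - z).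
Proof.
move=> Sx Sy Sz; rewrite -[x - z](subrKA y).
by apply: siN_triangle; exact: siSB.
Qed.

Lemma si_null_l x y : S x -> S y -> N x = 0 -> b x y = 0.
Proof.
move=> Sx Sy Nx; have := si_cauchy_abs Sx Sy.
by rewrite Nx mul0r normr_le0 => /eqP.
Qed.

End semi_inner_theory.

Lemma cvg_dist_squeeze (R : realType) (I : Type) (F : set_system I) {FF : Filter F}
    (f h : I -> R) (a : R) :
  (\forall x \near F, `|f x - a| <= h x) -> h @ F --> (0 : R) -> f @ F --> a.
Proof.
move=> fh h0; apply/subr_cvg0/norm_cvg0P.
apply: (@squeeze_cvgr _ _ _ _ (cst 0) h) => //; last exact: cvg_cst.
by apply: filterS fh => x ->; rewrite normr_ge0.
Qed.

(** * Strong measurability and Bochner integrals *)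

Section real_integrals.
Context (R : realType) d (T : measurableType d) (mu : {measure set T -> \bar R}).
Implicit Types (D : set T) (f g : T -> R).

Lemma dominated_integrable_fin D f g : measurable D -> measurable_fun D f ->
  (forall x, D x -> `|f x| <= g x) -> mu.-integrable D (EFin \o g) ->
  mu.-integrable D (EFin \o f).
Proof.
move=> mD mf fg; apply: le_integrable => //; first exact/measurable_EFinP.
move=> x Dx /=; rewrite lee_fin (le_trans (fg x Dx))//; exact: ler_norm.
Qed.

Lemma ae_le_Rintegral D f g : measurable D ->
  mu.-integrable D (EFin \o f) -> mu.-integrable D (EFin \o g) ->
  {ae mu, forall x, D x -> f x <= g x} ->
  \int[mu]_(x in D) f x <= \int[mu]_(x in D) g x.
Proof.
move=> mD fi gi fg; rewrite -subr_ge0 -RintegralB//.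
have igf := integrableB mD gi fi.
(* [g - f] is negative only on a null set, so its integral is that of its absolute value. *)
rewrite (_ : \int[mu]_(x in D) (g x - f x) = \int[mu]_(x in D) `|g x - f x|).
  by apply: Rintegral_ge0 => x _.
have mgf : measurable_fun D (EFin \o (fun x => g x - f x)).
  exact: (measurable_int mu igf).
congr fine; apply: ae_eq_integral => //.
  by apply/measurable_EFinP; apply: measurableT_comp => //; exact/measurable_EFinP.
apply: filterS fg => x h Dx.
by rewrite ger0_norm// subr_ge0 h.
Qed.

Lemma integrable_finB D f g : measurable D ->
  mu.-integrable D (EFin \o f) -> mu.-integrable D (EFin \o g) ->
  mu.-integrable D (EFin \o (fun t => f t - g t)).
Proof. by move=> mD fi gi; exact: (integrableB mD fi gi). Qed.

Lemma integrable_finD D f g : measurable D ->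
  mu.-integrable D (EFin \o f) -> mu.-integrable D (EFin \o g) ->
  mu.-integrable D (EFin \o (fun t => f t + g t)).
Proof. by move=> mD fi gi; exact: (integrableD mD fi gi). Qed.

Lemma integrable_finZ D (a : R) f : measurable D ->
  mu.-integrable D (EFin \o f) -> mu.-integrable D (EFin \o (fun t => a * f t)).
Proof. by move=> mD fi; exact: (integrableZl mD a fi). Qed.

End real_integrals.

Section finite_range.
Context (R : realType) d (T : measurableType d).

(** [Y] carries no sigma-algebra: the preimage of any set is a finite union of fibres. *)
Lemma measurable_finite_range (Y : Type) (s : T -> Y) (A : set Y) :
  finite_set (range s) -> (forall y, measurable (s @^-1` [set y])) ->
  measurable (s @^-1` A).
Proof.
move=> fs ms.
rewrite (_ : s @^-1` A = \bigcup_(y in range s `&` A) s @^-1` [set y]).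
  apply: fin_bigcup_measurable => //; exact: finite_setIl.
apply/seteqP; split => [t At|t [y [_ Ay]] /= -> //].
by exists (s t) => //; split => //; exists t.
Qed.

Context (X X' : lmodType R) (S : set X) (S' : set X').

Lemma simple_function_map2 (X'' : lmodType R) (S'' : set X'')
    (phi : X -> X' -> X'') s s' :
  (forall x y, S x -> S' y -> S'' (phi x y)) ->
  simple_function S s -> simple_function S' s' ->
  simple_function S'' (fun t : T => phi (s t) (s' t)).
Proof.
move=> phiS [fs ms Ss] [fs' ms' Ss']; split => [|y|t]; last exact: phiS.
- apply: (@sub_finite_set _ _ ((fun p => phi p.1 p.2) @` (range s `*` range s'))).
    by move=> _ [t _ <-]; exists (s t, s' t) => //; split; exists t.
  by apply: finite_image; exact: finite_setX.
- rewrite (_ : _ @^-1` _ = (fun t => (s t, s' t)) @^-1` [set p | phi p.1 p.2 = y])//.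
  apply: measurable_finite_range.
    apply: (@sub_finite_set _ _ (range s `*` range s')).
      by move=> _ [t _ <-]; split; exists t.
    exact: finite_setX.
  move=> [x x']; rewrite (_ : _ @^-1` _ = s @^-1` [set x] `&` s' @^-1` [set x']).
    exact: measurableI.
  by apply/seteqP; split => [t [/= -> ->]//|t [/= -> ->]].
Qed.

Lemma simple_function_cst (x : X) : S x -> simple_function S (fun _ : T => x).
Proof.
move=> Sx; split=> // [|y].
  by apply: (@sub_finite_set _ _ [set x]) => // _ [t _ <-].
have [->|xy] := pselect (x = y).
  by rewrite (_ : _ @^-1` _ = setT)//; apply/seteqP; split.
by rewrite (_ : _ @^-1` _ = set0)//; apply/seteqP; split.
Qed.

Lemma measurable_simple2 (phi : X -> X' -> R) (D : set T) s s' :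
  simple_function S s -> simple_function S' s' ->
  measurable_fun D (fun t => phi (s t) (s' t)).
Proof.
move=> ss ss' mD Y mY; apply: measurableI => //.
have [fp mp _] := @simple_function_map2 (R^o) setT phi s s' (fun _ _ _ _ => I) ss ss'.
exact: (measurable_finite_range Y fp).
Qed.

End finite_range.

Section strong_measurability.
Context (R : realType) d (T : measurableType d).
Context (X : lmodType R) (S : set X) (b : X -> X -> R) (N : X -> R).
Hypothesis sib : semi_inner S b N.
Implicit Types (D : set T) (f g : T -> X).

Lemma strongly_measurable_cst D x : S x -> strongly_measurable S N D (fun=> x).
Proof.
move=> Sx; split=> //; exists (fun=> fun=> x) => [_|t _].
  exact: simple_function_cst.
by rewrite subrr (siN0 sib); exact: cvg_cst.
Qed.

Lemma strongly_measurable_lin D a f g :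
  strongly_measurable S N D f -> strongly_measurable S N D g ->
  strongly_measurable S N D (fun t => a *: f t + g t).
Proof.
move=> [Sf [s ss sf]] [Sg [r rr rg]]; split.
  by move=> t Dt; apply: (si_S sib); [exact: Sf|exact: Sg].
exists (fun k t => a *: s k t + r k t) => [k|t Dt].
  apply: (simple_function_map2 (S := S) (S' := S) (phi := fun x y => a *: x + y)) => //.
  exact: (si_S sib).
have Ss k : S (s k t) by have [] := ss k.
have Sr k : S (r k t) by have [] := rr k.
have Sft := Sf t Dt; have Sgt := Sg t Dt.
apply: (@squeeze_cvgr _ _ _ _ (cst 0) (fun k => `|a| * N (s k t - f t) + N (r k t - g t))).
- near=> k; apply/andP; split.
    by apply: (siN_ge0 sib); apply: (siSB sib); exact: (si_S sib).
  rewrite opprD addrACA -scalerBr.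
  rewrite -(siNZ sib)//; last exact: (siSB sib).
  by apply: (siN_triangle sib); [apply: (siSZ sib)|]; exact: (siSB sib).
- exact: cvg_cst.
- rewrite -(addr0 0) -{1}(mulr0 `|a|); apply: cvgD; last exact: rg.
  by apply: cvgM; [exact: cvg_cst|exact: sf].
Unshelve. all: end_near. Qed.

Lemma strongly_measurableB D f g :
  strongly_measurable S N D f -> strongly_measurable S N D g ->
  strongly_measurable S N D (fun t => f t - g t).
Proof.
move=> mf mg; have := strongly_measurable_lin (-1) mg mf.
by congr strongly_measurable; apply/funext => t; rewrite scaleN1r addrC.
Qed.

Lemma strongly_measurable_scale D (a : T -> R) x : measurable D ->
  measurable_fun D a -> S x -> strongly_measurable S N D (fun t => a t *: x).
Proof.
move=> mD ma Sx; split; first by move=> t _; exact: (siSZ sib).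
have [s sa] := approximation_sfun mD ((measurable_EFinP _ _).2 ma).
exists (fun k t => s k t *: x) => [k|t Dt].
  apply: (simple_function_map2 (X := R^o) (S := setT) (S' := S) (phi := fun (y : R^o) x => y *: x)
    (s' := fun=> x)).
  - by move=> y z _ Sz; exact: (siSZ sib).
  - split=> [|y|//]; first exact: fimfunP.
    have := @measurable_funP _ _ _ _ setT (s k).
    by move=> /(_ measurableT [set y]); rewrite setTI; apply.
  - exact: simple_function_cst.
under eq_fun do rewrite -scalerBl (siNZ sib)//.
rewrite -(mul0r (N x)); apply: cvgM; last exact: cvg_cst.
apply/norm_cvg0P/subr_cvg0.
by have /fine_cvg := sa t Dt.
Qed.

(** Without a sigma-algebra on [X], measurability makes sense for scalar expressions only; they are
    pointwise limits of the same expressions for simple functions. *)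
Lemma measurable_strong2 D f g :
  strongly_measurable S N D f -> strongly_measurable S N D g ->
  measurable_fun D (fun t => b (f t) (g t)).
Proof.
move=> [Sf [s ss sf]] [Sg [r rr rg]].
apply: (@measurable_fun_cvg _ _ _ D (fun k t => b (s k t) (r k t))) => [k|t Dt].
  exact: measurable_simple2 (ss k) (rr k).
have Ss k : S (s k t) by have [] := ss k.
have Sr k : S (r k t) by have [] := rr k.
have Sft := Sf t Dt; have Sgt := Sg t Dt.
apply: (cvg_dist_squeeze (h := fun k => N (s k t - f t) * (N (r k t - g t) + N (g t))
  + N (f t) * N (r k t - g t))).
- near=> k.
  have Ssf : S (s k t - f t) by exact: (siSB sib).
  have Srg : S (r k t - g t) by exact: (siSB sib).
  rewrite (_ : b _ _ - _ = b (s k t - f t) (r k t) + b (f t) (r k t - g t)); last first.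
    by rewrite (siBl sib)// (siBr sib)//; ring.
  rewrite (le_trans (ler_normD _ _))// lerD//.
    rewrite (le_trans (si_cauchy_abs sib _ _))// ler_wpM2l// ?(siN_ge0 sib)//.
    by have := siN_triangle sib Srg Sgt; rewrite subrK.
  exact: (si_cauchy_abs sib).
- rewrite [X in _ --> X](_ : _ = 0 * (0 + N (g t)) + N (f t) * 0); last by ring.
  apply: cvgD; apply: cvgM.
  + exact: sf.
  + by apply: cvgD; [exact: rg|exact: cvg_cst].
  + exact: cvg_cst.
  + exact: rg.
Unshelve. all: end_near. Qed.

Lemma measurable_strong_norm D f :
  strongly_measurable S N D f -> measurable_fun D (fun t => N (f t)).
Proof.
move=> mf; apply: (@eq_measurable_fun _ _ _ _ D (Num.sqrt \o (fun t => b (f t) (f t)))).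
  by move=> t /[!inE] Dt; rewrite /= (si_norm sib)//; case: mf => + _; exact.
apply: measurableT_comp; last exact: measurable_strong2.
exact: continuous_measurable_fun (@sqrt_continuous R).
Qed.

End strong_measurability.

Section bochner_pairing.
Context (R : realType) d (T : measurableType d) (mu : {measure set T -> \bar R}).
Context (X : lmodType R) (S : set X) (b : X -> X -> R) (N : X -> R).
Hypothesis sib : semi_inner S b N.
Context (D : set T) (mD : measurable D).
Implicit Types (f g : T -> X).

Lemma in_L2_sqr_integrable f : in_L2 mu S N D f ->
  mu.-integrable D (EFin \o (fun t => N (f t) ^+ 2)).
Proof.
move=> [mf foo]; apply/integrableP; split.
  apply/measurable_EFinP; apply: measurable_funX.
  exact: (measurable_strong_norm sib).
apply: le_lt_trans foo; rewrite le_eqVlt; apply/orP; left; apply/eqP.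
by apply: eq_integral => t _ /=; rewrite ger0_norm// sqr_ge0.
Qed.

Lemma in_L2_pairing_integrable f g : in_L2 mu S N D f -> in_L2 mu S N D g ->
  mu.-integrable D (EFin \o (fun t => b (f t) (g t))).
Proof.
move=> Lf Lg; have if2 := in_L2_sqr_integrable Lf; have ig2 := in_L2_sqr_integrable Lg.
case: Lf => mf _; case: Lg => mg _.
apply: (dominated_integrable_fin mD (measurable_strong2 sib mf mg) _ (integrableD mD if2 ig2)).
move=> t Dt /=; have Sf := mf.1 t Dt; have Sg := mg.1 t Dt.
have := si_cauchy_abs sib Sf Sg; have := siN_ge0 sib Sf; have := siN_ge0 sib Sg.
by nra.
Qed.

Hypothesis Doo : (mu D < +oo)%E.

Lemma cst_integrable_fin (a : R) : mu.-integrable D (EFin \o (fun=> a)).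
Proof.
apply/integrableP; split; first exact/measurable_EFinP.
by rewrite integral_cst//= lte_mul_pinfty.
Qed.

Lemma in_L2_norm_integrable f : in_L2 mu S N D f ->
  mu.-integrable D (EFin \o (fun t => N (f t))).
Proof.
move=> Lf; have if2 := in_L2_sqr_integrable Lf; case: Lf => mf _.
apply: (dominated_integrable_fin mD (measurable_strong_norm sib mf) _
  (integrableD mD if2 (cst_integrable_fin 1))).
move=> t Dt /=; have N0 := siN_ge0 sib (mf.1 t Dt).
by rewrite ger0_norm//; nra.
Qed.

Lemma S_simple_integral (s : T -> X) : simple_function S s -> S (simple_integral mu D s).
Proof.
move=> [fs _ Ss]; rewrite /simple_integral fsbig_finite//.
have : forall y, y \in enum_fset (fset_set (range s)) -> S y.
  move=> y; rewrite [_ \in _](_ : _ = (y \in fset_set (range s)))//.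
  by rewrite in_fset_set// inE => -[t _ <-].
elim: (enum_fset _) => [_|y r ih Sr]; first by rewrite big_nil; exact: (si_0 sib).
rewrite big_cons; apply: (siSD sib).
  by apply: (siSZ sib); apply: Sr; rewrite mem_head.
by apply: ih => z zr; apply: Sr; rewrite inE zr orbT.
Qed.

Lemma simple_integral_pairing (s : T -> X) x : simple_function S s -> S x ->
  mu.-integrable D (EFin \o (fun t => b (s t) x)) /\
  b (simple_integral mu D s) x = \int[mu]_(t in D) b (s t) x.
Proof.
move=> [fs ms Ss] Sx.
have bE t : b (s t) x = \sum_(y <- fset_set (range s)) b y x * \1_(s @^-1` [set y]) t.
  rewrite (bigD1_seq (s t)) ?fset_uniq//=; last by rewrite in_fset_set// inE; exists t.
  rewrite indicE mem_set// mulr1 big1 ?addr0// => y yst.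
  by rewrite indicE memNset ?mulr0//= => /esym/eqP; rewrite (negbTE yst).
have iy y : mu.-integrable D (EFin \o (fun t => b y x * \1_(s @^-1` [set y]) t)).
  apply: (dominated_integrable_fin (g := fun=> `|b y x|) mD _ _ (cst_integrable_fin _)).
    by apply: measurable_funM => //; exact: measurable_indic.
  move=> t _; rewrite normrM ler_piMr// indicE.
  by case: (_ \in _); rewrite ?normr1 ?normr0.
have EFb : EFin \o (fun t => b (s t) x) =
    (fun t => \sum_(y <- fset_set (range s)) (b y x * \1_(s @^-1` [set y]) t)%:E)%E.
  by apply/funext => t /=; rewrite bE sumEFin.
split.
  by rewrite EFb; apply: (integrable_sum mD) => y _; exact: iy.
rewrite /Rintegral -[X in integral _ _ X]/(EFin \o (fun t => b (s t) x)) EFb (integral_sum mD)//.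
rewrite /simple_integral fsbig_finite//.
transitivity (fine (\sum_(y <- fset_set (range s)) (fine (mu (D `&` s @^-1` [set y])) * b y x)%:E)%E).
  rewrite sumEFin /=.
  have : forall y, y \in enum_fset (fset_set (range s)) -> S y.
    move=> y; rewrite [_ \in _](_ : _ = (y \in fset_set (range s)))//.
    by rewrite in_fset_set// inE => -[t _ <-].
  elim: (enum_fset _) => [_|y r ih Sr].
    by rewrite !big_nil (si0l sib).
  have Sy : S y by apply: Sr; rewrite mem_head.
  have {}Sr z : z \in r -> S z by move=> zr; apply: Sr; rewrite inE zr orbT.
  rewrite !big_cons -ih// (siDl sib)// ?(siZl sib)//; first exact: (siSZ sib).
  elim: r {ih} Sr => [_|z r ih Sr]; first by rewrite big_nil; exact: (si_0 sib).
  rewrite big_cons; apply: (siSD sib).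
    by apply: (siSZ sib); apply: Sr; rewrite mem_head.
  by apply: ih => z' z'r; apply: Sr; rewrite inE z'r orbT.
congr fine; apply: eq_bigr => y _; rewrite -[in RHS]/((EFin \o _) _).
rewrite [RHS](_ : _ = \int[mu]_(t in D) ((b y x)%:E * (\1_(s @^-1` [set y]) t)%:E))%E//.
rewrite integralZl//; last first.
  apply: (dominated_integrable_fin (g := fun=> 1) mD _ _ (cst_integrable_fin 1)).
    exact: measurable_indic.
  by move=> t _; rewrite indicE; case: (_ \in _); rewrite ?normr1 ?normr0.
rewrite integral_indic// setIC EFinM fineK 1?muleC// ge0_fin_numE//.
apply: le_lt_trans Doo; apply: le_measure; rewrite ?inE//.
exact: measurableI.
Qed.

(** This is how every Bochner integral of the problem, in the weak derivatives and in G, becomes an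
    integral of real functions. *)
Lemma bochner_pairing f v x : bochner_integral mu S N D f v -> S x ->
  mu.-integrable D (EFin \o (fun t => b (f t) x)) /\
  b v x = \int[mu]_(t in D) b (f t) x.
Proof.
move=> [Sv mf [s [ss sf sv]]] Sx.
have mfs k : strongly_measurable S N D (fun t => f t - s k t).
  apply: (strongly_measurableB sib) => //; split; first by move=> t _; case: (ss k).
  exists (fun=> s k) => // t Dt; rewrite subrr (siN0 sib); exact: cvg_cst.
have mfx : measurable_fun D (fun t => b (f t) x).
  apply: (measurable_strong2 sib mf); exact: (strongly_measurable_cst sib).
have Sfs k t : D t -> S (f t - s k t) by exact: (mfs k).1.
have Ss k t : S (s k t) by case: (ss k).
have Sf t : D t -> S (f t) by exact: mf.1.
have mN k : measurable_fun D (fun t => N (f t - s k t)).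
  exact: (measurable_strong_norm sib).
have NE k : (\int[mu]_(t in D) (N (f t - s k t))%:E =
             \int[mu]_(t in D) `|(N (f t - s k t))%:E|)%E.
  by apply: eq_integral => t /[!inE] Dt; rewrite gee0_abs// lee_fin (siN_ge0 sib)//; exact: Sfs.
(* Convergence to 0 in the extended reals makes these integrals finite only from some index on. *)
have iN : \forall k \near \oo, mu.-integrable D (EFin \o (fun t => N (f t - s k t))).
  have /fine_cvgP[+ _] := sf; apply: filterS => k.
  rewrite ge0_fin_numE; last first.
    by apply: integral_ge0 => t Dt; rewrite lee_fin (siN_ge0 sib)//; exact: Sfs.
  rewrite NE => h; apply/integrableP; split => //; exact/measurable_EFinP.
have iNx k : mu.-integrable D (EFin \o (fun t => N (f t - s k t))) ->
    mu.-integrable D (EFin \o (fun t => N (f t - s k t) * N x)).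
  by move=> h; exact: (integrableZr mD (N x) h).
have ifx : mu.-integrable D (EFin \o (fun t => b (f t) x)).
  have [k _ /(_ k (leqnn k)) ik] := iN.
  have [isk _] := simple_integral_pairing (ss k) Sx.
  have := integrableD mD (iNx k ik) (integrable_norm isk).
  apply: (dominated_integrable_fin mD mfx) => t Dt.
  rewrite (_ : b (f t) x = b (f t - s k t) x + b (s k t) x); last first.
    by rewrite (siBl sib)//; [ring|exact: Sf].
  rewrite (le_trans (ler_normD _ _))// lerD2r; apply: (si_cauchy_abs sib) => //.
  exact: Sfs.
split=> //.
(* Both sides are limits of the pairings of the simple integrals with [x]. *)
apply: (@cvg_unique _ (@Rhausdorff R) (b (simple_integral mu D (s k)) x @[k --> \oo])).
  apply: (cvg_dist_squeeze (h := fun k => N (simple_integral mu D (s k) - v) * N x)).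
    near=> k; have SI := S_simple_integral (ss k).
    by rewrite -(siBl sib)//; apply: (si_cauchy_abs sib) => //; exact: (siSB sib).
  by rewrite -(mul0r (N x)); apply: cvgM => //; exact: cvg_cst.
apply: (cvg_dist_squeeze (h := fun k => fine (\int[mu]_(t in D) (N (f t - s k t))%:E)%E * N x)).
  near=> k; have ik : mu.-integrable D (EFin \o (fun t => N (f t - s k t))).
    by near: k.
  have [isk ->] := simple_integral_pairing (ss k) Sx.
  rewrite distrC -RintegralB// -RintegralZr//.
  apply: le_trans (le_normr_Rintegral mD _) _; first exact: integrable_finB.
  apply: le_Rintegral => //; first 2 last.
  - move=> t Dt; rewrite -(siBl sib)//; last exact: Sf.
    apply: (si_cauchy_abs sib) => //; exact: Sfs.
  - by apply: integrable_norm; exact: integrable_finB.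
  - exact: iNx.
rewrite -(mul0r (N x)); apply: cvgM; last exact: cvg_cst.
exact: (fine_cvg sf).
Unshelve. all: end_near. Qed.

End bochner_pairing.

(** * Weak time derivatives and the energy identity *)

Section quadratic_remainder.
Context (R : realType).
Notation mu := (@lebesgue_measure R).
Implicit Types (F f : R -> R) (a b C : R).

(** A global quadratic remainder bound replaces differentiation rules: it survives sums and
    rescaling, and for piecewise quadratic functions it is a polynomial inequality in each case. *)
Lemma quadratic_remainder_is_derive F C x (l : R) :
  (forall h, `|F (x + h) - F x - l * h| <= C * h ^+ 2) -> is_derive x 1 F l.
Proof.
move=> H.
have cl : h^-1 *: ((F \o shift x) (h *: 1) - F x) @[h --> 0^'] --> l.
  apply: (cvg_dist_squeeze (h := fun h : R => C * `|h|)).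
    near=> h; have h0 : h != 0 by near: h; exact: nbhs_dnbhs_neq.
    rewrite /= [h *: 1]mulr1 [_ *: _]mulrC (addrC h x).
    have -> : (F (x + h) - F x) * h^-1 - l = (F (x + h) - F x - l * h) * h^-1.
      by rewrite [RHS]mulrBl mulfK.
    rewrite normrM normfV ler_pdivrMr ?normr_gt0// -mulrA -expr2 real_normK ?num_real//.
  rewrite -[X in _ --> X](mulr0 C); apply: cvgM; first exact: cvg_cst.
  by apply/norm_cvg0P; exact: cvg_within.
split; first by apply/cvg_ex; exists l.
exact/cvg_lim.
Unshelve. all: end_near. Qed.

Lemma quadratic_remainder_ftc F f a b C : a <= b -> continuous f ->
  (forall x h, `|F (x + h) - F x - f x * h| <= C * h ^+ 2) ->
  mu.-integrable `]a, b[ (EFin \o f) /\ \int[mu]_(x in `]a, b[) f x = F b - F a.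
Proof.
move=> ab cf H; have dF x := quadratic_remainder_is_derive (H x).
have cF x : F y @[y --> x] --> F x.
  apply: differentiable_continuous; apply/derivable1_diffP.
  by case: (dF x).
have [ab'|ab'] := eqVneq a b.
  rewrite ab' subrr set_itvoo0 Rintegral_set0; split => //.
  exact: integrable_set0.
have {ab ab'}ab : a < b by rewrite lt_neqAle ab'.
have ifc : mu.-integrable `[a, b] (EFin \o f).
  apply: continuous_compact_integrable; first exact: segment_compact.
  exact: continuous_subspaceT.
have ifo : mu.-integrable `]a, b[ (EFin \o f).
  by apply: integrableS ifc => //; exact: subset_itv_oo_cc.
split => //.
rewrite (@Rintegral_itv_obnd_cbnd _ a (BLeft b))// Rintegral_itv_bndo_bndc//; last first.
  by apply: integrableS ifc => //; apply: subset_itvl; rewrite bnd_simp.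
rewrite /Rintegral (continuous_FTC2 (F := F) ab)//.
- exact: continuous_subspaceT.
- split.
  + by move=> x _; case: (dF x).
  + exact: cvg_at_right_filter (cF a).
  + exact: cvg_at_left_filter (cF b).
- by move=> x _; rewrite derive1E; case: (dF x).
Qed.

End quadratic_remainder.

(** * Continuously differentiable ramps made of parabolas *)

Section ramp.
Context (R : realType).
Implicit Types x h e a : R.

Let pos x : R := Num.max x 0.

Let pos_cases x : (pos x = x /\ 0 <= x) \/ (pos x = 0 /\ x <= 0).
Proof. by rewrite /pos /Num.max; case: ltP => [/ltW|] ?; [right|left]. Qed.

Let pos_continuous : continuous pos.
Proof.
by move=> x; apply: (continuous_max (f := id) (g := cst 0)); [exact: cvg_id|exact: cvg_cst].
Qed.

(** A quadratic spline rising from 0 to 1 on [0, 1] with knots 0, 1/2, 1. Its derivative [unit_hat]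
    is the triangle of height 2 at 1/2, of integral 1. *)
Definition unit_ramp x : R :=
  2 * pos x ^+ 2 - 4 * pos (x - 2^-1) ^+ 2 + 2 * pos (x - 1) ^+ 2.
Definition unit_hat x : R := 4 * pos x - 8 * pos (x - 2^-1) + 4 * pos (x - 1).

Lemma unit_ramp_le0 x : x <= 0 -> unit_ramp x = 0.
Proof.
move=> x0; rewrite /unit_ramp.
by have [[-> ?]|[-> ?]] := pos_cases x; have [[-> ?]|[-> ?]] := pos_cases (x - 2^-1);
  have [[-> ?]|[-> ?]] := pos_cases (x - 1); nra.
Qed.

Lemma unit_ramp_ge1 x : 1 <= x -> unit_ramp x = 1.
Proof.
move=> x0; rewrite /unit_ramp.
by have [[-> ?]|[-> ?]] := pos_cases x; have [[-> ?]|[-> ?]] := pos_cases (x - 2^-1);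
  have [[-> ?]|[-> ?]] := pos_cases (x - 1); nra.
Qed.

Lemma unit_ramp_itv x : 0 <= unit_ramp x <= 1.
Proof.
rewrite /unit_ramp; apply/andP; split;
by have [[-> ?]|[-> ?]] := pos_cases x; have [[-> ?]|[-> ?]] := pos_cases (x - 2^-1);
  have [[-> ?]|[-> ?]] := pos_cases (x - 1); nra.
Qed.

Lemma unit_hat_ge0 x : 0 <= unit_hat x.
Proof.
rewrite /unit_hat.
by have [[-> ?]|[-> ?]] := pos_cases x; have [[-> ?]|[-> ?]] := pos_cases (x - 2^-1);
  have [[-> ?]|[-> ?]] := pos_cases (x - 1); lra.
Qed.

Lemma unit_hat_out x : (x <= 0) || (1 <= x) -> unit_hat x = 0.
Proof.
rewrite /unit_hat => /orP[] ?;
by have [[-> ?]|[-> ?]] := pos_cases x; have [[-> ?]|[-> ?]] := pos_cases (x - 2^-1);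
  have [[-> ?]|[-> ?]] := pos_cases (x - 1); lra.
Qed.

Lemma unit_hat_continuous : continuous unit_hat.
Proof.
move=> x; have cM k c : k * pos (y - c) @[y --> x] --> k * pos (x - c).
  apply: cvgM; first exact: cvg_cst.
  apply: (@continuous_comp _ _ _ (fun y => y - c) pos); last exact: pos_continuous.
  by apply: cvgB; [exact: cvg_id|exact: cvg_cst].
apply: cvgD; last exact: cM.
apply: cvgB; last exact: cM.
by apply: cvgM; [exact: cvg_cst|exact: pos_continuous].
Qed.

Let pos_remainder x h : `|pos (x + h) ^+ 2 - pos x ^+ 2 - 2 * pos x * h| <= h ^+ 2.
Proof.
rewrite ler_norml; apply/andP; split;
by have [[-> ?]|[-> ?]] := pos_cases x; have [[-> ?]|[-> ?]] := pos_cases (x + h); nra.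
Qed.

(** Each squared positive part has remainder at most h^2, and 8 = 2 + 4 + 2 adds the absolute
    coefficients. *)
Lemma unit_ramp_remainder x h :
  `|unit_ramp (x + h) - unit_ramp x - unit_hat x * h| <= 8 * h ^+ 2.
Proof.
have := pos_remainder x h; have := pos_remainder (x - 2^-1) h.
have := pos_remainder (x - 1) h; rewrite /unit_ramp /unit_hat !(addrAC x h).
by rewrite !ler_norml => /andP[? ?] /andP[? ?] /andP[? ?]; apply/andP; split; lra.
Qed.

Definition ramp e a x := unit_ramp ((x - a) / e).
Definition hat e a x := e^-1 * unit_hat ((x - a) / e).

Lemma ramp_remainder e a x h : 0 < e ->
  `|ramp e a (x + h) - ramp e a x - hat e a x * h| <= 8 / e ^+ 2 * h ^+ 2.
Proof.
move=> e0; have := unit_ramp_remainder ((x - a) / e) (h / e).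
rewrite /ramp /hat -mulrDl (_ : x - a + h = x + h - a); last by ring.
rewrite exprMn exprVn (_ : 8 * (h ^+ 2 / e ^+ 2) = 8 / e ^+ 2 * h ^+ 2); last by ring.
by rewrite (_ : unit_hat _ * (h / e) = e^-1 * unit_hat ((x - a) / e) * h); last by ring.
Qed.

Lemma hat_continuous e a : continuous (hat e a).
Proof.
move=> x; apply: cvgM; first exact: cvg_cst.
apply: (@continuous_comp _ _ _ (fun y => (y - a) / e) unit_hat); last exact: unit_hat_continuous.
by apply: cvgM; [apply: cvgB; [exact: cvg_id|exact: cvg_cst]|exact: cvg_cst].
Qed.

Lemma hat_ge0 e a x : 0 < e -> 0 <= hat e a x.
Proof. by move=> e0; apply: mulr_ge0; [rewrite invr_ge0 ltW|exact: unit_hat_ge0]. Qed.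

Lemma hat_out e a x : 0 < e -> (x <= a) || (a + e <= x) -> hat e a x = 0.
Proof.
move=> e0 xa; rewrite /hat unit_hat_out ?mulr0//.
by rewrite ler_pdivrMr// ler_pdivlMr//; apply/orP; case/orP: xa => ?; [left|right]; lra.
Qed.

Lemma ramp_le e a x : 0 < e -> x <= a -> ramp e a x = 0.
Proof. by move=> e0 xa; rewrite /ramp unit_ramp_le0// ler_pdivrMr//; lra. Qed.

Lemma ramp_ge e a x : 0 < e -> a + e <= x -> ramp e a x = 1.
Proof. by move=> e0 xa; rewrite /ramp unit_ramp_ge1// ler_pdivlMr//; lra. Qed.

End ramp.

Section weak_derivative.
Context (R : realType) (T : R).
Notation mu := (@lebesgue_measure R).
Context (g h : R -> R).
Hypothesis cg : forall t : R, t \in `[0, T] ->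
  g s @[s --> within `[0, T] (nbhs t)] --> g t.
Hypothesis ih : mu.-integrable `]0, T[ (EFin \o h).
Hypothesis wk : forall phi, C1c_time T phi ->
  mu.-integrable `]0, T[ (EFin \o (fun t => derive1 phi t * g t)) /\
  \int[mu]_(t in `]0, T[) (derive1 phi t * g t) =
    - \int[mu]_(t in `]0, T[) (phi t * h t).

(** Rises on [s + e, s + 2e] and falls on [t - 2e, t - e]. The margins of width e keep the support
    inside the open interval even for s = 0 and t = T. *)
Let test_ramp (s t e x : R) : R := ramp e (s + e) x - ramp e (t - 2 * e) x.
Let dtest_ramp (s t e x : R) : R := hat e (s + e) x - hat e (t - 2 * e) x.

Let test_ramp_derive (s t e x : R) : 0 < e ->
  is_derive x 1 (test_ramp s t e) (dtest_ramp s t e x).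
Proof.
move=> e0; apply: (@quadratic_remainder_is_derive _ _ (16 / e ^+ 2)) => y.
have := ramp_remainder (s + e) x y e0; have := ramp_remainder (t - 2 * e) x y e0.
rewrite /test_ramp /dtest_ramp (_ : 16 / e ^+ 2 * y ^+ 2 = 8 / e ^+ 2 * y ^+ 2 + 8 / e ^+ 2 * y ^+ 2); last by ring.
move: (8 / _ * _) => B; rewrite !ler_norml => /andP[? ?] /andP[? ?]; apply/andP; split; lra.
Qed.

Let derive1_test_ramp (s t e : R) : 0 < e ->
  derive1 (test_ramp s t e) = dtest_ramp s t e.
Proof.
by move=> e0; apply/funext => x; rewrite derive1E; case: (test_ramp_derive s t x e0).
Qed.

Let test_ramp_C1c (s t e : R) : 0 <= s -> t <= T -> 0 < e -> 4 * e <= t - s ->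
  C1c_time T (test_ramp s t e).
Proof.
move=> s0 tT e0 e4; split.
- by move=> x; case: (test_ramp_derive s t x e0).
- rewrite derive1_test_ramp// => x.
  by apply: cvgB; exact: hat_continuous.
- exists (s + e), (t - e); split; [lra|lra|move=> x].
  rewrite in_itv/= negb_and -!ltNge => /orP[] xst; rewrite /test_ramp.
    by rewrite !ramp_le ?subrr//; lra.
  by rewrite !ramp_ge ?subrr//; lra.
Qed.

Let hat_integral (e a : R) : 0 < e -> 0 <= a -> a + e <= T ->
  mu.-integrable `]0, T[ (EFin \o hat e a) /\ \int[mu]_(x in `]0, T[) hat e a x = 1.
Proof.
move=> e0 a0 aT; have T0 : 0 <= T by lra.
have [i ->] := quadratic_remainder_ftc T0 (@hat_continuous _ e a)
  (fun x y => ramp_remainder a x y e0).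
by split=> //; rewrite ramp_ge// ramp_le// subr0.
Qed.

(** The derivative of the test function is a hat of mass one near s minus one near t, so pairing it
    with [g] gives local averages of [g], which differ from [g s] and [g t] by at most [eta]
    each. *)
Let test_ramp_pairing (s t e eta : R) :
  0 <= s -> t <= T -> 0 < e -> 4 * e <= t - s ->
  (forall x, x \in `[0, T] -> s <= x <= s + 2 * e -> `|g x - g s| <= eta) ->
  (forall x, x \in `[0, T] -> t - 2 * e <= x <= t -> `|g x - g t| <= eta) ->
  `|\int[mu]_(x in `]0, T[) (test_ramp s t e x * h x) - (g t - g s)| <= 2 * eta.
Proof.
move=> s0 tT e0 e4 gs gt.
have [ip /eqP] := wk (test_ramp_C1c s0 tT e0 e4); rewrite eq_sym eqr_oppLR => /eqP ->.
have [||i1 I1] := @hat_integral e (s + e) e0; [lra|lra|].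
have [||i2 I2] := @hat_integral e (t - 2 * e) e0; [lra|lra|].
rewrite derive1_test_ramp// in ip *.
have mT : measurable (`]0, T[ : set (measurableTypeR R)) by exact: measurable_itv.
pose k x := hat e (s + e) x * g s - hat e (t - 2 * e) x * g t.
have iZ (f : R -> R) (y : R) : mu.-integrable `]0, T[ (EFin \o f) ->
    mu.-integrable `]0, T[ (EFin \o (fun x => f x * y)).
  by move=> fi; exact: (integrableZr mT y fi).
have ik : mu.-integrable `]0, T[ (EFin \o k).
  by apply: integrable_finB => //; exact: iZ.
have Ik : \int[mu]_(x in `]0, T[) k x = g s - g t.
  by rewrite /k RintegralB ?RintegralZr//; [rewrite I1 I2 !mul1r|exact: iZ|exact: iZ].
rewrite (_ : - _ - _ = - (\int[mu]_(x in `]0, T[) (dtest_ramp s t e x * g x - k x))); last first.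
  by rewrite RintegralB// Ik; ring.
rewrite normrN; apply: le_trans (le_normr_Rintegral mT _) _.
  exact: integrable_finB.
rewrite (_ : 2 * eta = \int[mu]_(x in `]0, T[) ((hat e (s + e) x + hat e (t - 2 * e) x) * eta)); last first.
  by rewrite RintegralZr ?RintegralD ?I1 ?I2//; exact: integrable_finD.
apply: le_Rintegral => //.
- by apply: integrable_norm; exact: integrable_finB.
- by apply: iZ; exact: integrable_finD.
move=> x /= xT; have {}xT : x \in `[0, T] by exact: subset_itv_oo_cc.
rewrite /dtest_ramp /k.
rewrite (_ : _ - _ = hat e (s + e) x * (g x - g s) - hat e (t - 2 * e) x * (g x - g t)); last by ring.
apply: (le_trans (ler_normB _ _)).
have ab (a : R) : `|hat e a x| = hat e a x by rewrite ger0_norm// hat_ge0.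
rewrite (normrM (hat e (s + e) x)) (normrM (hat e (t - 2 * e) x)) !ab.
rewrite (mulrDl (hat e (s + e) x)).
apply: lerD.
- have [xout|] := boolP ((x <= s + e) || (s + e + e <= x)).
    by rewrite hat_out// !mul0r.
  rewrite negb_or -!ltNge => /andP[? ?]; apply: ler_wpM2l; first exact: hat_ge0.
  by apply: gs => //; apply/andP; split; lra.
- have [xout|] := boolP ((x <= t - 2 * e) || (t - 2 * e + e <= x)).
    by rewrite hat_out// !mul0r.
  rewrite negb_or -!ltNge => /andP[? ?]; apply: ler_wpM2l; first exact: hat_ge0.
  by apply: gt => //; apply/andP; split; lra.
Qed.

(** As e tends to 0 the test functions converge to the indicator of ]s, t[. Dominated convergence
    gives the integral of [h], while continuity of [g] gives the difference of its end values. *)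
Lemma weak_derivative_ftc (s t : R) : 0 <= s -> s < t -> t <= T ->
  g t - g s = \int[mu]_(x in `]s, t[) h x.
Proof.
move=> s0 st tT.
have mT : measurable (`]0, T[ : set (measurableTypeR R)) by exact: measurable_itv.
(* The quarter ensures [4 * e k <= t - s]: the rise ends before the fall begins. *)
pose e (k : nat) := (t - s) / 4 * k.+1%:R^-1 : R.
have ts4 : 0 < (t - s) / 4 by lra.
have e0 k : 0 < e k by rewrite mulr_gt0// invr_gt0 ltr0n.
have e4 k : 4 * e k <= t - s.
  have : k.+1%:R^-1 <= 1 :> R by rewrite invf_le1// ler1n.
  move=> k1; rewrite /e (_ : 4 * _ = (t - s) * k.+1%:R^-1); last by field.
  by rewrite ler_piMr//; lra.
have e_cvg : e k @[k --> \oo] --> (0 : R).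
  rewrite -(mulr0 ((t - s) / 4)); apply: cvgM; first exact: cvg_cst.
  exact: cvg_harmonic.
pose phi k := test_ramp s t (e k).
pose I k := \int[mu]_(x in `]0, T[) (phi k x * h x).
apply: (@cvg_unique _ (@Rhausdorff R) (I k @[k --> \oo])).
  apply/cvgrPdist_le => eta eta0.
  have cont y : y \in `[0, T] -> exists2 d : R, 0 < d &
      forall x, x \in `[0, T] -> `|x - y| < d -> `|g x - g y| <= eta / 2.
    move=> yT; have /cvgrPdistC_le/(_ (eta / 2)) := cg yT.
    have eta2 : 0 < eta / 2 by lra.
    move=> /(_ eta2)[d /= d0 dP]; exists d => // x xT xy.
    by apply: dP => //=; rewrite distrC.
  have [|d1 d10 d1P] := cont s; first by rewrite in_itv/=; apply/andP; split; lra.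
  have [|d2 d20 d2P] := cont t; first by rewrite in_itv/=; apply/andP; split; lra.
  have d0 : 0 < Num.min d1 d2 / 2 by rewrite divr_gt0// lt_min d10.
  have /cvgrPdist_lt/(_ _ d0) := e_cvg.
  apply: filterS => k; rewrite sub0r normrN gtr0_norm// ltr_pdivlMr// lt_min => /andP[ed1 ed2].
  rewrite distrC (_ : eta = 2 * (eta / 2)); last by field.
  apply: test_ramp_pairing => //.
    move=> x xT /andP[? ?]; apply: d1P => //.
    by rewrite ger0_norm; lra.
  move=> x xT /andP[? ?]; apply: d2P => //.
  by rewrite ler0_norm; lra.
have mphi k : measurable_fun setT (phi k).
  apply: continuous_measurable_fun => x.
  apply: differentiable_continuous; apply/derivable1_diffP.
  by case: (test_ramp_C1c s0 tT (e0 k) (e4 k)) => + _ _; exact.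
have mh : measurable_fun `]0, T[ h by apply/measurable_EFinP; exact: (measurable_int mu).
have phi1 k x : `|phi k x| <= 1.
  have := unit_ramp_itv ((x - (s + e k)) / e k).
  have := unit_ramp_itv ((x - (t - 2 * e k)) / e k).
  by rewrite /phi /test_ramp /ramp ler_norml => /andP[? ?] /andP[? ?]; apply/andP; split; lra.
have [|||||ihl _ cvgI] := @dominated_convergence _ _ _ mu _ mT
    (fun k x => (phi k x * h x)%:E) (EFin \o (h \_ `]s, t[)) (EFin \o (fun x => `|h x|)).
- move=> k; apply/measurable_EFinP; apply: measurable_funM => //.
  exact: measurable_funS (mphi k).
- apply/measurable_EFinP; apply/measurable_restrict => //.
  by apply: measurable_funS mh => //; exact: subIsetr.
- apply: aeW => x _; apply: cvg_EFin; first by apply: nearW.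
  rewrite /comp /=.
  (* At a fixed point the sequence is eventually constant: 1 times [h x] strictly inside ]s, t[, and
     0 outside. *)
  apply: cvg_near_cst.
  rewrite patchE; case: ifPn; rewrite ?inE ?notin_setE /= in_itv/=.
    move=> /andP[sx xt].
    have d0 : 0 < Num.min (x - s) (t - x) / 2 by rewrite divr_gt0// lt_min; apply/andP; split; lra.
    have /cvgrPdist_lt/(_ _ d0) := e_cvg.
    apply: filterS => k; rewrite sub0r normrN gtr0_norm// ltr_pdivlMr// lt_min => /andP[ed1 ed2].
    rewrite /phi /test_ramp ramp_ge; [|exact: e0|lra].
    by rewrite ramp_le; [rewrite subr0 mul1r|exact: e0|lra].
  move=> /negP; rewrite negb_and -!leNgt => xst.
  apply: nearW => k; have ek := e0 k; have ek4 := e4 k.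
  case/orP: xst => xst; rewrite /phi /test_ramp.
    by rewrite !ramp_le ?subrr ?mul0r//; lra.
  by rewrite !ramp_ge ?subrr ?mul0r//; lra.
- exact: integrable_norm.
- by apply: aeW => x k _ /=; rewrite lee_fin normrM ler_piMl.
have -> : \int[mu]_(x in `]s, t[) h x = \int[mu]_(x in `]0, T[) (h \_ `]s, t[) x.
  rewrite -Rintegral_mkcondr; congr (Rintegral _ _ _).
  apply/esym/setIidPr => x /=; rewrite !in_itv/= => /andP[? ?].
  by apply/andP; split; lra.
apply: fine_cvg; rewrite fineK//.
exact: integrable_fin_num.
Qed.

End weak_derivative.

(** * Chaining of time intervals and splitting of integrals *)

Section interval_lemmas.
Context (R : realType).
Notation mu := (@lebesgue_measure R).
Implicit Types a b s t m x y d : R.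

(* compactness of [a, b] in the form of Cousin's lemma *)
Lemma interval_chaining a b (P : R -> R -> Prop) : a <= b ->
  (forall s m t, a <= s -> s <= m -> m <= t -> t <= b -> P s m -> P m t -> P s t) ->
  (forall x, a <= x -> x <= b -> exists2 d, 0 < d & forall s t,
     a <= s -> s <= x -> x <= t -> t <= b -> x - d < s -> t < x + d -> P s t) ->
  P a b.
Proof.
move=> ab Padd Ploc.
pose A := [set x | a <= x <= b /\ P a x].
have Aa : A a.
  split; first by rewrite lexx.
  by have [d d0 H] := Ploc a (lexx _) ab; apply: H; lra.
have Aub : ubound A b by move=> x [/andP[_ ?] _].
have hs : has_sup A by split; [exists a|exists b].
have az : a <= sup A by apply: ub_le_sup => //; exact: hs.2.
have zb : sup A <= b by apply: ge_sup => //; exact: hs.1.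
have [d d0 H] := Ploc _ az zb.
have [x [/andP[ax xb] Pax] zx] := sup_adherent d0 hs.
have xz : x <= sup A by apply: ub_le_sup => //; [exact: hs.2|split=> //; apply/andP].
have Py y : sup A <= y -> y <= b -> y < sup A + d -> P a y.
  by move=> zy yb yd; apply: (Padd a x y) => //; [lra|apply: H].
have [zb'|bz] := ltP (sup A) b; last by apply: Py => //; lra.
pose y := Num.min (sup A + d / 2) b.
have zy : sup A < y by rewrite lt_min zb' andbT; lra.
have yb : y <= b by rewrite ge_min lexx orbT.
have yd : y < sup A + d.
  by apply: (@le_lt_trans _ _ (sup A + d / 2)); [rewrite ge_min lexx|lra].
have : A y by split; [apply/andP; split; lra|apply: Py; lra].
move=> Ay; have : y <= sup A by apply: ub_le_sup => //; exact: hs.2.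
by rewrite leNgt zy.
Qed.

Lemma Rintegral_itv_split (f : R -> R) s m t : s <= m -> m <= t ->
  mu.-integrable `]s, t[ (EFin \o f) ->
  \int[mu]_(x in `]s, t[) f x =
    \int[mu]_(x in `]s, m[) f x + \int[mu]_(x in `]m, t[) f x.
Proof.
move=> sm; rewrite le_eqVlt => /predU1P[<- ifs|mt ifs].
  by rewrite set_itvoo0 Rintegral_set0 addr0.
rewrite -(@Rintegral_itvB _ f (BRight s) (BLeft t) m)// ?bnd_simp//.
rewrite [X in _ = X + _]Rintegral_itv_bndo_bndc ?(addrC _ (_ - _)) ?subrK//.
by apply: integrableS ifs => //; apply: subset_itvl; rewrite bnd_simp ltW.
Qed.

Lemma subset_itvoo s t a b : a <= s -> t <= b ->
  [set` `]s, t[ ] `<=` [set` `]a, b[ ].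
Proof. by move=> as_ tb x /=; rewrite !in_itv/= => /andP[? ?]; apply/andP; split; lra. Qed.

Lemma Rintegral_itv_mono (f : R -> R) s t a b : a <= s -> s <= t -> t <= b ->
  (forall x, x \in `]a, b[ -> 0 <= f x) -> mu.-integrable `]a, b[ (EFin \o f) ->
  \int[mu]_(x in `]s, t[) f x <= \int[mu]_(x in `]a, b[) f x.
Proof.
move=> as_ st tb f0 fi.
rewrite (Rintegral_itv_split as_ _ fi); last by lra.
rewrite (Rintegral_itv_split st tb); last first.
  by apply: integrableS fi => //; apply: subset_itvoo.
rewrite addrCA lerDl addr_ge0//; apply: Rintegral_ge0 => x /=; rewrite in_itv/= => /andP[? ?];
  by apply: f0; rewrite in_itv/=; apply/andP; split; lra.
Qed.

End interval_lemmas.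

Section energy.
Context (R : realType).
Notation mu := (@lebesgue_measure R).
Context (X : lmodType R) (S : set X) (b : X -> X -> R) (N : X -> R).
Hypothesis sib : semi_inner S b N.

(** On a short interval the increment of |e|^2 is the increment of [e] paired with the fixed vector
    [e t + e s], hence the integral of [b (e' y) (e t + e s)]. By continuity this vector is close to
    [2 *: e y]. The resulting error is a small multiple of the integral of [N (e' y)], an additive
    bound, so the chaining lemma extends it from short intervals to the whole one. *)
Lemma energy_identity (e e' : R -> X) (alpha beta : R) : alpha <= beta ->
  (forall x, x \in `[alpha, beta] -> S (e x)) ->
  (forall x, x \in `]alpha, beta[ -> S (e' x)) ->
  (forall x, x \in `[alpha, beta] -> forall eta : R, 0 < eta -> exists2 d : R, 0 < d &
     forall y, y \in `[alpha, beta] -> `|y - x| < d -> N (e y - e x) <= eta) ->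
  mu.-integrable `]alpha, beta[ (EFin \o (fun x => N (e' x))) ->
  mu.-integrable `]alpha, beta[ (EFin \o (fun x => b (e' x) (e x))) ->
  (forall z s t, S z -> alpha <= s -> s < t -> t <= beta ->
    mu.-integrable `]s, t[ (EFin \o (fun x => b (e' x) z)) /\
    b (e t) z - b (e s) z = \int[mu]_(x in `]s, t[) b (e' x) z) ->
  b (e beta) (e beta) - b (e alpha) (e alpha) =
    2 * \int[mu]_(x in `]alpha, beta[) b (e' x) (e x).
Proof.
move=> ab Se Se' ce iN ib wk.
suff H eps : 0 < eps ->
    `|b (e beta) (e beta) - b (e alpha) (e alpha) -
      2 * \int[mu]_(x in `]alpha, beta[) b (e' x) (e x)| <=
    eps * \int[mu]_(x in `]alpha, beta[) N (e' x).
  apply/eqP; rewrite -subr_eq0 -normr_le0; apply/ler_addgt0Pl => eps eps0.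
  rewrite addr0; pose J := \int[mu]_(x in `]alpha, beta[) N (e' x).
  have J0 : 0 <= J by apply: Rintegral_ge0 => x xab; apply: (siN_ge0 sib); exact: Se'.
  have J1 : 0 < J + 1 by lra.
  apply: (le_trans (H (eps / (J + 1)) _)); first by rewrite divr_gt0.
  by rewrite -/J -mulrAC ler_pdivrMr// ler_pM2l//; lra.
move=> eps0.
apply: (@interval_chaining _ alpha beta (fun s t =>
  `|b (e t) (e t) - b (e s) (e s) - 2 * \int[mu]_(x in `]s, t[) b (e' x) (e x)| <=
    eps * \int[mu]_(x in `]s, t[) N (e' x))) => //.
  move=> s m t as_ sm mt tb Psm Pmt.
  have sub : [set` `]s, t[ ] `<=` [set` `]alpha, beta[ ] by exact: subset_itvoo.
  rewrite !(Rintegral_itv_split sm mt); [|exact: integrableS iN|exact: integrableS ib].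
  move: Psm Pmt; rewrite !ler_norml => /andP[? ?] /andP[? ?].
  by apply/andP; split; lra.
move=> x ax xb; have xab : x \in `[alpha, beta] by rewrite in_itv/= ax.
(* Relative to [e x], the vector [e t + e s - 2 *: e y] contains one difference at t, one at s and
   two at y, hence the quarter. *)
have eps4 : 0 < eps / 4 by lra.
have [d d0 dP] := ce x xab _ eps4.
exists d => // s t as_ sx xt tb ds td.
have [->|st] := eqVneq s t.
  by rewrite set_itvoo0 !Rintegral_set0 !mulr0 !subrr normr0.
have {}st : s < t by rewrite lt_neqAle st; lra.
have sub : [set` `]s, t[ ] `<=` [set` `]alpha, beta[ ] by exact: subset_itvoo.
have Ss : S (e s) by apply: Se; rewrite in_itv/=; apply/andP; split; lra.
have St : S (e t) by apply: Se; rewrite in_itv/=; apply/andP; split; lra.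
have Sst := siSD sib St Ss.
have [ist] := wk _ _ _ Sst as_ st tb.
rewrite !(siDr sib)// (si_sym sib Ss St) => E.
have {}E : b (e t) (e t) - b (e s) (e s) = \int[mu]_(x0 in `]s, t[) b (e' x0) (e t + e s).
  by rewrite -E; ring.
have ibs : mu.-integrable `]s, t[ (EFin \o (fun x => b (e' x) (e x))) by exact: integrableS ib.
have iNs : mu.-integrable `]s, t[ (EFin \o (fun x => N (e' x))) by exact: integrableS iN.
rewrite E -RintegralZl// -RintegralB//; last exact: integrable_finZ.
apply: le_trans (le_normr_Rintegral _ _) _ => //.
  by apply: integrable_finB => //; exact: integrable_finZ.
rewrite -RintegralZl//; apply: le_Rintegral => //.
- by apply: integrable_norm; apply: integrable_finB => //; exact: integrable_finZ.
- exact: integrable_finZ.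
move=> y /= yst; have yab : y \in `]alpha, beta[ by exact: sub.
have yab' : y \in `[alpha, beta] by exact: subset_itv_oo_cc.
have Sy := Se _ yab'; have Sy' := Se' _ yab; have Sx := Se _ xab.
have S2y := siSZ sib 2 Sy.
rewrite -(siZr sib)// -(siBr sib)// (le_trans (si_cauchy_abs sib _ _))//.
  exact: (siSB sib).
rewrite mulrC; apply: ler_wpM2r; first exact: (siN_ge0 sib).
rewrite (_ : _ - _ = (e t - e x) + (e s - e x) - 2 *: (e y - e x)); last first.
  rewrite scalerBr (scaler_nat 2 (e x)) mulr2n.
  by rewrite opprB addrA (addrACA (e t)) -opprD subrK.
have near z : z \in `[alpha, beta] -> s <= z <= t -> N (e z - e x) <= eps / 4.
  move=> zab /andP[sz zt]; apply: dP => //.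
  by rewrite ltr_norml; apply/andP; split; lra.
move: yst; rewrite in_itv/= => /andP[sy yt].
have Nt : N (e t - e x) <= eps / 4.
  by apply: near; rewrite ?in_itv/=; apply/andP; split; lra.
have Ns : N (e s - e x) <= eps / 4.
  by apply: near; rewrite ?in_itv/=; apply/andP; split; lra.
have Ny : N (e y - e x) <= eps / 4 by apply: near => //; apply/andP; split; lra.
have Stx := siSB sib St Sx; have Ssx := siSB sib Ss Sx; have Syx := siSB sib Sy Sx.
have := siN_triangle sib (siSD sib Stx Ssx) (siSN sib (siSZ sib 2 Syx)).
have := siN_triangle sib Stx Ssx.
rewrite (siN_opp sib); last exact: (siSZ sib).
rewrite (siNZ sib)// ger0_norm//; lra.
Qed.

End energy.

Section H1_energy.
Context (R : realType).
Notation mu := (@lebesgue_measure R).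
Context (X : lmodType R) (S : set X) (b : X -> X -> R) (N : X -> R).
Hypothesis sib : semi_inner S b N.
Context (T : R).

Let mT : measurable (`]0, T[ : set (measurableTypeR R)).
Proof. exact: measurable_itv. Qed.

Lemma lebesgue_itvoo_lty (s t : R) : (mu `]s, t[ < +oo)%E.
Proof. by rewrite lebesgue_measure_itv/=; case: ifP => // _; rewrite ltry. Qed.

Lemma strongly_measurable_affine (D : set R) (z0 z1 : X) (c d : R) :
  measurable (D : set (measurableTypeR R)) -> S z0 -> S z1 ->
  strongly_measurable S N D (fun t => z0 + ((t - c) / d) *: z1).
Proof.
move=> mD Sz0 Sz1.
rewrite (_ : (fun _ => _) = fun t => 1 *: (((t - c) / d) *: z1) + z0); last first.
  by apply/funext => t; rewrite scale1r addrC.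
apply: (strongly_measurable_lin sib); last exact: (strongly_measurable_cst sib).
apply: (strongly_measurable_scale sib) => //.
by apply: measurable_funM => //; exact: measurable_funB.
Qed.

(** [(t - c) / d] is the local coordinate of a time step; [z1 = 0] covers the distance to a
    constant. *)
Lemma in_L2_affine (f : R -> X) (z0 z1 : X) (c d alpha beta : R) :
  in_L2 mu S N `]0, T[ f -> 0 <= alpha -> beta <= T -> S z0 -> S z1 ->
  in_L2 mu S N `]alpha, beta[ (fun t => f t - (z0 + ((t - c) / d) *: z1)).
Proof.
move=> Lf a0 bT Sz0 Sz1.
have mab : measurable (`]alpha, beta[ : set (measurableTypeR R)) by exact: measurable_itv.
have sub : [set` `]alpha, beta[ ] `<=` [set` `]0, T[ ] by exact: subset_itvoo.
have mf : strongly_measurable S N `]alpha, beta[ f.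
  case: Lf => -[Sf [s ss sf]] _; split; first by move=> t /sub; exact: Sf.
  by exists s => // t /sub; exact: sf.
have me := strongly_measurableB sib mf (strongly_measurable_affine c d mab Sz0 Sz1).
split => //.
pose M := N z0 + (`|alpha - c| + `|beta - c|) * `|d^-1| * N z1.
have M0 : 0 <= M.
  by rewrite addr_ge0 ?(siN_ge0 sib)// mulr_ge0 ?(siN_ge0 sib)// mulr_ge0// addr_ge0.
have if2 : mu.-integrable `]alpha, beta[ (EFin \o (fun t => N (f t) ^+ 2)).
  exact: (integrableS mT mab sub (in_L2_sqr_integrable sib Lf)).
have := integrable_finZ 2 mab (integrable_finD mab if2
  (cst_integrable_fin mab (lebesgue_itvoo_lty alpha beta) (M ^+ 2))).
rewrite /L2_sqnorm.
set e := (X in _ -> (\int[_]_(t in _) (N (X t) ^+ 2)%:E < _)%E) => iM.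
have ie2 : mu.-integrable `]alpha, beta[ (EFin \o (fun t => N (e t) ^+ 2)).
  apply: (dominated_integrable_fin mab _ _ iM).
    by apply: measurable_funX; exact: (measurable_strong_norm sib).
  move=> t tab; rewrite ger0_norm ?sqr_ge0//.
  have Sft := mf.1 t tab; have Saz := siSZ sib ((t - c) / d) Sz1.
  have Sa := siSD sib Sz0 Saz; have Set_ := siSB sib Sft Sa.
  have h : N (e t) <= N (f t) + M.
    apply: (le_trans (siN_triangle sib Sft (siSN sib Sa))).
    rewrite lerD2l (siN_opp sib)//; apply: (le_trans (siN_triangle sib Sz0 Saz)).
    rewrite lerD2l (siNZ sib)// normrM ler_wpM2r// ?(siN_ge0 sib)// ler_wpM2r//.
    move: tab; rewrite /= in_itv/= => /andP[? ?].
    by rewrite ler_norml; apply/andP; split;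
      have := ler_norm (alpha - c); have := ler_norm (beta - c);
      have := ler_norm (- (alpha - c)); have := ler_norm (- (beta - c)); rewrite !normrN; lra.
  have := siN_ge0 sib Set_; have := siN_ge0 sib Sft.
  have := sqr_ge0 (N (f t) - M); nra.
case/integrableP : ie2 => _; apply: le_lt_trans; rewrite le_eqVlt; apply/orP; left; apply/eqP.
by apply: eq_integral => t _ /=; rewrite ger0_norm// sqr_ge0.
Qed.

Context (u ut : R -> X).
Hypothesis uH1 : in_H1 S N T u ut.

Let Su t : t \in `[0, T] -> S (u t).
Proof. by case: uH1 => + _ _ _; move=> cu /cu[]. Qed.

Let Sut t : t \in `]0, T[ -> S (ut t).
Proof. by case: uH1 => _ _ [[+ _] _] _; exact. Qed.

Let integrable_ut z : S z -> mu.-integrable `]0, T[ (EFin \o (fun t => b (ut t) z)).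
Proof.
move=> Sz; case: uH1 => _ _ Lut _.
have := in_L2_norm_integrable sib mT (lebesgue_itvoo_lty 0 T) Lut.
move=> /(integrableZr mT (N z)); apply: dominated_integrable_fin => //.
  apply: (measurable_strong2 sib Lut.1); exact: (strongly_measurable_cst sib).
move=> t tT; apply: (si_cauchy_abs sib) => //; exact: Sut.
Qed.

(** After pairing with [z], the weak derivative is scalar and [weak_derivative_ftc] applies;
    [energy_identity] takes the derivative in this form. *)
Lemma in_H1_pairing z s t : S z -> 0 <= s -> s < t -> t <= T ->
  mu.-integrable `]s, t[ (EFin \o (fun x => b (ut x) z)) /\
  b (u t) z - b (u s) z = \int[mu]_(x in `]s, t[) b (ut x) z.
Proof.
move=> Sz s0 st tT; split.
  apply: integrableS (integrable_ut Sz) => //; exact: subset_itvoo.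
apply: (@weak_derivative_ftc _ T (fun x => b (u x) z) (fun x => b (ut x) z)) => //.
- move=> {s0 st} x xT; have [cu0 _ _ _] := uH1; have [Sx cu] := cu0 x xT.
  apply: (cvg_dist_squeeze (h := fun s => N (u s - u x) * N z)).
    apply: filterS (near_withinT [set` `[0, T]] (nbhs_filter x)) => s' sT.
    have Ss := Su sT; by rewrite -(siBl sib)//; apply: (si_cauchy_abs sib) => //; exact: (siSB sib).
  by rewrite -[X in _ --> X](mul0r (N z)); apply: cvgM; [exact: cu|exact: cvg_cst].
- exact: integrable_ut.
- move=> phi phiC; case: uH1 => _ _ _ /(_ phi phiC)[v [bu but]].
  have Sv : S v by case: bu.
  have [iu Iu] := bochner_pairing sib mT (lebesgue_itvoo_lty 0 T) bu Sz.
  have [iut Iut] := bochner_pairing sib mT (lebesgue_itvoo_lty 0 T) but Sz.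
  have Eu x : x \in `]0, T[ -> b (derive1 phi x *: u x) z = derive1 phi x * b (u x) z.
    move=> xT; rewrite (siZl sib)//; apply: Su; exact: subset_itv_oo_cc.
  split.
    apply: eq_integrable iu => // x; rewrite inE => xT.
    by rewrite /= Eu.
  rewrite (@eq_Rintegral _ _ _ mu _ (fun x => b (derive1 phi x *: u x) z)); last first.
    by move=> x; rewrite inE => xT; rewrite Eu.
  rewrite -Iu -[LHS]opprK -(siNl sib)// Iut; congr (- _).
  apply: eq_Rintegral => x; rewrite inE => xT.
  by rewrite (siZl sib)//; exact: Sut.
Qed.

Lemma H1_affine_energy (z0 z1 : X) (c d alpha beta : R) : S z0 -> S z1 ->
  0 <= alpha -> alpha <= beta -> beta <= T ->
  let e t := u t - (z0 + ((t - c) / d) *: z1) in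
  let e' t := ut t - d^-1 *: z1 in
  [/\ in_L2 mu S N `]alpha, beta[ e,
      mu.-integrable `]alpha, beta[ (EFin \o (fun t => b (e' t) (e t))) &
      b (e beta) (e beta) - b (e alpha) (e alpha) =
        2 * \int[mu]_(t in `]alpha, beta[) b (e' t) (e t)].
Proof.
move=> Sz0 Sz1 a0 ab bT e e'.
have [cu Lu Lut _] := uH1.
have mab : measurable (`]alpha, beta[ : set (measurableTypeR R)) by exact: measurable_itv.
have sub : [set` `]alpha, beta[ ] `<=` [set` `]0, T[ ] by exact: subset_itvoo.
have Se t : t \in `[alpha, beta] -> S (e t).
  rewrite in_itv/= => /andP[? ?]; apply: (siSB sib).
    by apply: Su; rewrite in_itv/=; apply/andP; split; lra.
  by apply: (siSD sib) => //; exact: (siSZ sib).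
have Se' t : t \in `]alpha, beta[ -> S (e' t).
  by move=> tab; apply: (siSB sib); [apply: Sut; exact: sub|exact: (siSZ sib)].
have Le : in_L2 mu S N `]alpha, beta[ e by exact: in_L2_affine.
have Le' : in_L2 mu S N `]alpha, beta[ e'.
  have := in_L2_affine 0 1 Lut a0 bT (siSZ sib d^-1 Sz1) (si_0 sib).
  rewrite (_ : (fun t => _ - _) = e')//; apply/funext => t.
  by rewrite scaler0 addr0.
have cue x : x \in `[alpha, beta] -> forall eta : R, 0 < eta -> exists2 d : R, 0 < d &
     forall y, y \in `[alpha, beta] -> `|y - x| < d -> N (e y - e x) <= eta.
  move=> xab eta eta0.
  have xT : x \in `[0, T].
    by move: xab; rewrite !in_itv/= => /andP[? ?]; apply/andP; split; lra.
  have [Sx /cvgrPdistC_le] := cu x xT.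
  have eta2 : 0 < eta / 2 by lra.
  move=> /(_ _ eta2)[d1 /= d10 d1P].
  pose M := N (d^-1 *: z1); have M0 : 0 <= M by apply: (siN_ge0 sib); exact: (siSZ sib).
  have M1 : 0 < M + 1 by lra.
  exists (Num.min d1 (eta / 2 / (M + 1))); first by rewrite lt_min d10/= divr_gt0.
  move=> y yab; rewrite lt_min => /andP[yd1]; rewrite ltr_pdivlMr// => yM.
  have yT : y \in `[0, T].
    by move: yab; rewrite !in_itv/= => /andP[? ?]; apply/andP; split; lra.
  have Sy := Su yT; have Sdz := siSZ sib d^-1 Sz1.
  have H1 : N (u y - u x) <= eta / 2.
    have := d1P y; rewrite /= distrC subr0 => /(_ yd1 yT).
    by apply: le_trans; exact: ler_norm.
  have Eyx : e y - e x = (u y - u x) - (y - x) *: (d^-1 *: z1).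
    have addK4 (x1 x2 : X) : z0 + x1 - (z0 + x2) = x1 - x2.
      by rewrite opprD addrACA subrr add0r.
    rewrite /e subrACA addK4.
    rewrite -scalerBl scalerA; congr (_ - _ *: _).
    by rewrite -mulrBl; congr (_ * _); ring.
  rewrite Eyx.
  have Syx := siSB sib Sy Sx; have Sdd := siSZ sib (y - x) Sdz.
  have := siN_triangle sib Syx (siSN sib Sdd).
  rewrite (siN_opp sib)// (siNZ sib)// -/M => H2.
  have : `|y - x| * M <= eta / 2.
    by apply: le_trans (ltW yM); rewrite ler_wpM2l// lerDl.
  lra.
have ib := in_L2_pairing_integrable sib mab Le' Le.
have ie' := in_L2_norm_integrable sib mab (lebesgue_itvoo_lty _ _) Le'.
split => //; apply: (energy_identity sib ab Se Se' cue ie' ib).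
move=> z s t Sz as_ st tb.
have sT : 0 <= s by lra. have tT : t <= T by lra.
have [iz Iz] := in_H1_pairing Sz sT st tT.
have Sdz := siSZ sib d^-1 Sz1.
have E x : x \in `]s, t[ -> b (e' x) z = b (ut x) z - b (d^-1 *: z1) z.
  move=> xst; rewrite (siBl sib)//; apply: Sut; apply: sub.
  exact: (subset_itvoo as_ tb xst).
have mst : measurable (`]s, t[ : set (measurableTypeR R)) by exact: measurable_itv.
have ic : mu.-integrable `]s, t[ (EFin \o (fun=> b (d^-1 *: z1) z)).
  exact: (cst_integrable_fin mst (lebesgue_itvoo_lty _ _)).
split.
  apply: eq_integrable (integrable_finB mst iz ic) => // x; rewrite inE => xst /=.
  by rewrite E.
rewrite (@eq_Rintegral _ _ _ mu _ (fun x => b (ut x) z - b (d^-1 *: z1) z)); last first.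
  by move=> x; rewrite inE => /E.
have mu_st : fine (mu `]s, t[) = t - s by rewrite lebesgue_measure_itv/= lte_fin st.
rewrite RintegralB// -Iz Rintegral_cst// mu_st.
have Az y : b (z0 + ((y - c) / d) *: z1) z = b z0 z + (y - c) * b (d^-1 *: z1) z.
  by rewrite (siDl sib)// ?(siZl sib)//; [ring|exact: (siSZ sib)].
have Sa y : S (z0 + ((y - c) / d) *: z1) by apply: (siSD sib) => //; exact: (siSZ sib).
have Ss : S (u s) by apply: Su; rewrite in_itv/=; apply/andP; split; lra.
have St : S (u t) by apply: Su; rewrite in_itv/=; apply/andP; split; lra.
by rewrite /e !(siBl sib)// !Az; ring.
Qed.

End H1_energy.

(** * A quadratic Gronwall inequality *)

Section gronwall.
Context (R : realType).
Notation mu := (@lebesgue_measure R).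

Lemma Rintegral_affine (A B alpha t : R) : alpha <= t ->
  mu.-integrable `]alpha, t[ (EFin \o (fun x => A + B * (x - alpha))) /\
  \int[mu]_(x in `]alpha, t[) (A + B * (x - alpha)) =
    A * (t - alpha) + B / 2 * (t - alpha) ^+ 2.
Proof.
move=> at_.
have := @quadratic_remainder_ftc _ (fun x => A * x + B / 2 * (x - alpha) ^+ 2)
  (fun x => A + B * (x - alpha)) alpha t `|B / 2| at_.
move=> [||i ->].
- move=> x; apply: cvgD; first exact: cvg_cst.
  apply: cvgM; first exact: cvg_cst.
  by apply: cvgB; [exact: cvg_id|exact: cvg_cst].
- move=> x h; rewrite -[h ^+ 2]ger0_norm ?sqr_ge0// -normrM.
  by rewrite le_eqVlt; apply/orP; left; apply/eqP; congr `|_|; field.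
- by split=> //; ring.
Qed.

(** Let g = A + B (t - alpha) and D = sup (p - g). Inserting p <= g + D into the hypothesis gives
    p^2 <= g^2 + 2 D B (t - alpha) <= (g + D)^2 - D^2. If D > 0 this keeps p below g + D by a fixed
    margin, since g is bounded, contradicting the choice of D. No division by p or A occurs, so both
    may vanish. The conclusion bounds the whole right-hand side, so that any other quantity below it
    is bounded as well. *)
Lemma quadratic_gronwall (p : R -> R) (alpha beta A B M0 : R) :
  alpha <= beta -> 0 <= A -> 0 <= B ->
  (forall t, t \in `[alpha, beta] -> 0 <= p t <= M0) ->
  mu.-integrable `]alpha, beta[ (EFin \o p) ->
  (forall t, t \in `[alpha, beta] ->
    p t ^+ 2 <= A ^+ 2 + 2 * B * \int[mu]_(x in `]alpha, t[) p x) ->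
  forall t, t \in `[alpha, beta] ->
    A ^+ 2 + 2 * B * \int[mu]_(x in `]alpha, t[) p x <= (A + B * (t - alpha)) ^+ 2.
Proof.
move=> ab A0 B0 p_bd ip p_ineq.
pose g t := A + B * (t - alpha).
have mst s t : measurable (`]s, t[ : set (measurableTypeR R)) by exact: measurable_itv.
have bound M t : t \in `[alpha, beta] ->
    (forall x, x \in `[alpha, beta] -> p x <= g x + M) ->
    A ^+ 2 + 2 * B * \int[mu]_(x in `]alpha, t[) p x <= g t ^+ 2 + 2 * M * B * (t - alpha).
  move=> tab pM; have tab2 := tab; move: tab2; rewrite in_itv/= => /andP[at_ tb].
  have [ig Ig] := Rintegral_affine (A + M) B at_.
  rewrite (_ : g t ^+ 2 + _ = A ^+ 2 + 2 * B * \int[mu]_(x in `]alpha, t[) (A + M + B * (x - alpha))); last first.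
    by rewrite Ig /g; field.
  rewrite lerD2l ler_wpM2l ?mulr_ge0//; apply: le_Rintegral => //.
    by apply: integrableS ip => //; apply: subset_itvoo.
  move=> x /=; rewrite in_itv/= => /andP[? ?].
  rewrite addrAC; apply: pM; rewrite in_itv/=; apply/andP; split; lra.
suff pg t : t \in `[alpha, beta] -> p t <= g t.
  move=> t tab; have := bound 0 t tab; rewrite mulr0 !mul0r addr0; apply.
  by move=> x xab; rewrite addr0; exact: pg.
pose D := [set p x - g x | x in [set` `[alpha, beta]]].
have g0 x : x \in `[alpha, beta] -> 0 <= g x.
  by rewrite in_itv/= => /andP[? ?]; rewrite addr_ge0// mulr_ge0//; lra.
have aab : alpha \in `[alpha, beta] by rewrite in_itv/= lexx.
have bab : beta \in `[alpha, beta] by rewrite in_itv/= lexx andbT.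
have hsD : has_sup D.
  split; first by exists (p alpha - g alpha), alpha.
  exists M0 => _ [x xab <-]; have /andP[_ ?] := p_bd x xab; have := g0 x xab; lra.
have ubD x : x \in `[alpha, beta] -> p x <= g x + sup D.
  move=> xab; rewrite addrC -lerBlDr; apply: ub_le_sup; first exact: hsD.2.
  by exists x.
have [D0 tab|D0] := leP (sup D) 0; first by have := ubD t tab; lra.
pose G := g beta; have G0 := g0 _ bab; rewrite -/G in G0.
(* This margin gives [2 * eta * (g x + sup D) <= sup D ^+ 2 / 2], so the square of
   [g x + sup D - eta] still exceeds [(g x + sup D) ^+ 2 - sup D ^+ 2]. *)
have eta0 : 0 < sup D ^+ 2 / (4 * (G + sup D)) by rewrite divr_gt0 ?exprn_gt0// mulr_gt0//; lra.
have [_ [x xab <-]] := sup_adherent eta0 hsD.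
set eta := _ / _ => px.
have etaE : 4 * eta * (G + sup D) = sup D ^+ 2.
  by rewrite /eta; field; rewrite gt_eqF//; lra.
have gx0 := g0 x xab.
have gxG : g x <= G.
  move: xab; rewrite /= in_itv/= => /andP[_ xb].
  by rewrite lerD2l ler_wpM2l// lerB.
have agx : B * (x - alpha) <= g x by rewrite lerDr.
have /andP[px0 _] := p_bd x xab.
have h1 := le_trans (p_ineq x xab) (bound _ _ xab ubD).
have h2 : 2 * sup D * B * (x - alpha) <= 2 * sup D * g x.
  by rewrite -mulrA ler_wpM2l// mulr_ge0// ltW.
have eta_lt : eta < sup D.
  have : eta * (G + sup D) < sup D * (G + sup D) by nra.
  by rewrite ltr_pM2r//; lra.
have h3 : (g x + sup D - eta) ^+ 2 <= p x ^+ 2.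
  by rewrite ler_sqr ?nnegrE//; lra.
have h4 : eta * (g x + sup D) <= eta * (G + sup D) by apply: ler_wpM2l; [exact: ltW|lra].
exfalso; nra.
Qed.

End gronwall.

(** * The spaces L^2(Omega), H^1_0(Omega) and M *)

Section L2_domain.
Context (R : realType) (n : nat) (Omega : lipschitz_domain R n).
Notation H := (L2H Omega).
Notation Hd := (L2Hd Omega).
Notation muO := (mu_dom Omega).

Lemma L2H_mul_integrable (x y : H) : muO.-integrable setT (EFin \o (fun t => x t * y t)).
Proof. by apply/Lfun1_integrable; apply: Lfun2_mul_Lfun1; exact: LfunP. Qed.

Lemma semi_inner_ip : semi_inner setT (fun x y : H => ip Omega x y) (@normH _ _ Omega).
Proof.
split=> //.
- by move=> x y _ _; apply: eq_Rintegral => t _; rewrite mulrC.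
- move=> a x y z _ _ _; rewrite /ip.
  rewrite (@eq_Rintegral _ _ _ muO _ (fun t => a * (x t * z t) + y t * z t)); last first.
    by move=> t _; rewrite mulrA -mulrDl.
  rewrite RintegralD//; [rewrite RintegralZl//| |exact: L2H_mul_integrable].
    exact: L2H_mul_integrable.
  by apply: integrable_finZ => //; exact: L2H_mul_integrable.
- by move=> x _; apply: Rintegral_ge0 => t _; rewrite -expr2 sqr_ge0.
Qed.

(** Taken on all pairs, where it sees only the second component, so that differences of elements of
    V need no membership proof. *)
Lemma semi_inner_ipd : semi_inner setT
  (fun p q : (H * Hd)%type => ipd p.2 q.2) (@normV _ _ Omega).
Proof.
have sib := semi_inner_ip; split=> //.
- by move=> x y _ _; apply: eq_bigr => i _; exact: (si_sym sib).
- move=> a x y z _ _ _; rewrite /ipd big_distrr -big_split; apply: eq_bigr => i _ /=.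
  by rewrite -(si_lin sib)// !ffunE.
- by move=> x _; apply: sumr_ge0 => i _; exact: (si_ge0 sib).
Qed.

Lemma ip_eqH (x y z : H) : eqH x y -> ip Omega x z = ip Omega y z.
Proof.
move=> xy; congr fine; apply: ae_eq_integral => //.
- by apply/measurable_EFinP; exact: measurable_funM.
- by apply/measurable_EFinP; exact: measurable_funM.
- by apply: filterS xy => t h tT /=; rewrite h.
Qed.

Lemma ae_mu_dom : {ae muO, forall t, dom Omega t}.
Proof.
exists (~` (dom Omega : set (borelRn R n.+1))); split.
- by apply: measurableC; apply: open_borelRn; exact: dom_open.
- rewrite -[LHS]/(lebesgue_Rn R n.+1 (~` (dom Omega : set (borelRn R n.+1)) `&` dom Omega)).
  by rewrite setICl measure0.
- by move=> t.
Qed.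

Lemma bounded_dom : exists2 M : R, 0 < M &
  forall x, dom Omega x -> forall i, `|x ord0 i| < M.
Proof.
have [M [Mreal MO]] := dom_bounded Omega.
exists (`|M| + 2) => [|x Ox i]; first by rewrite ltr_wpDl.
apply: (@le_lt_trans _ _ (`|M| + 1)); last by rewrite ltrD2l ltr1n.
apply: le_trans (MO (`|M| + 1) _ x Ox); last first.
  by rewrite (le_lt_trans (ler_norm _))// ltrDl.
have /mapP[j Hj ->] : `|x ord0 i| \in [seq `|x y.1 y.2| | y : 'I_1 * 'I_n.+1].
  by apply/mapP; exists (ord0, i) => //=; rewrite mem_enum.
by rewrite [leRHS]/Num.norm /= mx_normrE; apply/bigmax_geP; right => /=; exists j.
Qed.

Lemma mu_dom_lty : (muO setT < +oo)%E.
Proof.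
have [M M0 MO] := bounded_dom.
pose B := [set x : borelRn R n.+1 | forall i, (x : 'rV[R]_n.+1) ord0 i \in
  `](const_mx (- M) : 'rV[R]_n.+1) ord0 i, (const_mx M : 'rV[R]_n.+1) ord0 i] ].
have mB : measurable B.
  rewrite (_ : B = \bigcap_(i in [set: 'I_n.+1])
    ((fun x : borelRn R n.+1 => (x : 'rV[R]_n.+1) ord0 i) @^-1` `]- M, M])); last first.
    by apply/seteqP; split => x /= h i => [_|]; have := h i; rewrite !mxE//; apply.
  apply: fin_bigcap_measurable => // i _.
  rewrite set_itvoc; rewrite [X in measurable X](_ : _ =
    ((fun x : 'rV[R]_n.+1 => x ord0 i) @^-1` [set y | - M < y]) `\`
    ((fun x : 'rV[R]_n.+1 => x ord0 i) @^-1` [set y | M < y])); last first.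
    apply/seteqP; split => x /=; first by move=> /andP[-> ?]; split=> //; apply/negP; rewrite -leNgt.
    by move=> [-> /negP]; rewrite -leNgt => ->.
  have co := @coord_continuous R 1 n.+1 ord0 i.
  by apply: measurableD; apply: open_borelRn; apply: open_comp => //; exact: open_gt.
have := @lebesgue_Rn_box R n.+1 (const_mx (- M)) (const_mx M).
move=> /(_ _)/wrap[|BE]; first by move=> i; rewrite !mxE; lra.
apply: (@le_lt_trans _ _ (lebesgue_Rn R n.+1 B)); last by rewrite BE ltry.
rewrite -[leLHS]/(lebesgue_Rn R n.+1 (setT `&` dom Omega)) setTI; apply: le_measure; rewrite ?inE//.
  by apply: open_borelRn; exact: dom_open.
by move=> x Ox i; rewrite !mxE in_itv/=; have := MO x Ox i; rewrite ltr_norml => /andP[-> /ltW ->].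
Qed.

Lemma bounded_on_dom (f : 'rV[R]_n.+1 -> R) : continuous f ->
  exists M, forall x, dom Omega x -> `|f x| <= M.
Proof.
move=> cf; have [M M0 MO] := bounded_dom.
pose K := [set v : 'rV[R]_n.+1 | forall i, v ord0 i \in `[(- M), M]].
have cK : compact K.
  by apply: (@rV_compact _ _ (fun=> `[(- M), M]%classic)) => _; exact: segment_compact.
have : compact (f @` K).
  by apply: continuous_compact => //; exact: continuous_subspaceT.
move=> /compact_bounded[A [Areal AP]]; exists (A + 1) => x Ox.
apply: (AP (A + 1)); first by rewrite ltrDl.
exists x => // i; rewrite in_itv/=; have := MO x Ox i.
by rewrite ltr_norml => /andP[/ltW -> /ltW ->].
Qed.

(** Test functions and their partial derivatives come as plain functions; as elements of H they
    become subject to the Cauchy-Schwarz inequality. *)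
Lemma continuous_L2H (f : 'rV[R]_n.+1 -> R) : continuous f ->
  exists x : H, (x : borelRn R n.+1 -> R) = f.
Proof.
move=> cf; have [M fM] := bounded_on_dom cf.
have mf : measurable_fun setT (f : borelRn R n.+1 -> R).
  apply: (measurability _ (RGenOpens.measurableE R)) => _ [A [a [b ->]] <-].
  rewrite setTI; apply: open_borelRn; apply: open_comp; first by move=> x _; exact: cf.
  exact: interval_open.
have fL : (f : borelRn R n.+1 -> R) \in Lfun muO 2%:E.
  rewrite inE; apply/andP; split; rewrite inE//= /finite_norm unlock.
  apply: poweR_lty; apply: (@le_lt_trans _ _ (\int[muO]_x (`|M| `^ 2)%:E)%E); last first.
    by rewrite integral_cst//= lte_mul_pinfty ?lee_fin ?powR_ge0//; exact: mu_dom_lty.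
  apply: ae_ge0_le_integral => //.
  - by move=> t _; rewrite poweR_ge0.
  - apply: (measurableT_comp (measurable_poweR _)).
    by apply: measurableT_comp => //; exact/measurable_EFinP.
  - apply: (@filterS _ _ (ae_filter_ringOfSetsType muO) _ _ _ ae_mu_dom) => t Ot _; rewrite /= lee_fin.
    by rewrite ge0_ler_powR ?nnegrE// (le_trans (fM t Ot))// ler_norm.
by exists (Lfun_Sub (lee1n 2) fL).
Qed.

(** The distributional identity is continuous in the test function for the H^1 norm, hence passes to
    the closure. *)
Lemma laplacian_H10 (u0 phi : H * Hd) (h : H) : is_laplacian u0 h -> H10 phi ->
  ip Omega h phi.1 = - ipd u0.2 phi.2.
Proof.
move=> lap [_ [psi [tpsi c1 c2]]]; have sib := semi_inner_ip.
have dpsi k i : continuous (partial i (psi k)).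
  by have [/(_ 1%N)[_ /(_ i)[_ [+ _]]] _ _] := tpsi k.
have cpsi k : continuous (psi k) by have [/(_ 0%N)[+ _] _ _] := tpsi k.
have [X XE] := choice (fun k => continuous_L2H (cpsi k)).
have [Y YE] := choice (fun ki : nat * 'I_n.+1 => continuous_L2H (dpsi ki.1 ki.2)).
apply: (@cvg_unique _ (@Rhausdorff R) (ip Omega h (psi k) @[k --> \oo])).
  apply: (cvg_dist_squeeze (h := fun k => normH h * L2norm Omega (psi k \- phi.1))).
    near=> k; rewrite -XE -[L2norm _ _]/(normH (X k - phi.1)).
    by rewrite -(siBr sib)//; exact: (si_cauchy_abs sib).
  by rewrite -[X in _ --> X](mulr0 (normH h)); apply: cvgM => //; exact: cvg_cst.
rewrite (_ : (fun k => _) = fun k => - \sum_(i < n.+1) ip Omega (u0.2 i) (partial i (psi k))); last first.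
  by apply/funext => k; exact: lap.
apply: cvgN; rewrite /ipd.
apply: cvg_big => [|i _]; first exact: add_continuous.
apply: (cvg_dist_squeeze (h := fun k => normH (u0.2 i) * L2norm Omega (partial i (psi k) \- phi.2 i))).
  near=> k; rewrite -(YE (k, i)) -[L2norm _ _]/(normH (Y (k, i) - phi.2 i)).
  by rewrite -(siBr sib)//; exact: (si_cauchy_abs sib).
by rewrite -[X in _ --> X](mulr0 (normH (u0.2 i))); apply: cvgM => //; exact: cvg_cst.
Unshelve. all: end_near. Qed.

End L2_domain.

Section memory_space.
Context (R : realType) (n : nat) (Omega : lipschitz_domain R n).
Notation H := (L2H Omega).
Context (dR : measure_display) (Rr : measurableType dR).
Context (mu : {finite_measure set Rr -> \bar R}) (c : Rr -> R).
Hypotheses (c_gt0 : forall r, 0 < c r) (mc : measurable_fun setT c).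
Hypothesis c_lty : (\int[mu]_r (c r)%:E < +oo)%E.

Notation NH := (@normH R n Omega).
Notation SM := (@spaceM R n Omega _ _ mu c).

Let sib := semi_inner_ip Omega.

Let mu_lty : (mu setT < +oo)%E.
Proof. by rewrite -ge0_fin_numE// fin_num_measure. Qed.

Lemma spaceM_sqr_integrable (z : Rr -> H) : SM z ->
  mu.-integrable setT (EFin \o (fun r => c r * NH (z r) ^+ 2)).
Proof.
move=> [mz zoo]; apply/integrableP; split.
  apply/measurable_EFinP; apply: measurable_funM => //; apply: measurable_funX.
  exact: (measurable_strong_norm sib mz).
apply: le_lt_trans zoo; rewrite le_eqVlt; apply/orP; left; apply/eqP.
by apply: eq_integral => r _ /=; rewrite ger0_norm// mulr_ge0 ?sqr_ge0// ltW.
Qed.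

Lemma spaceM_ip_integrable (z1 z2 : Rr -> H) : SM z1 -> SM z2 ->
  mu.-integrable setT (EFin \o (fun r => c r * ip Omega (z1 r) (z2 r))).
Proof.
move=> Sz1 Sz2.
apply: (dominated_integrable_fin measurableT _ _ (integrable_finD measurableT
  (spaceM_sqr_integrable Sz1) (spaceM_sqr_integrable Sz2))).
  apply: measurable_funM => //.
  by apply: (measurable_strong2 sib); [case: Sz1|case: Sz2].
move=> r _; rewrite normrM (gtr0_norm (c_gt0 r)) -mulrDr; apply: ler_wpM2l; first exact: ltW.
apply: (le_trans (si_cauchy_abs sib I I)).
have := siN_ge0 sib (x := z1 r) I; have := siN_ge0 sib (x := z2 r) I; nra.
Qed.

(** Finiteness of the total weight embeds H into M as constant functions; this is what makes the
    slack u - w an element of M. *)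
Lemma spaceM_cst (x : H) : SM (fun=> x).
Proof.
split; first exact: (strongly_measurable_cst sib).
rewrite (_ : (fun _ => _) = (fun r => (NH x ^+ 2)%:E * (c r)%:E)%E); last first.
  by apply/funext => r; rewrite mulrC EFinM.
rewrite ge0_integralZl ?lee_fin ?sqr_ge0//.
- by rewrite lte_mul_pinfty ?lee_fin ?sqr_ge0.
- exact/measurable_EFinP.
- by move=> r _; rewrite lee_fin ltW.
Qed.

Lemma semi_inner_ipM : semi_inner SM (ipM mu c) (normM mu c).
Proof.
have int := spaceM_ip_integrable; split; last by move=> z _; reflexivity.
- exact: (spaceM_cst 0).
- move=> a x y Sx Sy; have [mx _] := Sx; have [my _] := Sy.
  have mxy := strongly_measurable_lin sib a mx my.
  split => //.
  have : mu.-integrable setT (EFin \o (fun r => c r * NH (a *: x r + y r) ^+ 2)).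
    apply: (dominated_integrable_fin measurableT _ _
      (integrable_finD measurableT (integrable_finZ (2 * a ^+ 2) measurableT
        (spaceM_sqr_integrable Sx)) (integrable_finZ 2 measurableT (spaceM_sqr_integrable Sy)))).
      apply: measurable_funM => //; apply: measurable_funX.
      exact: (measurable_strong_norm sib).
    move=> r _; rewrite ger0_norm; last by rewrite mulr_ge0 ?sqr_ge0// ltW.
    have := siN_triangle sib (x := a *: x r) (y := y r) I I; rewrite (siNZ sib)// => h.
    have h1 : NH (a *: x r + y r) ^+ 2 <= 2 * a ^+ 2 * NH (x r) ^+ 2 + 2 * NH (y r) ^+ 2.
      have := siN_ge0 sib (x := a *: x r + y r) I => N0.
      apply: (@le_trans _ _ ((`|a| * NH (x r) + NH (y r)) ^+ 2)).
        by rewrite ler_sqr ?nnegrE// (le_trans N0).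
      rewrite -(real_normK (num_real a)).
      have := sqr_ge0 (`|a| * NH (x r) - NH (y r)); nra.
    have := c_gt0 r; nra.
  case/integrableP => _; apply: le_lt_trans; rewrite le_eqVlt; apply/orP; left; apply/eqP.
  by apply: eq_integral => r _ /=; rewrite ger0_norm// mulr_ge0 ?sqr_ge0// ltW.
- by move=> x y _ _; apply: eq_Rintegral => r _; rewrite (si_sym sib).
- move=> a x y z Sx Sy Sz; rewrite /ipM.
  rewrite (@eq_Rintegral _ _ _ mu _
    (fun r => a * (c r * ip Omega (x r) (z r)) + c r * ip Omega (y r) (z r))); last first.
    by move=> r _; rewrite [ip _ (_ + _) _](si_lin sib)//; ring.
  rewrite RintegralD//; [rewrite RintegralZl//; exact: int| |exact: int].
  apply: integrable_finZ => //; exact: int.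
- move=> x Sx; apply: Rintegral_ge0 => r _.
  by apply: mulr_ge0; [exact: ltW|exact: (si_ge0 sib)].
Qed.

(** G is the adjoint of the embedding by constants. The coupling term thus becomes a product in M
    and merges with the kappa term into the energy product. *)
Lemma is_G_pairing (z : Rr -> H) (g phi : H) : is_G mu c z g ->
  ip Omega g phi = ipM mu c z (fun=> phi).
Proof.
move=> Gz; have [_ ->] := bochner_pairing sib measurableT mu_lty Gz (x := phi) I.
by apply: eq_Rintegral => r _; rewrite (siZl sib).
Qed.

Lemma ipM_le0 (z1 z2 : Rr -> H) : SM z1 -> SM z2 ->
  {ae mu, forall r, ip Omega (z1 r) (z2 r) <= 0} -> ipM mu c z1 z2 <= 0.
Proof.
move=> Sz1 Sz2 h; rewrite -(mul0r (fine (mu setT))) -Rintegral_cst//.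
apply: ae_le_Rintegral => //.
- exact: spaceM_ip_integrable.
- exact: (cst_integrable_fin measurableT mu_lty).
- apply: filterS h => r h _; rewrite -oppr_ge0 -mulrN; apply: mulr_ge0.
    exact: ltW.
  by rewrite oppr_ge0.
Qed.

Lemma eqM_normM (z1 z2 : Rr -> H) : SM z1 -> SM z2 -> eqM mu z1 z2 ->
  normM mu c (z1 - z2) = 0.
Proof.
move=> Sz1 Sz2 h; have sM := semi_inner_ipM; have Sz := siSB sM Sz1 Sz2.
rewrite (si_norm sM)//.
suff -> : ipM mu c (z1 - z2) (z1 - z2) = 0 by rewrite sqrtr0.
apply/eqP; rewrite eq_le (si_ge0 sM)// andbT; apply: ipM_le0 => //.
apply: filterS h => r h.
rewrite (siBl sib)//; rewrite (ip_eqH _ h) subrr//.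
Qed.

End memory_space.

Section pair_lmodule.
Context (R : realType) (X Y : lmodType R).
Implicit Types x y : (X * Y)%type.

Lemma fst_lin (a : R) x y : (a *: x + y).1 = a *: x.1 + y.1. Proof. by []. Qed.
Lemma snd_lin (a : R) x y : (a *: x + y).2 = a *: x.2 + y.2. Proof. by []. Qed.
End pair_lmodule.

Lemma pair_eq (X Y : Type) (x y : X * Y) : x.1 = y.1 -> x.2 = y.2 -> x = y.
Proof. by case: x y => [? ?] [? ?] /= -> ->. Qed.

Lemma semi_inner_prod (R : realType) (X1 X2 : lmodType R) (S1 : set X1) (S2 : set X2)
    (b1 : X1 -> X1 -> R) (b2 : X2 -> X2 -> R) (N1 : X1 -> R) (N2 : X2 -> R) (k : R) :
  0 <= k -> semi_inner S1 b1 N1 -> semi_inner S2 b2 N2 ->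
  semi_inner [set p : X1 * X2 | S1 p.1 /\ S2 p.2]
    (fun p q => k * b1 p.1 q.1 + b2 p.2 q.2)
    (fun p => Num.sqrt (k * b1 p.1 p.1 + b2 p.2 p.2)).
Proof.
move=> k0 s1 s2; split; last by move=> p _; reflexivity.
- by split; [exact: si_0 s1|exact: si_0 s2].
- by move=> a x y [? ?] [? ?]; split; [exact: (si_S s1)|exact: (si_S s2)].
- by move=> x y [? ?] [? ?]; rewrite (si_sym s1)// (si_sym s2).
- move=> a x y z [? ?] [? ?] [? ?].
  by rewrite [b1 _ _](si_lin s1)// [b2 _ _](si_lin s2)//; ring.
- by move=> x [? ?]; rewrite addr_ge0 ?mulr_ge0 ?(si_ge0 s1) ?(si_ge0 s2).
Qed.

Lemma small_multiple_le0 (R : realType) (A B : R) : 0 <= B ->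
  (forall e, 0 < e -> e <= 1 -> 2 * A <= e * B) -> A <= 0.
Proof.
move=> B0 H; rewrite leNgt; apply/negP => A0.
have B1 : 0 < B + 1 by lra.
have [AB|AB] := leP (A / (B + 1)) 1.
  have := H _ (divr_gt0 A0 B1) AB.
  have : A / (B + 1) * B <= A by rewrite mulrAC ler_pdivrMr// ler_pM2l//; lra.
  lra.
have := H _ ltr01 (lexx 1); move: AB; rewrite ltr_pdivlMr//; lra.
Qed.

(** * Projections and normal cones in H *)

Section cones.
Context (R : realType) (n : nat) (Omega : lipschitz_domain R n).
Notation H := (L2H Omega).
Implicit Types (C : set H) (x y p xi : H).

Let sib := semi_inner_ip Omega.

Lemma closedH_eqH C x y : closedH C -> C x -> normH (y - x) = 0 -> C y.
Proof.
move=> cC Cx yx; apply: contrapT => Cy.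
have [e e0 H] := cC y Cy.
by apply: (H x); rewrite // (siN_subC sib)// yx.
Qed.

Lemma eqH_normH x y : eqH x y -> normH (x - y) = 0.
Proof.
move=> xy; rewrite (si_norm sib)// (siBl sib)// (ip_eqH (x - y) xy).
by rewrite subrr sqrtr0.
Qed.

(** Minimality of the distance along the segment from p to y, divided by the segment parameter e,
    reads 2 (x - p, y - p) <= e |y - p|^2; then e tends to 0. *)
Lemma is_projection_normal_cone C x p : convexH C -> is_projection C x p ->
  normal_cone C p (x - p).
Proof.
move=> convC [Cp pmin]; split; first exact: Cp.
move=> y Cy; have Nyp := si_ge0 sib (x := y - p) I.
have main e : 0 < e -> e <= 1 -> 2 * ip Omega (x - p) (y - p) <= e * ip Omega (y - p) (y - p).
  move=> e0 e1.
  have Cq : C (e *: y + (1 - e) *: p) by apply: convC => //; rewrite (ltW e0).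
  have := pmin _ Cq.
  rewrite (_ : x - (e *: y + _) = (x - p) - e *: (y - p)); last first.
    by rewrite scalerBl scale1r scalerBr addrCA opprD addrA.
  have N1 := siN_ge0 sib (x := x - p) I.
  have N2 := siN_ge0 sib (x := x - p - e *: (y - p)) I.
  rewrite -(ler_sqr N1 N2) (siN_sqr sib I) (siN_sqr sib I).
  rewrite (si_sqB sib (x := x - p) (y := e *: (y - p)) I I).
  rewrite !(siZl sib _ I I) !(siZr sib _ I I) => h'.
  have : 0 <= e * (e * ip Omega (y - p) (y - p) - 2 * ip Omega (x - p) (y - p)).
    move: h'; move: (ip _ (x - p) (y - p)) (ip _ (y - p) (y - p)) (ip _ (x - p) (x - p)).
    by clear=> A B D; lra.
  rewrite (pmulr_rge0 _ e0) subr_ge0; exact: id.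
exact: (small_multiple_le0 Nyp main).
Qed.

(** The scheme determines the memory variable only up to a.e. equality, so the cone at the
    projection has to be moved to an equivalent point and direction. *)
Lemma normal_cone_eqH C x y xi xi' : closedH C -> normal_cone C x xi ->
  normH (y - x) = 0 -> normH (xi' - xi) = 0 -> normal_cone C y xi'.
Proof.
move=> cC [Cx h] yx xixi; split; first exact: closedH_eqH yx.
move=> z Cz; have := h z Cz.
have E1 : ip Omega (xi' - xi) (z - y) = 0 by exact: (si_null_l sib).
have E2 : ip Omega (y - x) xi = 0 by exact: (si_null_l sib).
move: E1 E2; rewrite !(siBl sib)// !(siBr sib)// (si_sym sib (x := y))// (si_sym sib (x := x))//.
lra.
Qed.

Lemma normal_coneZ C x xi (e : R) : 0 <= e -> normal_cone C x xi -> normal_cone C x (e *: xi).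
Proof.
move=> e0 [Cx h]; split=> // y Cy; rewrite (siZl sib)//.
by rewrite -oppr_ge0 -mulrN mulr_ge0// oppr_ge0 h.
Qed.

End cones.

(** * Partitions of the time interval *)

Section variation.
Context (R : realType) (X : lmodType R) (b : X -> X -> R) (N : X -> R).
Hypothesis sib : semi_inner setT b N.
Context (T : R) (f : R -> X).
Hypothesis fBV : has_ubound (variations_along N 0 T f).

Notation Var := (total_variation_on N 0 T f).

Lemma sum_increments_le (s : nat -> R) (m : nat) : s 0%N = 0 -> s m = T ->
  (forall k, (k < m)%N -> s k < s k.+1) ->
  \sum_(k < m) N (f (s k.+1) - f (s k)) <= Var.
Proof.
move=> s0 sm sinc.
pose l := mkseq (fun k => s k.+1) m.
have sl : size l = m by rewrite size_mkseq.
have nthl k : (k <= m)%N -> nth T (0 :: l) k = s k.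
  by case: k => [|k] km; rewrite /= ?s0// nth_mkseq.
apply: ub_le_sup => //; exists l.
  split; last by apply/eqP; rewrite (last_nth T) sl nthl// sm.
  apply/(pathP T) => k; rewrite sl => km.
  by rewrite nthl ?(ltnW km)// nth_mkseq// sinc.
rewrite /variation_along sl big_mkord; apply: eq_bigr => k _.
by rewrite !nthl// ltnW.
Qed.

Context (n : nat) (t : nat -> R).
Hypothesis ht : time_partition T n t.

(** A single interior point per step is enough: it controls both the increment over the step and the
    distance from an inner value to the right end. Together with the nodes such points form a
    partition, so the suprema still add up to at most the total variation. *)
Definition step_variations (k : nat) : set R :=
  [set N (f s - f (t k)) + N (f (t k.+1) - f s) | s in [set` `]t k, t k.+1[] ].

Definition step_variation (k : nat) : R := sup (step_variations k).

Let t_step k : (k < n)%N -> t k < t k.+1.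
Proof. by case: ht => _ _; exact. Qed.

(** Nodes sit at even indices, the chosen interior points at odd ones. *)
Let interleave (sg : nat -> R) (k : nat) : R := if odd k then sg k./2 else t k./2.

Let sum_interleave (sg : nat -> R) : (forall k, (k < n)%N -> t k < sg k < t k.+1) ->
  \sum_(k < n) (N (f (sg k) - f (t k)) + N (f (t k.+1) - f (sg k))) <= Var.
Proof.
move=> sgt; have [t0 tn _] := ht.
have even k : interleave sg k.*2 = t k by rewrite /interleave odd_double doubleK.
have odds k : interleave sg k.*2.+1 = sg k.
  by rewrite /interleave /= odd_double /= uphalf_double.
have := @sum_increments_le (interleave sg) n.*2.
rewrite even -[0%N]/(0.*2)%N even => /(_ t0 tn).
have sumE m : \sum_(k < m.*2) N (f (interleave sg k.+1) - f (interleave sg k)) =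
  \sum_(k < m) (N (f (sg k) - f (t k)) + N (f (t k.+1) - f (sg k))).
  elim: m => [|m ih]; first by rewrite !big_ord0.
  by rewrite doubleS !big_ord_recr /= ih -addrA -[m.*2.+2]doubleS !even !odds.
rewrite sumE; apply => k; rewrite -(odd_double_half k).
move: (odd k) (k./2) => [] j /=; rewrite ?add1n ?add0n => kn.
  rewrite -doubleS even odds; have /sgt/andP[_] // : (j < n)%N.
  by rewrite -ltn_double; exact: ltn_trans kn.
by rewrite even odds; move: kn; rewrite ltn_double => /sgt/andP[].
Qed.

Let step_variations_ub k (s : R) : (k < n)%N -> t k < s < t k.+1 ->
  N (f s - f (t k)) + N (f (t k.+1) - f s) <= Var.
Proof.
move=> kn st.
(* Midpoints fill the other steps; their contributions are nonnegative and are dropped. *)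
pose sg j := if j == k then s else (t j + t j.+1) / 2.
have /sum_interleave : forall j, (j < n)%N -> t j < sg j < t j.+1.
  move=> j jn; rewrite /sg; case: eqP => [->//|_].
  have := t_step jn => h; apply/andP; split; lra.
apply: le_trans; rewrite (bigD1 (Ordinal kn))//= /sg eqxx lerDl.
by apply: sumr_ge0 => j _; rewrite addr_ge0// (siN_ge0 sib).
Qed.

Lemma step_variation_ge k s : (k < n)%N -> t k < s < t k.+1 ->
  N (f s - f (t k)) + N (f (t k.+1) - f s) <= step_variation k.
Proof.
move=> kn st; apply: ub_le_sup; last by exists s => //=; rewrite in_itv.
by exists Var => _ [s' /=+ <-]; rewrite in_itv/= => s't; exact: step_variations_ub.
Qed.

Lemma step_variation_increment k : (k < n)%N ->
  N (f (t k.+1) - f (t k)) <= step_variation k.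
Proof.
move=> kn; have tk := t_step kn.
have /(step_variation_ge kn) : t k < (t k + t k.+1) / 2 < t k.+1.
  by apply/andP; split; lra.
by apply: le_trans; rewrite (addrC (N _)); exact: (siN_triangleB sib).
Qed.

Lemma sum_step_variation : \sum_(k < n) step_variation k <= Var.
Proof.
apply/ler_addgt0Pr => e e0.
(* The tolerance of one step; [n.+1] avoids division by zero, and the n tolerances sum to at most
   [e]. *)
have en : 0 < e / n.+1%:R by rewrite divr_gt0.
have ex (k : nat) : exists s : R, (k < n)%N ->
    t k < s < t k.+1 /\ step_variation k - e / n.+1%:R <= N (f s - f (t k)) + N (f (t k.+1) - f s).
  have [kn|kn] := boolP (k < n)%N; last by exists 0.
  have tk := t_step kn.
  have hs : has_sup (step_variations k).
    split.
      eexists; exists ((t k + t k.+1) / 2) => //=.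
      by rewrite in_itv/=; apply/andP; split; lra.
    by exists Var => _ [s' /=+ <-]; rewrite in_itv/= => s't; exact: step_variations_ub.
  have [_ [s + <-] h] := sup_adherent en hs.
  by rewrite /= in_itv/= => st; exists s => _; split=> //; exact: ltW.
have [sg sgP] := choice ex.
have /sum_interleave : forall k, (k < n)%N -> t k < sg k < t k.+1 by move=> k /sgP[].
rewrite -(lerD2r e); apply: le_trans.
apply: (@le_trans _ _ (\sum_(k < n) (N (f (sg k) - f (t k)) + N (f (t k.+1) - f (sg k)) + e / n.+1%:R))).
  by apply: ler_sum => k _; rewrite -lerBlDr; case: (sgP k (ltn_ord k)).
rewrite big_split lerD2l sumr_const card_ord -[_ *+ n]mulr_natl mulrCA ler_piMr ?(ltW e0)//.
by rewrite ler_pdivrMr// mul1r ler_nat.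
Qed.

End variation.

Section time_partitions.
Context (R : realType) (T : R) (n : nat) (t : nat -> R).
Hypothesis ht : time_partition T n t.
Notation leb := (@lebesgue_measure R).

Lemma time_partition_mono i k : (i <= k)%N -> (k <= n)%N -> t i <= t k.
Proof.
move=> ik kn; have [_ _ tS] := ht; elim: k ik kn => [|k ih].
  by rewrite leqn0 => /eqP ->.
rewrite leq_eqVlt => /predU1P[-> //|ik] kn.
exact: le_trans (ih ik (ltnW kn)) (ltW (tS k kn)).
Qed.

Lemma interval_index_step k s : (k < n)%N -> t k < s <= t k.+1 ->
  interval_index n t s = k.
Proof.
move=> kn /andP[ks sk]; rewrite /interval_index.
case: findP => [/hasPn/(_ k)|i].
  by rewrite mem_iota kn sk => /(_ isT).
rewrite size_iota => ilt /(_ 0%N); rewrite nth_iota// add0n => si before.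
apply/eqP; rewrite eqn_leq; apply/andP; split; rewrite leqNgt; apply/negP => lt.
  by have := before 0%N k lt; rewrite nth_iota ?(ltn_trans lt)// sk.
have := time_partition_mono lt (ltnW kn); lra.
Qed.

(** The interval is closed on the left to include s = 0, whose index is 0; T > 0 guarantees at least
    one step. *)
Lemma interval_index_spec s : 0 < T -> 0 <= s <= T ->
  (interval_index n t s < n)%N /\
  s \in `[t (interval_index n t s), t (interval_index n t s).+1].
Proof.
move=> T0 /andP[s0 sT]; have [t0 tn _] := ht.
have n0 : (0 < n)%N by case: (n) tn t0 => // -> E; move: T0; rewrite E ltxx.
rewrite /interval_index; case: findP => [/hasPn/(_ n.-1)|i].
  by rewrite mem_iota prednK// leqnn tn sT => /(_ isT).
rewrite size_iota => ilt /(_ 0%N); rewrite nth_iota// add0n => si before.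
split=> //; rewrite in_itv/= si andbT; case: i ilt si before => [|i] ilt si.
  by rewrite t0.
move=> /(_ 0%N i (leqnn _)); rewrite nth_iota ?(ltn_trans _ ilt)// add0n.
by move=> /negbT; rewrite -ltNge => /ltW.
Qed.

Lemma ge0_integral_partition (g : R -> R) : (forall x, 0 <= g x) ->
  (forall k, (k < n)%N -> measurable_fun `]t k, t k.+1[ g) ->
  (\int[leb]_(x in `]0%R, T[) (g x)%:E =
    \sum_(k < n) \int[leb]_(x in `]t k, t k.+1[) (g x)%:E)%E.
Proof.
move=> g0 mg; have [t0 tn tS] := ht.
have co a b : measurable_fun (`]a, b[ : set R) g ->
    measurable_fun (`[a, b[ : set R) g /\
    (\int[leb]_(x in `]a, b[) (g x)%:E = \int[leb]_(x in `[a, b[) (g x)%:E)%E.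
  move=> m; split; first exact/measurable_fun_itv_obnd_cbndP.
  by apply: integral_itv_obnd_cbnd; exact/measurable_EFinP.
(* Half-open steps tile [[0, t k[] exactly and differ from the open ones by a null set. *)
have main k : (k <= n)%N -> measurable_fun (`[0, t k[ : set R) g /\
    (\int[leb]_(x in `[0%R, t k[) (g x)%:E =
    \sum_(i < k) \int[leb]_(x in `]t i, t i.+1[) (g x)%:E)%E.
  elim: k => [_|k ih kn].
    by rewrite t0 set_itvco0 integral_set0 big_ord0; split=> //; exact: measurable_fun_set0.
  have [m0 E0] := ih (ltnW kn); have [m1 E1] := co _ _ (mg k kn).
  have tk0 : 0 <= t k by rewrite -t0; exact: time_partition_mono (ltnW kn).
  have E : `[0, t k.+1[%classic = `[0, t k[%classic `|` `[t k, t k.+1[%classic.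
    by apply: itv_bndbnd_setU; rewrite bnd_simp// ltW// tS.
  have mE : measurable_fun (`[0, t k.+1[ : set R) g.
    by rewrite E; apply/measurable_funU.
  split=> //; rewrite E ge0_integral_setU//.
  - by rewrite E0 big_ord_recr/= E1.
  - by rewrite -E; exact/measurable_EFinP.
  - by move=> x _; rewrite lee_fin.
  - apply/disj_setPS => x []/=; rewrite !in_itv/= => /andP[_ h] /andP[h' _].
    by move: h; rewrite ltNge h'.
have [m <-] := main n (leqnn n); rewrite tn -integral_itv_obnd_cbnd//.
apply/measurable_EFinP; rewrite tn in m; exact/measurable_fun_itv_obnd_cbndP.
Qed.

End time_partitions.

(** * The error estimate for an abstract scheme *)

(* Each summand is at most half of the decrease of [(d k + r k)^2], where [r k]
   is the sum of the remaining [b i]. *)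
Lemma sum_dissipation_le (R : realType) (b d : nat -> R) (n : nat) (r : R) :
  (forall k, (k < n)%N -> 0 <= b k) -> (forall k, 0 <= d k) -> 0 <= r ->
  (forall k, (k < n)%N -> 0 <= d k.+1 * (b k + d k - d k.+1)) ->
  \sum_(k < n) d k.+1 * (b k + d k - d k.+1) <=
    ((d 0%N + \sum_(k < n) b k + r) ^+ 2 - (d n + r) ^+ 2) / 2.
Proof.
elim: n r => [|n ih] r b0 d0 r0 be0.
  by rewrite !big_ord0 addr0 subrr mul0r.
rewrite !big_ord_recr /=.
have bn := b0 n (leqnn _); have dn := d0 n; have dn1 := d0 n.+1; have ben := be0 n (leqnn _).
have := ih (b n + r) (fun k kn => b0 k (ltnW kn)) d0 (addr_ge0 bn r0)
  (fun k kn => be0 k (ltnW kn)).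
have pq : d n.+1 <= b n + d n.
  have [d1|d1] := eqVneq (d n.+1) 0; first by rewrite d1 addr_ge0.
  have dpos : 0 < d n.+1 by rewrite lt_neqAle eq_sym d1.
  by move: ben; rewrite pmulr_rge0// subr_ge0.
have : d n.+1 * (b n + d n - d n.+1) <= ((d n + (b n + r)) ^+ 2 - (d n.+1 + r) ^+ 2) / 2.
  move: (b n + d n) (d n.+1) pq dn1 (addrC (b n) (d n)) => p q pq q0 pE.
  rewrite (addrA (d n)) -pE; nra.
rewrite (addrA (d 0%N) _ (b n)) -(addrA _ (b n) r); lra.
Qed.

(** After squaring, only the cross terms differ, and sqrt P <= sqrt (P + e). This lets the induction
    over the steps keep the form sqrt P + Q: dissipation collects under the root, forcing
    outside. *)
Lemma sqrt_add_sqr_le (R : realType) (P Q e : R) : 0 <= P -> 0 <= Q -> 0 <= e ->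
  Num.sqrt ((Num.sqrt P + Q) ^+ 2 + e) <= Num.sqrt (P + e) + Q.
Proof.
move=> P0 Q0 e0; have Pe : 0 <= P + e by rewrite addr_ge0.
rewrite -ler_sqr ?nnegrE ?addr_ge0 ?sqrtr_ge0// sqr_sqrtr ?addr_ge0 ?sqr_ge0//.
rewrite !sqrrD !sqr_sqrtr//.
have : Num.sqrt P <= Num.sqrt (P + e) by rewrite ler_wsqrtr// lerDl.
have := sqrtr_ge0 P; nra.
Qed.

(** The arithmetic of the error inequality. [A], [B] pair the exact memory velocity with the
    interpolated and the exact slack; [C], [D] pair the discrete one with the exact slack and the
    one at the right node. [G] pairs the discrete velocity with the slack increment, [V] is the
    squared gradient increment and [m] is 1 - la. Both 2 m G and m^2 V are absorbed by 2 m
    [beta]. *)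
Lemma error_arith (R : realType) (IU IW A B C D G pv fd nf Wk E V m beta : R) :
  A - B <= 0 -> C - D <= 0 -> IU + (IW + (B - A - (C - (D - m * G)))) + pv = fd ->
  nf <= Wk -> 0 <= E -> 0 <= G -> G + V <= beta -> - (nf * E) <= fd <= nf * E ->
  0 <= V -> 0 <= m -> m <= 1 ->
  2 * (IU + IW) + (2 * pv + m ^+ 2 * V) <= 2 * Wk * E + 2 * m * beta.
Proof.
move=> AB CD eq nW E0 G0 GV /andP[_ fE] V0 m0 m1.
have h1 : fd <= Wk * E by apply: (le_trans fE); rewrite ler_wpM2r.
have h2 : m * (G + V) <= m * beta by rewrite ler_wpM2l.
have h3 : m ^+ 2 * V <= m * V by rewrite expr2 -mulrA ler_piMl// mulr_ge0.
have h4 : 0 <= m * V by rewrite mulr_ge0.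
lra.
Qed.

Section abstract_scheme.
Context (R : realType) (X V M : lmodType R).
Context (ip : X -> X -> R) (NX : X -> R) (ipv : V -> V -> R) (NV : V -> R).
Context (SM : set M) (ipM : M -> M -> R) (NM : M -> R).
Hypotheses (sib : semi_inner setT ip NX) (siV : semi_inner setT ipv NV)
  (siM : semi_inner SM ipM NM).
Context (pi : V -> X) (j : X -> M).
Hypothesis pi_lin : forall a x y, pi (a *: x + y) = a *: pi x + pi y.
Hypothesis j_lin : forall a x y, j (a *: x + y) = a *: j x + j y.
Hypothesis jS : forall x, SM (j x).
Context (kappa : R) (kappa_gt0 : 0 < kappa).

(** In the model [pi] forgets the gradient and [j] embeds by constants, so an equation tested with
    phi in V pairs a velocity with [(pi phi, j (pi phi))]. *)
Definition energy_ip (p q : X * M) : R := kappa * ip p.1 q.1 + ipM p.2 q.2.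
Definition energy_norm (p : X * M) : R := Num.sqrt (energy_ip p p).
Definition energy_space : set (X * M) := [set p | setT p.1 /\ SM p.2].

Lemma semi_inner_energy : semi_inner energy_space energy_ip energy_norm.
Proof. exact: (semi_inner_prod (ltW kappa_gt0) sib siM). Qed.

Let siE := semi_inner_energy.

Let piB x y : pi (x - y) = pi x - pi y.
Proof. by rewrite -scaleN1r addrC pi_lin scaleN1r addrC. Qed.

Let piZ a x : pi (a *: x) = a *: pi x.
Proof.
have pi0 : pi 0 = 0 by have := piB 0 0; rewrite !subrr.
by rewrite -[a *: x]addr0 pi_lin pi0 addr0.
Qed.

Let piD x y : pi (x + y) = pi x + pi y.
Proof. by rewrite -[x in LHS]scale1r pi_lin scale1r. Qed.

Let jB x y : j (x - y) = j x - j y.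
Proof. by rewrite -scaleN1r addrC j_lin scaleN1r addrC. Qed.

Let jZ a x : j (a *: x) = a *: j x.
Proof.
have j0 : j 0 = 0 by have := jB 0 0; rewrite !subrr.
by rewrite -[a *: x]addr0 j_lin j0 addr0.
Qed.

Let jD x y : j (x + y) = j x + j y.
Proof. by rewrite -[x in LHS]scale1r j_lin scale1r. Qed.

(** The factor 1 / sqrt kappa of the data increments arises here, from kappa |p.1|^2 <= |p|^2 in the
    energy norm. *)
Lemma energy_fst_le (x : X) (p : X * M) : energy_space p ->
  `|ip x p.1| <= NX x / Num.sqrt kappa * energy_norm p.
Proof.
move=> Sp; apply: (le_trans (si_cauchy_abs sib I I)).
rewrite -mulrA ler_wpM2l ?(siN_ge0 sib)// ler_pdivlMl ?sqrtr_gt0//.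
rewrite (si_norm sib)// -sqrtrM ?(ltW kappa_gt0)// ler_wsqrtr// /energy_ip lerDl.
by apply: (si_ge0 siM); case: Sp.
Qed.

(** * One time step: dissipation and pointwise error *)

Section time_step.
Context (tau : R) (u0 u1 : V) (w0 w1 : M) (F0 F1 : X) (H10 : set V) (p0 : X * M).
Hypotheses (tau_gt0 : 0 < tau) (Hu0 : H10 u0) (Hu1 : H10 u1).
Hypotheses (Sw0 : SM w0) (Sw1 : SM w1) (Sp0 : energy_space p0).
Let x0 := j (pi u0) - w0.
Let x1 := j (pi u1) - w1.
Let du := tau^-1 *: (u1 - u0).
Let dw := tau^-1 *: (w1 - w0).
Let p1 : X * M := (pi du, dw).
Hypothesis weak0 : forall phi, H10 phi ->
  energy_ip p0 (pi phi, j (pi phi)) + ipv u0 phi = ip F0 (pi phi).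
Hypothesis weak1 : forall phi, H10 phi ->
  energy_ip p1 (pi phi, j (pi phi)) + ipv u1 phi = ip F1 (pi phi).
Hypothesis cone0 : ipM p0.2 (x1 - x0) <= 0.
Hypothesis cone1 : ipM dw (x0 - x1) <= 0.

Let Sx0 : SM x0. Proof. exact: (siSB siM). Qed.
Let Sx1 : SM x1. Proof. exact: (siSB siM). Qed.
Let Sdw : SM dw. Proof. by apply: (siSZ siM); exact: (siSB siM). Qed.
Let Sp1 : energy_space p1. Proof. by []. Qed.

Lemma slack_velocity_ge0 : 0 <= ipM dw (x1 - x0).
Proof.
by move: cone1; rewrite (siBr siM Sx0 Sx1 Sdw) (siBr siM Sx1 Sx0 Sdw) subr_le0 subr_ge0.
Qed.

Lemma step_dissipation (W : R) : NX (F1 - F0) <= W ->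
  ipM dw (x1 - x0) + NV (u1 - u0) ^+ 2 <=
  tau * (energy_norm p1 * (W / Num.sqrt kappa + energy_norm p0 - energy_norm p1)).
Proof.
move=> FW; have Sp := siSB siE Sp1 Sp0; have Sx := siSB siM Sx1 Sx0.
pose emb phi : X * M := (pi phi, j (pi phi)).
have Semb phi : energy_space (emb phi) by split=> //; exact: jS.
have embB phi psi : emb (phi - psi) = emb phi - emb psi by rewrite /emb piB jB.
have weak : energy_ip (p1 - p0) (emb (u1 - u0)) + NV (u1 - u0) ^+ 2 =
    ip (F1 - F0) (pi (u1 - u0)).
  (* [H10] is a bare set here, so the equation is taken at [u0] and [u1] separately and then
     combined by linearity. *)
  have L phi : H10 phi -> energy_ip (p1 - p0) (emb phi) + ipv (u1 - u0) phi =
      ip (F1 - F0) (pi phi).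
    move=> Hphi; rewrite (siBl siE)// (siBl siV)// (siBl sib)//.
    by rewrite -(weak0 Hphi) -(weak1 Hphi) /emb; ring.
  rewrite (siN_sqr siV)// embB piB (siBr siE)// (siBr siV)// (siBr sib)//.
  by rewrite -(L _ Hu0) -(L _ Hu1); ring.
have tau0 : tau != 0 by rewrite gt_eqF.
(* The test pair exceeds the increment of the solution by the slack increment, in the memory
   component only. The first part yields the velocity norms, the second is paired with both memory
   velocities, and [cone0] discards the older one. *)
have emb_tau : emb (u1 - u0) = tau *: p1 + (0, x1 - x0).
  apply: pair_eq; rewrite ?fst_lin ?snd_lin /=.
    by rewrite addr0 /du piZ scalerA mulfV// scale1r.
  rewrite /dw scalerA mulfV// scale1r piB jB /x1 /x0.
  by rewrite subrACA [RHS]addrC subrK.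
have S0x : energy_space (0, x1 - x0) by [].
have St := siSZ siE tau Sp1.
move: weak; rewrite emb_tau (siDr siE)// (siZr siE)// !(siBl siE)// piB.
have E0 p : energy_ip p (0, x1 - x0) = ipM p.2 (x1 - x0).
  by rewrite /energy_ip /= (si_sym sib)// (si0l sib)// mulr0 add0r.
rewrite !E0 /=.
rewrite -piB (_ : pi (u1 - u0) = tau *: pi du); last first.
  by rewrite /du piZ scalerA mulfV// scale1r.
rewrite (siZr sib)// -(siN_sqr siE)//.
have := energy_fst_le (F1 - F0) Sp1; have := si_cauchy_abs siE Sp0 Sp1.
have : NX (F1 - F0) / Num.sqrt kappa <= W / Num.sqrt kappa.
  by rewrite ler_pM2r// invr_gt0 sqrtr_gt0.
have := siN_ge0 siE Sp1; have := cone0.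
move: (energy_norm p1) (energy_norm p0) (NV _) (energy_ip p0 p1) (ip (F1 - F0) _)
  (NX _ / _) (W / _) (ipM p0.2 _) (ipM dw _) tau_gt0.
move=> d1 d0 nv e01 fd nf Wk g0 g1 t0 c0 d1_ge0 nfW; rewrite !ler_norml => /andP[_ h1] /andP[_ h2] E.
have h3 : fd <= Wk * d1 by apply: (le_trans h2); rewrite ler_wpM2r.
have : tau * (fd + e01 - d1 ^+ 2) <= tau * (Wk * d1 + d0 * d1 - d1 ^+ 2).
  by rewrite ler_pM2l//; lra.
have -> : d1 * (Wk + d0 - d1) = Wk * d1 + d0 * d1 - d1 ^+ 2 by ring.
lra.
Qed.

(* The exact equation at time [s = (1 - la) t_0 + la t_1] minus the discrete one is
   tested with the error, and each inclusion with the slack of the other solution. *)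
Lemma pointwise_error (la W : R) (fs us uts : X) (vs : V) (ws wts : M) (Kset : set M) :
  0 <= la <= 1 -> H10 vs -> SM ws -> SM wts -> Kset x0 -> Kset x1 ->
  Kset ((1 - la) *: x0 + la *: x1) ->
  (forall x, ip x us = ip x (pi vs)) ->
  (forall z, SM z -> ipM z (j us) = ipM z (j (pi vs))) ->
  (forall phi, H10 phi ->
    energy_ip (uts, wts) (pi phi, j (pi phi)) + ipv vs phi = ip fs (pi phi)) ->
  Kset (j us - ws) ->
  (forall y, Kset y -> ipM wts (y - (j us - ws)) <= 0) ->
  (forall y, Kset y -> ipM dw (y - x1) <= 0) ->
  NX (F1 - F0) <= W -> NX (fs - F1) <= W ->
  forall ut wt, ut = u0 + la *: (u1 - u0) -> wt = w0 + la *: (w1 - w0) ->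
  2 * (kappa * ip (uts - pi du) (us - pi ut) + ipM (wts - dw) (ws - wt)) +
    (NV (vs - u1) ^+ 2 + NV (vs - ut) ^+ 2) <=
  2 * (W / Num.sqrt kappa) * energy_norm (us - pi ut, ws - wt) +
  2 * (1 - la) * (tau * (energy_norm p1 * (W / Num.sqrt kappa + energy_norm p0 - energy_norm p1))).
Proof.
move=> /andP[la0 la1] Hvs Sws Swts K0 K1 Kla us_vs jus_vs weaks Ks cones coned FW fW ut wt utE wtE.
pose mu_ := 1 - la; have mu0 : 0 <= mu_ by rewrite /mu_; lra.
have mu1 : mu_ <= 1 by rewrite /mu_; lra.
have la_mu : la = 1 - mu_ by rewrite /mu_; ring.
have Swt : SM wt by rewrite wtE; apply: (siSD siM) => //; apply: (siSZ siM); exact: (siSB siM).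
have Sdwt := siSB siM Swts Sdw; have Sew := siSB siM Sws Swt.
have Sxs := siSB siM (jS us) Sws; have Sx := siSB siM Sx1 Sx0.
pose phi := vs - ut.
have weak : energy_ip (uts - pi du, wts - dw) (pi phi, j (pi phi)) + ipv (vs - u1) phi =
    ip (fs - F1) (pi phi).
  have Ee psi : energy_space (pi psi, j (pi psi)) by split=> //; exact: jS.
  have L psi : H10 psi -> energy_ip (uts - pi du, wts - dw) (pi psi, j (pi psi)) +
      ipv (vs - u1) psi = ip (fs - F1) (pi psi).
    move=> Hpsi; rewrite [energy_ip _ _](siBl siE (x := (uts, wts)) (y := p1))//.
    rewrite (siBl siV)// (siBl sib)//.
    by rewrite -(weaks _ Hpsi) -(weak1 Hpsi); ring.
  have Ephi : (pi phi, j (pi phi)) =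
      (pi vs, j (pi vs)) - ((pi u0, j (pi u0)) + la *: ((pi u1, j (pi u1)) - (pi u0, j (pi u0)))).
    by rewrite /phi utE; apply: pair_eq; rewrite /= piB piD piZ piB ?jB ?jD ?jZ ?jB.
  have S1 := siSB siE (Ee u1) (Ee u0); have S2 := siSZ siE la S1; have S3 := siSD siE (Ee u0) S2.
  have Sd : energy_space (uts - pi du, wts - dw) by [].
  rewrite {1}Ephi (siBr siE)// (siDr siE)// (siZr siE)// (siBr siE)//.
  rewrite {1}/phi {1}utE (siBr siV)// (siDr siV)// (siZr siV)// (siBr siV)//.
  rewrite (_ : pi phi = pi vs - (pi u0 + la *: (pi u1 - pi u0))); last exact: (congr1 fst Ephi).
  rewrite (siBr sib)// (siDr sib)// (siZr sib)// (siBr sib)//.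
  by rewrite -(L _ Hvs) -(L _ Hu0) -(L _ Hu1); ring.
have ipphi x : ip x (pi phi) = ip x (us - pi ut).
  by rewrite /phi piB !(siBr sib)// us_vs.
have ipMphi : ipM (wts - dw) (j (pi phi)) = ipM (wts - dw) (j us - j (pi ut)).
  by rewrite /phi piB jB !(siBr siM)// jus_vs.
move: weak; rewrite {1}/energy_ip /= !ipphi ipMphi => weak.
have laE (x y : M) : x + la *: (y - x) = y - mu_ *: (y - x).
  by rewrite /mu_ scalerBl scale1r opprB addrCA subKr addrC.
(* The interpolated slack is expanded from the right node because the discrete velocity lies in the
   cone there; the deviation costs (1 - la) times the slack increment. *)
have xla : j (pi ut) - wt = x1 - mu_ *: (x1 - x0).
  rewrite -laE utE wtE piD piZ piB jD jZ jB /x0 /x1.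
  by rewrite opprD addrACA -scalerBr subrACA.
have Ew : j us - j (pi ut) = (ws - wt) + ((j us - ws) - (x1 - mu_ *: (x1 - x0))).
  by rewrite -xla subrACA [RHS]addrC subrK.
have Kla' : Kset (x1 - mu_ *: (x1 - x0)).
  suff <- : (1 - la) *: x0 + la *: x1 = x1 - mu_ *: (x1 - x0) by [].
  have laE' (x y : M) : (1 - la) *: x + la *: y = x + la *: (y - x).
    by rewrite scalerBl scale1r scalerBr addrA addrAC.
  by rewrite laE' laE.
have Sla := siSB siM Sx1 (siSZ siM mu_ Sx).
have Sd := siSB siM Sxs Sla.
rewrite Ew (siDr siM)// (siBl siM (z := _ - (_ - _)))// in weak.
have c1 := cones _ Kla'; rewrite (siBr siM)// in c1.
have c2 := coned _ Ks; rewrite (siBr siM)// in c2.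
rewrite [ipM wts _](siBr siM)// [ipM dw (_ - (_ - _))](siBr siM)// in weak.
rewrite [ipM dw (x1 - _)](siBr siM)// ?(siZr siM)// in weak; last by apply: (siSZ siM).
(* Polarization |p|^2 + |q|^2 = 2 (p, q) + |p - q|^2 turns the mixed gradient product of the tested
   equation into both gradient errors; here p - q = - (1 - la) (u1 - u0). *)
have NE : NV (vs - u1) ^+ 2 + NV (vs - ut) ^+ 2 =
    2 * ipv (vs - u1) phi + mu_ ^+ 2 * NV (u1 - u0) ^+ 2.
  have pq : vs - u1 - phi = - (mu_ *: (u1 - u0)).
    rewrite /phi subrACA subrr add0r utE; congr (- _).
    by rewrite /mu_ scalerBl scale1r opprD addrA.
  have := si_sqB siV (x := vs - u1) (y := phi) I I.
  rewrite pq -!(siN_sqr siV)// (siN_opp siV)// (siNZ siV)// exprMn real_normK ?num_real//.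
  by move=> ->; rewrite /phi; ring.
have Se : energy_space (us - pi ut, ws - wt) by [].
have := energy_fst_le (fs - F1) Se; have := step_dissipation FW.
have := slack_velocity_ge0; have := siN_ge0 siE Se.
have : NX (fs - F1) / Num.sqrt kappa <= W / Num.sqrt kappa.
  by rewrite ler_pM2r// invr_gt0 sqrtr_gt0.
rewrite NE ler_norml [(_, _).1]/=; move: c1 c2 weak.
move=> A B C D E F P Q; rewrite -/mu_; move: A B C D E F P Q (sqr_ge0 (NV (u1 - u0))) mu0 mu1.
exact: error_arith.
Qed.

End time_step.

(** * Integration in time and summation over the steps *)

Section time_error.
Notation leb := (@lebesgue_measure R).
Context (T : R) (T_gt0 : 0 < T) (n : nat) (t : nat -> R) (ht : time_partition T n t).
Context (u ut : R -> X) (v : R -> V) (w wt : R -> M) (f : R -> X).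
Context (un : nat -> V) (wn : nat -> M) (vel0 : X) (W : nat -> R).
Context (H10 : set V) (Kset : set M).
Hypothesis uH1 : in_H1 setT NX T u ut.
Hypothesis wH1 : in_H1 SM NM T w wt.
Hypothesis vL2 : in_L2 leb setT NV `]0, T[ v.
Hypothesis Kconvex : forall x y la, Kset x -> Kset y -> 0 <= la <= 1 ->
  Kset ((1 - la) *: x + la *: y).
Hypothesis exact_eq : {ae leb, forall s, s \in `]0, T[ ->
  [/\ H10 (v s), forall x, ip x (u s) = ip x (pi (v s)),
      forall z, SM z -> ipM z (j (u s)) = ipM z (j (pi (v s))),
      forall phi, H10 phi ->
        energy_ip (ut s, wt s) (pi phi, j (pi phi)) + ipv (v s) phi = ip (f s) (pi phi) &
      Kset (j (u s) - w s) /\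
      forall y, Kset y -> ipM (wt s) (y - (j (u s) - w s)) <= 0]}.

Definition slack (k : nat) : M := j (pi (un k)) - wn k.

(* difference quotients of the discrete solution; the one at k = 0 is the
   initial velocity prescribed by the equation, with w at rest *)
Definition velocity (k : nat) : X * M :=
  if k is i.+1 then (pi (backward_difference t un i), backward_difference t wn i)
  else (vel0, 0).

Hypothesis un_H10 : forall k, (k <= n)%N -> H10 (un k).
Hypothesis wn_SM : forall k, (k <= n)%N -> SM (wn k).
Hypothesis slack_K : forall k, (k <= n)%N -> Kset (slack k).
Hypothesis euler_eq : forall k phi, (k <= n)%N -> H10 phi ->
  energy_ip (velocity k) (pi phi, j (pi phi)) + ipv (un k) phi = ip (f (t k)) (pi phi).
Hypothesis euler_cone : forall k y, (k < n)%N -> Kset y ->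
  ipM (backward_difference t wn k) (y - slack k.+1) <= 0.
Hypothesis W_nodes : forall k, (k < n)%N -> NX (f (t k.+1) - f (t k)) <= W k.
Hypothesis W_inside : forall k s, (k < n)%N -> s \in `]t k, t k.+1[ ->
  NX (f s - f (t k.+1)) <= W k.

Let b k := W k / Num.sqrt kappa.
Let d k := energy_norm (velocity k).
Let tau k := step t k.
Let be k := tau k * (d k.+1 * (b k + d k - d k.+1)).

Let W_ge0 k : (k < n)%N -> 0 <= W k.
Proof. by move=> kn; apply: le_trans (W_nodes kn); exact: (siN_ge0 sib). Qed.

Let b_ge0 k : (k < n)%N -> 0 <= b k.
Proof. by move=> kn; rewrite divr_ge0 ?sqrtr_ge0// W_ge0. Qed.

Let tau_gt0 k : (k < n)%N -> 0 < tau k.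
Proof. by move=> kn; case: ht => _ _ /(_ k kn); rewrite subr_gt0. Qed.

Let velocity_S k : (k <= n)%N -> energy_space (velocity k).
Proof.
case: k => [_|k kn]; split => //=; first exact: si_0 siM.
by apply: (siSZ siM); apply: (siSB siM); apply: wn_SM => //; exact: ltnW.
Qed.

Let velocity_cone k : (k < n)%N -> ipM (velocity k).2 (slack k.+1 - slack k) <= 0.
Proof.
case: k => [|k] kn; last by apply: euler_cone => //; [exact: ltnW|exact: slack_K].
have SS i : (i <= n)%N -> SM (slack i) by move=> ?; apply: (siSB siM) => //; exact: wn_SM.
by rewrite /= (si0l siM)//; apply: (siSB siM); exact: SS.
Qed.

(** The quantity bounds a sum of two nonnegative consistency terms. Its sign is needed under the
    square root and for the telescoping sum. *)
Lemma step_dissipation_ge0 k : (k < n)%N -> 0 <= be k.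
Proof.
move=> kn; have kn' := ltnW kn.
have c0 := velocity_cone kn; have c1 := euler_cone kn (slack_K kn').
have h1 := slack_velocity_ge0 (wn_SM kn') (wn_SM kn) c1.
have := @step_dissipation (tau k) (un k) (un k.+1) (wn k) (wn k.+1) (f (t k)) (f (t k.+1))
  H10 (velocity k) (tau_gt0 kn) (un_H10 kn') (un_H10 kn) (wn_SM kn') (wn_SM kn)
  (velocity_S kn') (fun phi => euler_eq kn') (fun phi => euler_eq kn) c0 (W k) (W_nodes kn).
by apply: le_trans; rewrite addr_ge0// sqr_ge0.
Qed.

Section one_step.
Context (k : nat) (kn : (k < n)%N).

Let la (s : R) := (s - t k) / tau k.

Definition u_affine (s : R) : V := un k + la s *: (un k.+1 - un k).
Definition w_affine (s : R) : M := wn k + la s *: (wn k.+1 - wn k).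
Definition step_error (s : R) : X * M := (u s - pi (u_affine s), w s - w_affine s).
Definition step_gradient_error (s : R) : R :=
  NV (v s - un k.+1) ^+ 2 + NV (v s - u_affine s) ^+ 2.

Let tk : t k < t k.+1. Proof. by case: ht => _ _; exact. Qed.
Let tk0 : 0 <= t k.
Proof.
have [t0 _ tS] := ht; have : forall i, (i <= n)%N -> 0 <= t i.
  elim=> [_|i ih ilt]; first by rewrite t0.
  by apply: le_trans (ih (ltnW ilt)) (ltW (tS i ilt)).
by apply; exact: ltnW.
Qed.
Let tkT : t k.+1 <= T.
Proof.
have [_ tn tS] := ht; rewrite -tn.
have : forall i, (k.+1 <= i)%N -> (i <= n)%N -> t k.+1 <= t i.
  elim=> // i ih; rewrite leq_eqVlt => /predU1P[<- //|ki] ilt.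
  by apply: le_trans (ih ki (ltnW ilt)) (ltW (tS i ilt)).
exact.
Qed.

Let step_error_energy (s : R) : t k <= s -> s <= t k.+1 ->
  let rate x := kappa * ip (ut x - pi (backward_difference t un k)) (step_error x).1 +
    ipM (wt x - backward_difference t wn k) (step_error x).2 in
  [/\ forall x, x \in `]t k, s[ -> energy_space (step_error x),
      leb.-integrable `]t k, s[ (EFin \o rate),
      leb.-integrable `]t k, s[ (EFin \o (fun x => energy_norm (step_error x))) &
      energy_norm (step_error s) ^+ 2 - energy_norm (step_error (t k)) ^+ 2 =
        2 * \int[leb]_(x in `]t k, s[) rate x].
Proof.
move=> ks sk rate.
have sT : s <= T by exact: le_trans tkT.
have ms : measurable (`]t k, s[ : set (measurableTypeR R)) by exact: measurable_itv.
have S1 := wn_SM kn; have S0 := wn_SM (ltnW kn); have S10 := siSB siM S1 S0.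
have [Lu iu Eu] := H1_affine_energy sib uH1 (z0 := pi (un k)) (z1 := pi (un k.+1) - pi (un k))
  (t k) (tau k) I I tk0 ks sT.
have [Lw iw Ew] := H1_affine_energy siM wH1 (t k) (tau k) S0 S10 tk0 ks sT.
have euE x : u x - (pi (un k) + ((x - t k) / tau k) *: (pi (un k.+1) - pi (un k))) =
    (step_error x).1.
  by rewrite /step_error /u_affine /= piD piZ piB.
have duE : pi (backward_difference t un k) = (tau k)^-1 *: (pi (un k.+1) - pi (un k)).
  by rewrite /backward_difference piZ piB.
have SE x : x \in `]t k, s[ -> energy_space (step_error x).
  by move=> xs; split => //=; case: Lw => -[+ _] _; exact.
have ru : (fun x => ip (ut x - (tau k)^-1 *: (pi (un k.+1) - pi (un k)))
      (u x - (pi (un k) + ((x - t k) / tau k) *: (pi (un k.+1) - pi (un k))))) =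
    (fun x => ip (ut x - pi (backward_difference t un k)) (step_error x).1).
  by apply/funext => x; rewrite duE euE.
rewrite ru in iu Eu; rewrite !euE in Eu.
have irate : leb.-integrable `]t k, s[ (EFin \o rate).
  exact: (integrable_finD ms (integrable_finZ kappa ms iu) iw).
have iE2 : leb.-integrable `]t k, s[ (EFin \o (fun x => energy_norm (step_error x) ^+ 2)).
  have := integrable_finD ms (integrable_finZ kappa ms (in_L2_pairing_integrable sib ms Lu Lu))
    (in_L2_pairing_integrable siM ms Lw Lw).
  apply: eq_integrable => // x; rewrite inE => xs.
  by rewrite /= (siN_sqr siE) /energy_ip ?euE//; exact: SE.
split => //.
- apply: (dominated_integrable_fin ms _ _ (integrable_finD ms iE2
    (cst_integrable_fin ms (lebesgue_itvoo_lty _ _) 1))).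
    (* Measurability of the norm is read off from its square, already known to be integrable, by
       composition with square roots. *)
    rewrite (_ : (fun x => _) = Num.sqrt \o (fun x => Num.sqrt (energy_norm (step_error x) ^+ 2) ^+ 2)); last first.
      by apply/funext => x /=; rewrite sqr_sqrtr ?sqr_ge0// sqrtr_sqr ger0_norm// sqrtr_ge0.
    apply: measurableT_comp; first exact: continuous_measurable_fun (@sqrt_continuous R).
    apply: measurable_funX; apply: measurableT_comp.
      exact: continuous_measurable_fun (@sqrt_continuous R).
    by apply/measurable_EFinP; exact: (measurable_int leb).
  move=> x xs /=; rewrite ger0_norm ?sqrtr_ge0//.
  by have := sqr_ge0 (energy_norm (step_error x) - 1); nra.
- have Es : energy_space (step_error s).
    split => //=; have [cw _ _ _] := wH1; apply: (siSB siM).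
      by apply: (cw s _).1; rewrite in_itv/= (le_trans tk0 ks).
    by apply: (siSD siM); [exact: S0|exact: (siSZ siM _ S10)].
  have Ek : energy_space (step_error (t k)).
    split => //=; have [cw _ _ _] := wH1; apply: (siSB siM).
      by apply: (cw (t k) _).1; rewrite in_itv/= tk0 (le_trans (ltW tk) tkT).
    by apply: (siSD siM); [exact: S0|exact: (siSZ siM _ S10)].
  rewrite !(siN_sqr siE)// /energy_ip /rate RintegralD//; last exact: integrable_finZ.
  rewrite RintegralZl// mulrDr (mulrCA 2) -Ew -Eu; ring.
Qed.

Lemma step_gradient_integrable (s : R) : s <= t k.+1 ->
  leb.-integrable `]t k, s[ (EFin \o (fun x => NV (v x - un k.+1) ^+ 2)) /\
  leb.-integrable `]t k, s[ (EFin \o (fun x => NV (v x - u_affine x) ^+ 2)).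
Proof.
move=> sk; have sT : s <= T by exact: le_trans tkT.
have L1 := in_L2_affine siV 0 1 vL2 tk0 sT (z0 := un k.+1) (z1 := 0) I I.
have L2 := in_L2_affine siV (t k) (tau k) vL2 tk0 sT (z0 := un k) (z1 := un k.+1 - un k) I I.
split; last exact: (in_L2_sqr_integrable siV L2).
have := in_L2_sqr_integrable siV L1.
by apply: eq_integrable => // x _ /=; rewrite scaler0 addr0.
Qed.

Lemma step_estimate (s : R) : t k <= s -> s <= t k.+1 ->
  leb.-integrable `]t k, s[ (EFin \o (fun x => energy_norm (step_error x))) /\
  leb.-integrable `]t k, s[ (EFin \o step_gradient_error) /\
  energy_norm (step_error s) ^+ 2 + \int[leb]_(x in `]t k, s[) step_gradient_error x <=
    energy_norm (step_error (t k)) ^+ 2 + tau k * be k +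
    2 * b k * \int[leb]_(x in `]t k, s[) energy_norm (step_error x).
Proof.
move=> ks sk; have [SE irate iE Eeq] := step_error_energy ks sk.
have ms : measurable (`]t k, s[ : set (measurableTypeR R)) by exact: measurable_itv.
have sT : s <= T by exact: le_trans tkT.
have kn' := ltnW kn.
have [i1 i2] := step_gradient_integrable sk.
have ig : leb.-integrable `]t k, s[ (EFin \o step_gradient_error) by exact: integrable_finD.
split=> //; split=> //.
(* This is [2 * (1 - la x) * be k] written as an affine function of [x - t k]. *)
have [ia Ia] := @Rintegral_affine R (2 * be k) (- (2 * be k / tau k)) (t k) s ks.
have t0 := tau_gt0 kn; have be0 := step_dissipation_ge0 kn.
have le_int : 2 * \int[leb]_(x in `]t k, s[)
      (kappa * ip (ut x - pi (backward_difference t un k)) (step_error x).1 +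
        ipM (wt x - backward_difference t wn k) (step_error x).2) +
    \int[leb]_(x in `]t k, s[) step_gradient_error x <=
    2 * b k * \int[leb]_(x in `]t k, s[) energy_norm (step_error x) +
    \int[leb]_(x in `]t k, s[) (2 * be k + - (2 * be k / tau k) * (x - t k)).
  rewrite -!RintegralZl// -!RintegralD//; try exact: integrable_finZ.
  apply: ae_le_Rintegral => //.
  - by apply: integrable_finD => //; exact: integrable_finZ.
  - by apply: integrable_finD => //; exact: integrable_finZ.
  apply: (@filterS _ _ (ae_filter_ringOfSetsType leb) _ _ _ exact_eq) => x hx xs.
  have xT : x \in `]0, T[ by exact: (subset_itvoo tk0 sT xs).
  have xk : x \in `]t k, t k.+1[ by exact: (subset_itvoo (lexx _) sk xs).
  have [Hv us jus eqs [Ks cones]] := hx xT.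
  have la01 : 0 <= la x <= 1.
    move: xk; rewrite in_itv/= => /andP[k1 k2].
    rewrite /la divr_ge0 ?ler_pdivrMr// ?mul1r ?lerD2r ?subr_ge0 ?ltW//.
  have Sws : SM (w x).
    by have [cw _ _ _] := wH1; apply: (cw x _).1; exact: subset_itv_oo_cc.
  have Swts : SM (wt x) by have [_ _ [[+ _] _] _] := wH1; exact.
  have := @pointwise_error (tau k) (un k) (un k.+1) (wn k) (wn k.+1) (f (t k)) (f (t k.+1))
    H10 (velocity k) t0 (un_H10 kn') (un_H10 kn) (wn_SM kn') (wn_SM kn)
    (velocity_S kn') (fun phi => euler_eq kn') (fun phi => euler_eq kn)
    (velocity_cone kn) (euler_cone kn (slack_K kn'))
    (la x) (W k) (f x) (u x) (ut x) (v x) (w x) (wt x) Kset la01 Hv Sws Swts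
    (slack_K kn') (slack_K kn) (Kconvex (slack_K kn') (slack_K kn) la01)
    us jus eqs Ks cones (fun y => euler_cone kn) (W_nodes kn) (W_inside kn xk)
    (u_affine x) (w_affine x) erefl erefl.
  move=> h; apply: (le_trans h); rewrite lerD2l.
  rewrite /be /la -/(d k) -/(d k.+1); move: (d k.+1 * _) => z.
  rewrite le_eqVlt; apply/orP; left; apply/eqP; field.
  by rewrite gt_eqF.
(* Completing the square shows that the integral is largest for s at the right node, where it equals
   [tau k * be k]: the second factor tau_k. *)
have aff : \int[leb]_(x in `]t k, s[) (2 * be k + - (2 * be k / tau k) * (x - t k)) <= tau k * be k.
  rewrite Ia; set y := s - t k.
  have -> : 2 * be k * y + - (2 * be k / tau k) / 2 * y ^+ 2 =
      tau k * be k - be k / tau k * (tau k - y) ^+ 2.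
    by field; rewrite gt_eqF.
  by rewrite gerBl mulr_ge0 ?sqr_ge0// divr_ge0// ltW.
move: Eeq le_int aff; lra.
Qed.

(** [Acc] carries the gradient errors of the previous steps. Error and gradients lie together below
    the right-hand side bounded by [quadratic_gronwall], so one argument yields both estimates
    without doubling the constant. *)
Lemma step_gronwall (Y Acc s : R) : 0 <= Y -> 0 <= Acc ->
  energy_norm (step_error (t k)) ^+ 2 + Acc <= Y ^+ 2 ->
  s \in `[t k, t k.+1] ->
  energy_norm (step_error s) ^+ 2 +
    (Acc + \int[leb]_(x in `]t k, s[) step_gradient_error x) <=
  (Num.sqrt (Y ^+ 2 + tau k * be k) + b k * tau k) ^+ 2.
Proof.
move=> Y0 Acc0 YP sk.
have t0 := tau_gt0 kn; have be0 := step_dissipation_ge0 kn; have b0 := b_ge0 kn.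
pose A := Num.sqrt (Y ^+ 2 + tau k * be k).
have A2 : A ^+ 2 = Y ^+ 2 + tau k * be k.
  by rewrite sqr_sqrtr// addr_ge0 ?sqr_ge0// mulr_ge0// ltW.
have A0 : 0 <= A by exact: sqrtr_ge0.
pose p x := energy_norm (step_error x).
have p0 x : 0 <= p x by exact: sqrtr_ge0.
have g0 x : 0 <= \int[leb]_(x in `]t k, x[) step_gradient_error x.
  by apply: Rintegral_ge0 => y _; rewrite addr_ge0 ?sqr_ge0.
have est x : x \in `[t k, t k.+1] -> p x ^+ 2 +
    (Acc + \int[leb]_(x in `]t k, x[) step_gradient_error x) <=
    A ^+ 2 + 2 * b k * \int[leb]_(x in `]t k, x[) p x.
  rewrite in_itv/= => /andP[kx xk].
  have [_ [_]] := step_estimate kx xk; rewrite A2 /p; move: YP; lra.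
have [iE [_ _]] := step_estimate (ltW tk) (lexx _).
have Ip0 : 0 <= \int[leb]_(x in `]t k, t k.+1[) p x by exact: Rintegral_ge0.
have b2 : 0 <= 2 * b k by rewrite mulr_ge0.
pose C := A ^+ 2 + 2 * b k * \int[leb]_(x in `]t k, t k.+1[) p x.
have C0 : 0 <= C by rewrite addr_ge0 ?sqr_ge0// mulr_ge0.
have p2 x : x \in `[t k, t k.+1] ->
    p x ^+ 2 <= A ^+ 2 + 2 * b k * \int[leb]_(x in `]t k, x[) p x.
  by move=> xk; apply: le_trans (est x xk); rewrite lerDl addr_ge0.
(* A bound on p^2 gives one on p through p <= p^2 + 1; it only serves as the a priori bound for the
   Gronwall argument. *)
have pC x : x \in `[t k, t k.+1] -> 0 <= p x <= C + 1.
  move=> xk; rewrite p0/=.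
  have : p x ^+ 2 <= C.
    apply: (le_trans (p2 x xk)); rewrite lerD2l ler_wpM2l//.
    move: xk; rewrite in_itv/= => /andP[? ?].
    exact: Rintegral_itv_mono.
  have := sqr_ge0 (p x - 1); have := p0 x; nra.
apply: (le_trans (est s sk)).
apply: (le_trans (quadratic_gronwall (ltW tk) A0 b0 pC iE p2 sk)).
move: sk; rewrite in_itv/= => /andP[ks sk].
have L0 : 0 <= A + b k * (s - t k) by rewrite addr_ge0// mulr_ge0// subr_ge0.
have R0 : 0 <= A + b k * tau k by rewrite addr_ge0// mulr_ge0// ltW.
by rewrite (ler_sqr L0 R0) lerD2l ler_wpM2l// lerD2r.
Qed.

Lemma step_error_left : step_error (t k) = (u (t k) - pi (un k), w (t k) - wn k).
Proof. by rewrite /step_error /u_affine /w_affine /la subrr mul0r !scale0r !addr0. Qed.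

Lemma step_error_right :
  step_error (t k.+1) = (u (t k.+1) - pi (un k.+1), w (t k.+1) - wn k.+1).
Proof.
rewrite /step_error /u_affine /w_affine /la divff ?gt_eqF ?tau_gt0// !scale1r.
by rewrite [un k + _]addrC [wn k + _]addrC !subrK.
Qed.

End one_step.

Hypothesis u_init : NX (u 0 - pi (un 0%N)) = 0.
Hypothesis w_init : NM (w 0 - wn 0%N) = 0.

Let P k := \sum_(i < k) tau i * be i.
Let Q k := \sum_(i < k) b i * tau i.
Let gradient_error_sum k :=
  \sum_(i < k) \int[leb]_(x in `]t i, t i.+1[) step_gradient_error i x.

Let P_ge0 k : (k <= n)%N -> 0 <= P k.
Proof.
move=> kn; apply: sumr_ge0 => i _; have ik := leq_trans (ltn_ord i) kn.
by rewrite mulr_ge0 ?step_dissipation_ge0// ltW// tau_gt0.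
Qed.

Let Q_ge0 k : (k <= n)%N -> 0 <= Q k.
Proof.
move=> kn; apply: sumr_ge0 => i _; have ik := leq_trans (ltn_ord i) kn.
by rewrite mulr_ge0 ?b_ge0// ltW// tau_gt0.
Qed.

Let gradient_error_sum_ge0 k : 0 <= gradient_error_sum k.
Proof.
by apply: sumr_ge0 => i _; apply: Rintegral_ge0 => y _; rewrite addr_ge0 ?sqr_ge0.
Qed.

Lemma step_error_le k s : (k < n)%N -> s \in `[t k, t k.+1] ->
  energy_norm (u (t k) - pi (un k), w (t k) - wn k) ^+ 2 + gradient_error_sum k <=
    (Num.sqrt (P k) + Q k) ^+ 2 ->
  energy_norm (step_error k s) ^+ 2 + (gradient_error_sum k +
    \int[leb]_(x in `]t k, s[) step_gradient_error k x) <=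
  (Num.sqrt (P k.+1) + Q k.+1) ^+ 2.
Proof.
move=> kn sk; rewrite -(step_error_left k) => h.
have Pk := P_ge0 (ltnW kn); have Qk := Q_ge0 (ltnW kn).
have t0 := tau_gt0 kn; have be0 := step_dissipation_ge0 kn; have b0 := b_ge0 kn.
have e0 : 0 <= tau k * be k by rewrite mulr_ge0// ltW.
have q0 : 0 <= b k * tau k by rewrite mulr_ge0// ltW.
have Y0 : 0 <= Num.sqrt (P k) + Q k by rewrite addr_ge0// sqrtr_ge0.
apply: (le_trans (step_gronwall kn Y0 (gradient_error_sum_ge0 k) h sk)).
rewrite /P /Q !big_ord_recr /= -/(P k) -/(Q k).
have L0 : 0 <= Num.sqrt ((Num.sqrt (P k) + Q k) ^+ 2 + tau k * be k) + b k * tau k.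
  by rewrite addr_ge0// sqrtr_ge0.
have R0 : 0 <= Num.sqrt (P k + tau k * be k) + (Q k + b k * tau k).
  by rewrite addr_ge0 ?sqrtr_ge0// addr_ge0.
by rewrite (ler_sqr L0 R0) addrA lerD2r; exact: sqrt_add_sqr_le.
Qed.

Lemma node_error_le k : (k <= n)%N ->
  energy_norm (u (t k) - pi (un k), w (t k) - wn k) ^+ 2 + gradient_error_sum k <=
    (Num.sqrt (P k) + Q k) ^+ 2.
Proof.
have [tz _ _] := ht.
elim: k => [_|k ih kn].
  rewrite /gradient_error_sum /P /Q !big_ord0 sqrtr0 !addr0 expr0n/= tz.
  have SM0 : SM (w 0 - wn 0%N).
    apply: (siSB siM); last exact: wn_SM.
    by have [cw _ _ _] := wH1; apply: (cw 0 _).1; rewrite in_itv/= lexx ltW.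
  rewrite (siN_sqr siE)// /energy_ip /= -(siN_sqr sib)// -(siN_sqr siM)//.
  by rewrite u_init w_init expr0n/= mulr0 addr0.
have tkk : t k.+1 \in `[t k, t k.+1].
  by rewrite in_itv/= lexx andbT -subr_ge0 ltW// -/(step t k) tau_gt0.
have := step_error_le kn tkk (ih (ltnW kn)).
by rewrite step_error_right// /gradient_error_sum big_ord_recr.
Qed.

Let bound_mono k : (k < n)%N -> Num.sqrt (P k.+1) + Q k.+1 <= Num.sqrt (P n) + Q n.
Proof.
move=> kn.
have mono F i : (forall l, (l < n)%N -> 0 <= F l) -> (i <= n)%N ->
    \sum_(l < i) F l <= \sum_(l < n) F l :> R.
  move=> F0 il; rewrite -!(big_mkord xpredT F) [leRHS](big_cat_nat (n := i))//= lerDl.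
  by rewrite big_nat; apply: sumr_ge0 => l /andP[_ ln]; exact: F0.
have PP : P k.+1 <= P n.
  apply: (mono (fun l => tau l * be l)) => // l ln.
  by rewrite mulr_ge0 ?step_dissipation_ge0// ltW// tau_gt0.
have QQ : Q k.+1 <= Q n.
  apply: (mono (fun l => b l * tau l)) => // l ln.
  by rewrite mulr_ge0 ?b_ge0// ltW// tau_gt0.
by apply: lerD => //; exact: ler_wsqrtr.
Qed.

(** With S the sum of the b_k, the root contributes (d_0 + S) / sqrt 2 and the forcing contributes
    S, each times the mesh size; the factor 2 of the variation comes from 1 / sqrt 2 + 1 <= 2. *)
Let bound_le (Wtot : R) : \sum_(k < n) b k <= Wtot ->
  Num.sqrt (P n) + Q n <= mesh n t * ((Num.sqrt 2)^-1 * d 0 + 2 * Wtot).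
Proof.
move=> bW; set S := \sum_(k < n) b k in bW.
have mesh_ge k : (k < n)%N -> tau k <= mesh n t.
  by move=> kn; rewrite /mesh; exact: (le_bigmax _ (fun i : 'I_n => step t i) (Ordinal kn)).
have mesh0 : 0 <= mesh n t by rewrite /mesh bigmax_ge_id.
have d_ge0 k : 0 <= d k by exact: sqrtr_ge0.
have S0 : 0 <= S by apply: sumr_ge0 => k _; exact: b_ge0.
have dis k : (k < n)%N -> 0 <= d k.+1 * (b k + d k - d k.+1).
  by move=> kn; have := step_dissipation_ge0 kn; rewrite pmulr_rge0// tau_gt0.
have QS : Q n <= mesh n t * S.
  by rewrite /Q /S mulr_sumr; apply: ler_sum => k _; rewrite mulrC ler_wpM2r ?b_ge0 ?mesh_ge.
have PS : P n <= (mesh n t / Num.sqrt 2 * (d 0 + S)) ^+ 2.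
  have := sum_dissipation_le b_ge0 d_ge0 (lexx 0) dis; rewrite -/S addr0 => dS.
  have : P n <= mesh n t ^+ 2 * \sum_(k < n) d k.+1 * (b k + d k - d k.+1).
    rewrite /P mulr_sumr; apply: ler_sum => k _; rewrite /be mulrA -expr2.
    rewrite ler_wpM2r ?dis// ler_sqr ?nnegrE ?mesh_ge//.
    by rewrite ltW// tau_gt0.
  move=> /le_trans; apply; rewrite !exprMn exprVn sqr_sqrtr// -mulrA ler_wpM2l ?sqr_ge0//.
  by rewrite mulrC; apply: (le_trans dS); rewrite ler_pM2r ?invr_gt0// gerBl sqr_ge0.
have s2 : 1 <= Num.sqrt 2 :> R by rewrite -[leLHS]sqrtr1 ler_wsqrtr// ler1n.
have is2 : (Num.sqrt 2)^-1 <= 1 :> R by rewrite invf_le1// (lt_le_trans ltr01).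
have is0 : 0 <= (Num.sqrt 2)^-1 :> R by rewrite invr_ge0 sqrtr_ge0.
have : Num.sqrt (P n) <= mesh n t / Num.sqrt 2 * (d 0 + S).
  rewrite -[leRHS]ger0_norm ?mulr_ge0 ?addr_ge0//.
  by rewrite -sqrtr_sqr ler_wsqrtr.
have : mesh n t / Num.sqrt 2 * S <= mesh n t * S by rewrite ler_wpM2r// ler_piMr.
have : mesh n t * S <= mesh n t * Wtot by rewrite ler_wpM2l.
move: QS; lra.
Qed.

Theorem abstract_error_estimate (Wtot : R) : \sum_(k < n) b k <= Wtot ->
  let B := mesh n t * ((Num.sqrt 2)^-1 * d 0 + 2 * Wtot) in
  [/\ 0 <= B,
      forall k s, (k < n)%N -> s \in `[t k, t k.+1] -> energy_norm (step_error k s) <= B &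
      \sum_(k < n) \int[leb]_(x in `]t k, t k.+1[) step_gradient_error k x <= B ^+ 2].
Proof.
move=> bW B; have PB := bound_le bW.
have PQ0 : 0 <= Num.sqrt (P n) + Q n by rewrite addr_ge0 ?sqrtr_ge0 ?Q_ge0.
have B0 := le_trans PQ0 PB; split=> //.
- move=> k s kn sk; have Ek := step_error_le kn sk (node_error_le (ltnW kn)).
  have E0 : 0 <= energy_norm (step_error k s) by exact: sqrtr_ge0.
  have g0 : 0 <= \int[leb]_(x in `]t k, s[) step_gradient_error k x.
    by apply: Rintegral_ge0 => y _; rewrite addr_ge0 ?sqr_ge0.
  have bm := bound_mono kn.
  have PQk : 0 <= Num.sqrt (P k.+1) + Q k.+1 by rewrite addr_ge0 ?sqrtr_ge0 ?Q_ge0.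
  apply: le_trans PB; apply: le_trans bm.
  rewrite -ler_sqr ?nnegrE//; apply: le_trans Ek.
  by rewrite lerDl addr_ge0.
- have := node_error_le (leqnn n) => En.
  have : gradient_error_sum n <= (Num.sqrt (P n) + Q n) ^+ 2.
    by apply: le_trans En; rewrite lerDr sqr_ge0.
  move=> /le_trans; apply.
  by rewrite ler_sqr ?nnegrE.
Qed.

Lemma interpolant_error_estimate (Wtot : R) : \sum_(k < n) b k <= Wtot ->
  let B := mesh n t * ((Num.sqrt 2)^-1 * d 0 + 2 * Wtot) in
  [/\ 0 <= B,
      forall s, 0 <= s <= T -> energy_norm (u s - pi (affine_interpolant n t un s),
        w s - affine_interpolant n t wn s) <= B &
      (L2_sqnorm leb NV `]0%R, T[ (fun s => v s - affine_interpolant n t un s)%R +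
       L2_sqnorm leb NV `]0%R, T[ (fun s => v s - constant_interpolant n t un s)%R <=
       (B ^+ 2)%:E)%E].
Proof.
move=> bW B; have [B0 errB gradB] := abstract_error_estimate bW; split=> //.
  move=> s sT; have [kn ks] := interval_index_spec ht T_gt0 sT.
  exact: errB kn ks.
(* Open steps suffice: nodes are negligible for the integrals, and a left node belongs to the
   preceding step. *)
have idx k x : (k < n)%N -> x \in `]t k, t k.+1[ -> interval_index n t x = k.
  move=> kn; rewrite in_itv/= => /andP[k1 k2].
  by apply: (interval_index_step ht kn); rewrite k1 ltW.
pose ga x := NV (v x - affine_interpolant n t un x) ^+ 2.
pose gc x := NV (v x - constant_interpolant n t un x) ^+ 2.
have gaE k x : (k < n)%N -> x \in `]t k, t k.+1[ -> ga x = NV (v x - u_affine k x) ^+ 2.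
  by move=> kn xk; rewrite /ga /affine_interpolant (idx _ _ kn xk).
have gcE k x : (k < n)%N -> x \in `]t k, t k.+1[ -> gc x = NV (v x - un k.+1) ^+ 2.
  by move=> kn xk; rewrite /gc /constant_interpolant (idx _ _ kn xk).
have mitv k : measurable (`]t k, t k.+1[ : set (measurableTypeR R)) by exact: measurable_itv.
have igc k : (k < n)%N -> leb.-integrable `]t k, t k.+1[ (EFin \o gc).
  move=> kn; have [h _] := step_gradient_integrable kn (lexx _).
  by apply: eq_integrable h => // x; rewrite inE => xk /=; rewrite (gcE k).
have iga k : (k < n)%N -> leb.-integrable `]t k, t k.+1[ (EFin \o ga).
  move=> kn; have [_ h] := step_gradient_integrable kn (lexx _).
  by apply: eq_integrable h => // x; rewrite inE => xk /=; rewrite (gaE k).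
have mR g k : leb.-integrable `]t k, t k.+1[ (EFin \o g) -> measurable_fun `]t k, t k.+1[ g.
  by move=> h; apply/measurable_EFinP; exact: measurable_int h.
rewrite /L2_sqnorm (ge0_integral_partition ht (g := ga))//; first last.
- by move=> k kn; apply: mR; exact: iga.
- by move=> x; exact: sqr_ge0.
rewrite (ge0_integral_partition ht (g := gc))//; first last.
- by move=> k kn; apply: mR; exact: igc.
- by move=> x; exact: sqr_ge0.
apply: le_trans (_ : (_ <= (\sum_(k < n)
    \int[leb]_(x in `]t k, t k.+1[) step_gradient_error k x)%:E)%E) _; last by rewrite lee_fin.
rewrite -big_split -sumEFin/=; apply: lee_sum => k _; have kn := ltn_ord k.
rewrite -(fineK (integrable_fin_num _ (iga k kn)))// -(fineK (integrable_fin_num _ (igc k kn)))//.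
rewrite -EFinD lee_fin.
have -> : \int[leb]_(x in `]t k, t k.+1[) step_gradient_error k x =
    \int[leb]_(x in `]t k, t k.+1[) (ga x + gc x).
  apply: eq_Rintegral => x; rewrite inE => xk.
  by rewrite (gaE k)// (gcE k)// addrC.
by rewrite RintegralD//; [exact: iga|exact: igc].
Qed.

End time_error.
End abstract_scheme.

(** * Problem (P) and scheme (IE) *)

Section model_problem.
Context (R : realType) (n : nat) (Omega : lipschitz_domain R n) (T : R).
Context (dR : measure_display) (Rr : measurableType dR).
Context (mu : {finite_measure set Rr -> \bar R}) (a : R) (c : Rr -> R).
Hypotheses (T_gt0 : 0 < T) (a_ge0 : 0 <= a) (c_gt0 : forall r, 0 < c r).
Hypotheses (mc : measurable_fun setT c) (c_lty : (\int[mu]_r (c r)%:E < +oo)%E).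
Context (K : Rr -> set (L2H Omega)).
Hypotheses (Kclosed : forall r, closedH (K r)) (Kconvex : forall r, convexH (K r)).
Context (u0 : L2H Omega * L2Hd Omega) (w0 : Rr -> L2H Omega).
Hypothesis adm0 : admissible mu K u0.1 w0.
Context (lap_u0 : L2H Omega) (lap_u0P : is_laplacian u0 lap_u0).
Context (f : R -> L2H Omega) (fBV : in_BVr setT (@normH _ _ Omega) T f).

Notation H := (L2H Omega).
Notation V := (L2H Omega * L2Hd Omega)%type.
Notation M := (Rr -> L2H Omega).
Notation kappa := (1 + a).
Notation ip := (ip Omega).
Notation ipM := (@ipM R n Omega _ _ mu c).
Notation SM := (@spaceM R n Omega _ _ mu c).
Notation NH := (@normH R n Omega).
Notation NV := (@normV R n Omega).
Notation leb := (@lebesgue_measure R).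

Let ipH (x y : H) : R := ip x y.
Let ipV (x y : V) : R := ipd x.2 y.2.
Let fstV (x : V) : H := x.1.
Let cst_M (x : H) : M := fun=> x.
(** The family of constraints as one set in M, so that the pointwise inclusions become a single
    inequality in [ipM]. *)
Let KM : set M := [set y | SM y /\ {ae mu, forall r, K r (y r)}].

Let sib : semi_inner setT ipH NH := semi_inner_ip Omega.
Let siV : semi_inner setT ipV NV := semi_inner_ipd Omega.
Let siM : semi_inner SM ipM (normM mu c) := semi_inner_ipM Omega c_gt0 mc c_lty.

Let kappa_gt0 : 0 < kappa. Proof. by rewrite ltr_wpDr. Qed.

Let fstV_lin (b : R) (x y : V) : fstV (b *: x + y) = b *: fstV x + fstV y.
Proof. exact: fst_lin. Qed.

Let cst_M_lin (b : R) (x y : H) : cst_M (b *: x + y) = b *: cst_M x + cst_M y.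
Proof. by []. Qed.

Let cst_M_S (x : H) : SM (cst_M x). Proof. exact: spaceM_cst. Qed.

Let KM_convex (x y : M) (b : R) : KM x -> KM y -> 0 <= b <= 1 ->
  KM ((1 - b) *: x + b *: y).
Proof.
move=> [Sx Kx] [Sy Ky] b01; split.
  by apply: (siSD siM); exact: (siSZ siM).
have b01' : 0 <= 1 - b <= 1 by move: b01 => /andP[? ?]; apply/andP; split; lra.
apply: (filterS2 _ _ Kx Ky) => r Kxr Kyr.
have := Kconvex Kxr Kyr b01'; rewrite subKr; exact: id.
Qed.

Section exact_solutions.
Context (u ut : R -> H) (v : R -> V) (w wt : R -> M).
Hypothesis uvw : exact_solution mu c K kappa T f u0 w0 u ut v w wt.

(** Forgets that the approximating simple functions take values in [H10], to match the form [ipV] on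
    all pairs. *)
Lemma exact_solution_L2V : in_L2 leb setT NV `]0, T[ v.
Proof.
have [_ [[[_ [s sS sv]] voo] _] _ _ _] := uvw; split=> //; split=> //; exists s => // k.
by have [? ? _] := sS k; split.
Qed.

Lemma exact_solution_weak : {ae leb, forall s, s \in `]0, T[ ->
  [/\ H10 (v s), forall x, ipH x (u s) = ipH x (fstV (v s)),
      forall z, SM z -> ipM z (cst_M (u s)) = ipM z (cst_M (fstV (v s))),
      forall phi, H10 phi ->
        energy_ip ipH ipM kappa (ut s, wt s) (fstV phi, cst_M (fstV phi)) + ipV (v s) phi =
        ipH (f s) (fstV phi) &
      KM (cst_M (u s) - w s) /\
      forall y, KM y -> ipM (wt s) (y - (cst_M (u s) - w s)) <= 0]}.
Proof.
have [_ [[[vH _] _] uv] [cw _ [[wtS _] _] _] _ eqs] := uvw.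
apply: (@filterS2 _ _ (ae_filter_ringOfSetsType leb) _ _ _ _ uv eqs) => s us es sT.
have {us} us := us sT; have {es} [[g Gg weak] cone] := es sT.
have ipus x : ipH x (u s) = ipH x (fstV (v s)).
  rewrite (si_sym sib (x := x) (y := u s) I I) (si_sym sib (x := x) (y := fstV (v s)) I I).
  exact: ip_eqH.
have Sws : SM (w s) by apply: (cw s _).1; exact: subset_itv_oo_cc.
have Swts : SM (wt s) := wtS s sT.
have Sx := siSB siM (cst_M_S (u s)) Sws.
split; first exact: vH.
- exact: ipus.
- by move=> z _; apply: eq_Rintegral => r _; congr (_ * _); exact: ipus.
- move=> phi Hphi; rewrite -[RHS](weak phi Hphi) (is_G_pairing phi.1 Gg); reflexivity.
- split; first by split=> //; apply: filterS cone => r [].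
  move=> y [Sy Ky]; apply: (ipM_le0 c_gt0 mc Swts (siSB siM Sy Sx)).
  apply: (filterS2 _ _ Ky cone) => r Kyr [_ [_ h]]; exact: h.
Qed.

End exact_solutions.

Section euler_solutions.
Context (N : nat) (t : nat -> R) (ht : time_partition T N t).
Context (un : nat -> V) (wn : nat -> M).
Hypothesis uwn : euler_solution mu c K kappa u0 w0 N t (fun k => f (t k)) un wn.

Let slackn := slack fstV cst_M un wn.
Let veln := velocity fstV t un wn (kappa^-1 *: (f 0 + lap_u0)).

Let wn_SM k : (k <= N)%N -> SM (wn k).
Proof. by case: uwn => _ + _ => /(_ k) h /h[]. Qed.

(** With x = u^(k+1) - w^k and p its projection, the update says that the new slack is p and that
    w^(k+1) - w^k = x - p, which lies in the normal cone at p; dividing by the step keeps it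
    there. *)
Lemma euler_normal_cone k : (k < N)%N ->
  {ae mu, forall r, normal_cone (K r) (slackn k.+1 r) (backward_difference t wn k r)}.
Proof.
move=> kN; case: uwn => _ _ /(_ k kN)[_]; apply: filterS => r [p pP wp].
have nc := is_projection_normal_cone (@Kconvex r) pP.
have wp0 : NH (wn k.+1 r - ((un k.+1).1 - p)) = 0 by exact: eqH_normH.
apply: normal_coneZ.
  by rewrite invr_ge0 subr_ge0 ltW//; case: ht => _ _; apply.
apply: (normal_cone_eqH (@Kclosed r) nc).
- rewrite (_ : _ - p = - (wn k.+1 r - ((un k.+1).1 - p))); last first.
    by rewrite opprB addrAC.
  by rewrite (siN_opp sib).
- rewrite [X in NH X](_ : _ = wn k.+1 r - ((un k.+1).1 - p))//.
  by rewrite [(un k.+1).1 - _ - p]addrAC opprB subrKA.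
Qed.

Lemma euler_slack_K k : (k <= N)%N -> KM (slackn k).
Proof.
move=> kN; split; first exact: (siSB siM (cst_M_S _) (wn_SM kN)).
case: k kN => [_|k kN]; last by apply: filterS (euler_normal_cone kN) => r [].
have [[e1 e2] _ _] := uwn.
have -> : slackn 0 = cst_M (fstV u0) - w0 by rewrite -e1 -e2.
exact: adm0.
Qed.

Lemma euler_cone_ipM k (y : M) : (k < N)%N -> KM y ->
  ipM (backward_difference t wn k) (y - slackn k.+1) <= 0.
Proof.
move=> kN [Sy Ky]; apply: (ipM_le0 c_gt0 mc).
- by apply: (siSZ siM); exact: (siSB siM (wn_SM kN) (wn_SM (ltnW kN))).
- by apply: (siSB siM Sy); have [] := euler_slack_K kN.
- by apply: (filterS2 _ _ Ky (euler_normal_cone kN)) => r Kyr [_]; exact.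
Qed.

Lemma euler_weak k (phi : V) : (k <= N)%N -> H10 phi ->
  energy_ip ipH ipM kappa (veln k) (fstV phi, cst_M (fstV phi)) + ipV (un k) phi =
  ipH (f (t k)) (fstV phi).
Proof.
case: k => [_|k kN] Hphi.
  (* At k = 0 the prescribed velocity makes the equation hold: kappa times it is f(0) + Laplacian
     u^0, and the Laplacian cancels the gradient term. *)
  have [[e1 _] _ _] := uwn; have [t0 _ _] := ht.
  rewrite e1 t0 -[energy_ip _ _ _ _ _]/(kappa * ipH (kappa^-1 *: (f 0 + lap_u0)) phi.1 +
    ipM 0 (fun=> phi.1)) (si0l siM); last exact: cst_M_S.
  rewrite (siZl sib _ I I) mulVKf ?gt_eqF ?kappa_gt0// (siDl sib I I I).
  by rewrite /ipH (laplacian_H10 lap_u0P Hphi) addr0 subrK.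
have [_ _ /(_ k kN)[[g Gg weak] _]] := uwn.
rewrite -[RHS](weak phi Hphi) (is_G_pairing phi.1 Gg); reflexivity.
Qed.

End euler_solutions.

(** Evaluates d_0 with x = f(0) + Laplacian u^0; it carries the same factor 1 / sqrt kappa as the
    b_k, which can then be pulled out of the bound. *)
Let rest_energy (x : H) : energy_norm ipH ipM kappa (kappa^-1 *: x, 0) = NH x / Num.sqrt kappa.
Proof.
have SM0 : SM 0 by exact: si_0 siM.
have -> : energy_norm ipH ipM kappa (kappa^-1 *: x, 0) = Num.sqrt (kappa^-1 * ipH x x).
  rewrite /energy_norm /energy_ip [ipM _ _](si0l siM SM0) addr0.
  rewrite [ipH _ _](siZl sib _ I I) (siZr sib _ I I) mulVKf// gt_eqF//.
rewrite sqrtrM ?invr_ge0 ?ltW// sqrtrV ?ltW// (si_norm sib I) mulrC; reflexivity.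
Qed.

Lemma euler_error_estimate (u ut : R -> H) (v : R -> V) (w wt : R -> M)
    (N : nat) (t : nat -> R) (un : nat -> V) (wn : nat -> M) :
  exact_solution mu c K kappa T f u0 w0 u ut v w wt -> time_partition T N t ->
  euler_solution mu c K kappa u0 w0 N t (fun k => f (t k)) un wn ->
  let B := mesh N t / Num.sqrt kappa *
    ((Num.sqrt 2)^-1 * NH (f 0 + lap_u0) + 2 * total_variation_on NH 0 T f) in
  [/\ 0 <= B,
      forall s, 0 <= s <= T ->
        kappa * NH (u s - (affine_interpolant N t un s).1) ^+ 2 +
        normM mu c (w s - affine_interpolant N t wn s) ^+ 2 <= B ^+ 2 &
      (L2_sqnorm leb NV `]0%R, T[ (fun s => v s - affine_interpolant N t un s)%R +
       L2_sqnorm leb NV `]0%R, T[ (fun s => v s - constant_interpolant N t un s)%R <=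
       (B ^+ 2)%:E)%E].
Proof.
move=> uvw ht uwn B; have [uH1 _ wH1 [u_0 w_0] _] := uvw.
have [[un0 wn0] unwn _] := uwn; have [_ ub _ _] := fBV.
have [cw _ _ _] := wH1.
have Sw0 : SM (w 0) by apply: (cw 0 _).1; rewrite in_itv/= lexx ltW.
have Swn0 : SM (wn 0%N) by have [] := unwn 0%N (leq0n N).
have init_u : NH (u 0 - fstV (un 0%N)) = 0 by rewrite un0; exact: eqH_normH.
have init_w : normM mu c (w 0 - wn 0%N) = 0.
  by apply: (eqM_normM c_gt0 mc c_lty Sw0 Swn0); rewrite wn0.
have W_inside k s : (k < N)%N -> s \in `]t k, t k.+1[ ->
    NH (f s - f (t k.+1)) <= step_variation NH f t k.
  move=> kN sk; rewrite (siN_subC sib I I).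
  apply: (le_trans _ (step_variation_ge sib ub ht kN _)); last first.
    by move: sk; rewrite in_itv; exact: id.
  by rewrite lerDr; exact: (siN_ge0 sib).
have total : \sum_(k < N) step_variation NH f t k / Num.sqrt kappa <=
    total_variation_on NH 0 T f / Num.sqrt kappa.
  by rewrite -mulr_suml ler_pM2r ?invr_gt0 ?sqrtr_gt0//; exact: (sum_step_variation sib ub ht).
have := interpolant_error_estimate sib siV siM fstV_lin cst_M_lin cst_M_S kappa_gt0 T_gt0 ht
  uH1 wH1 (exact_solution_L2V uvw) KM_convex (exact_solution_weak uvw)
  (fun k kN => (unwn k kN).1) (fun k kN => (unwn k kN).2) (euler_slack_K ht uwn)
  (euler_weak ht uwn) (euler_cone_ipM ht uwn)
  (fun k kN => step_variation_increment sib ub ht kN) W_inside init_u init_w total.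
rewrite /= rest_energy.
rewrite (_ : mesh N t * _ = B); last by rewrite /B; ring.
move=> [B0 err grad]; split=> // s sT; have := err s sT.
set z := w s - _ => E.
have Sz : SM z.
  apply: (siSB siM); first by apply: (cw s _).1; rewrite in_itv.
  have [kN _] := interval_index_spec ht T_gt0 sT.
  have S0 := (unwn _ (ltnW kN)).2; have S1 := (unwn _ kN).2.
  exact: (siSD siM S0 (siSZ siM _ (siSB siM S1 S0))).
have E0 : 0 <= energy_norm ipH ipM kappa (u s - fstV (affine_interpolant N t un s), z).
  exact: sqrtr_ge0.
move: E; rewrite -ler_sqr ?nnegrE// => /(le_trans _); apply.
have sE := semi_inner_energy sib siM kappa_gt0.
rewrite (siN_sqr sE (x := (_, z)) (conj I Sz)) /energy_ip /=.
by rewrite (siN_sqr sib I) (siN_sqr siM Sz).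
Qed.

End model_problem.

(** Since kappa = 1 + a >= 1, dropping the weight of the energy norm only decreases the error. *)
Lemma weighted_sqrt_le (R : realType) (x y k B : R) : 0 <= B -> 1 <= k ->
  k * x ^+ 2 + y ^+ 2 <= B ^+ 2 -> Num.sqrt (x ^+ 2 + y ^+ 2) <= B.
Proof.
move=> B0 k1 h; rewrite -[leRHS]ger0_norm// -sqrtr_sqr ler_wsqrtr//.
apply: le_trans h; rewrite lerD2r -[leLHS]mul1r ler_wpM2r ?sqr_ge0//.
Qed.

Theorem theorem4p4 (R : realType) (n : nat) (Omega : lipschitz_domain R n)
    (T : R) (hT : 0 < T)
    (dR : measure_display) (Rr : measurableType dR)
    (mu : {finite_measure set Rr -> \bar R}) (hmu : measure_is_complete mu)
    (a : R) (ha : 0 <= a)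
    (c : Rr -> R) (hc0 : forall r, 0 < c r) (hcm : measurable_fun setT c)
    (hc : (\int[mu]_r (c r)%:E < +oo)%E)
    (K : Rr -> set (L2H Omega))
    (hKclosed : forall r, closedH (K r)) (hKconvex : forall r, convexH (K r))
    (hK0 : forall r, K r 0) (hKm : jointly_measurable K)
    (u0 : L2H Omega * L2Hd Omega) (w0 : Rr -> L2H Omega)
    (hu0 : H10 u0) (hw0 : spaceM mu c w0) (h0 : admissible mu K u0.1 w0)
    (lap_u0 : L2H Omega) (hlap : is_laplacian u0 lap_u0)
    (f : R -> L2H Omega) (hf : in_BVr setT (@normH _ _ Omega) T f)
    (u ut : R -> L2H Omega) (v : R -> L2H Omega * L2Hd Omega)
    (w wt : R -> Rr -> L2H Omega)
    (hexact : exact_solution mu c K (1 + a) T f u0 w0 u ut v w wt)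
    (N : nat) (t : nat -> R) (ht : time_partition T N t)
    (un : nat -> L2H Omega * L2Hd Omega) (wn : nat -> Rr -> L2H Omega)
    (heuler : euler_solution mu c K (1 + a) u0 w0 N t (fun k => f (t k)) un wn) :
  let kappa := 1 + a in
  let tau := mesh N t in
  let u_tau := affine_interpolant N t un in
  let ubar_tau := constant_interpolant N t un in
  let w_tau := affine_interpolant N t wn in
  let sqnorm_L2V := L2_sqnorm lebesgue_measure (@normV _ _ Omega) (`]0, T[) in
  let err (s : R) := Num.sqrt (normH (u s - (u_tau s).1) ^+ 2
                               + normM mu c (w s - w_tau s) ^+ 2) in
  (maxe
    (ereal_sup [set (err s)%:E | s in [set s : R | (0 <= s <= T)%R]])
    (sqrte (sqnorm_L2V (fun s => v s - u_tau s)%R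
            + sqnorm_L2V (fun s => v s - ubar_tau s)%R))
   <= (tau / Num.sqrt kappa
       * ((Num.sqrt 2)^-1 * normH (f 0 + lap_u0)
          + 2 * total_variation_on (@normH _ _ Omega) 0 T f))%:E)%E.
Proof.
cbv zeta.
have [B0 errB gradB] := euler_error_estimate hT ha hc0 hcm hc hKclosed hKconvex h0 hlap hf
  hexact ht heuler.
rewrite ge_max; apply/andP; split.
  apply: ge_ereal_sup => _ [s sT <-]; rewrite lee_fin.
  have k1 : 1 <= 1 + a by rewrite lerDl.
  exact: (weighted_sqrt_le B0 k1 (errB s sT)).
set B := mesh _ _ / _ * _ in B0 gradB *.
have -> : B%:E = sqrte (B ^+ 2)%:E by rewrite /= sqrtr_sqr ger0_norm.
by rewrite lee_sqrt ?lee_fin ?sqr_ge0.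
Qed.
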